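(* Let $p>3$ be a prime, and let the integers $b(n)$ be defined by $$\sum_{n=1}^\infty b(n)q^n:=\eta^3(6z)\,\eta^3(2z)\in S_3\left(\Gamma_0(12),\left(\tfrac{-3}{d}\right)\right),$$ where $\eta$ is Dedekind's eta function and $q=e^{2\pi i z}$. Then $${_3}G_3\left[\begin{array}{ccc}\frac12,&\frac13,&\frac23\\ 0,&0,&0\end{array}\Big|\,1\right]_p=b(p),$$ where ${_3}G_3[\cdots]_p$ is McCarthy's $p$-adic hypergeometric function.
   Context: Dedekind's eta function is $\eta(z):=q^{1/24}\prod_{n=1}^\infty(1-q^n)$, where $q:=e^{2\pi iz}$ and $\mathrm{Im}(z)>0$. Let $p$ be an odd prime, $\mathbb{F}_p$ the field with $p$ elements, $\mathbb{Z}_p$ the $p$-adic integers, $\mathbb{Q}_p$ the $p$-adic numbers. $\omega:\mathbb{F}_p^\times\to\mathbb{Z}_p^\times$ is the Teichmüller character: $\omega(a)$ is the $(p-1)$-th root of unity in $\mathbb{Z}_p$ with $\omega(a)\equiv a\pmod p$; $\overline{\omega}=\omega^{-1}$; all powers of $\omega$ (including the trivial character) are extended to $\mathbb{F}_p$ by the value $0$ at $0$. For $x\in\mathbb{Q}$, $\lfloor x\rfloor$ is the greatest integer $\le x$ and $\langle x\rangle:=x-\lfloor x\rfloor$. The $p$-adic gamma function is defined on positive integers by $\Gamma_p(n):=(-1)^n\prod_{0<j<n,\ p\nmid j}j$, extended continuously to $\Gamma_p:\mathbb{Z}_p\to\mathbb{Z}_p^\times$ by $\Gamma_p(0):=1$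 and $\Gamma_p(x):=\lim_{x_n\to x}\Gamma_p(x_n)$ for $x\neq0$, where $x_n$ runs through any sequence of positive integers $p$-adically approaching $x$. McCarthy's $p$-adic hypergeometric function: for $t\in\mathbb{F}_p$, a positive integer $n$, and $a_k,b_k\in\mathbb{Q}\cap\mathbb{Z}_p$ ($1\le k\le n$), $${_n}G_n\left[\begin{array}{cccc}a_1,&a_2,&\ldots,&a_n\\ b_1,&b_2,&\ldots,&b_n\end{array}\Big|\,t\right]_p:=\frac{-1}{p-1}\sum_{a=0}^{p-2}(-1)^{an}\,\overline{\omega}^a(t)\prod_{k=1}^n(-p)^{-\lfloor\langle a_k\rangle-\frac{a}{p-1}\rfloor-\lfloor\langle -b_k\rangle+\frac{a}{p-1}\rfloor}\frac{\Gamma_p(\langle a_k-\frac{a}{p-1}\rangle)}{\Gamma_p(\langle a_k\rangle)}\cdot\frac{\Gamma_p(\langle -b_k+\frac{a}{p-1}\rangle)}{\Gamma_p(\langle -b_k\rangle)}\in\mathbb{Q}_p.$$ *)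

(* Defs.v *)
From HB Require Import structures.
From mathcomp Require Import all_boot all_order all_algebra.
From mathcomp Require Import complex.
From mathcomp Require Import all_classical all_reals all_analysis.

Set Implicit Arguments.
Unset Strict Implicit.
Unset Printing Implicit Defensive.

Import Order.TTheory GRing.Theory Num.Theory numFieldNormedType.Exports.

Local Open Scope classical_set_scope.
Local Open Scope ring_scope.

(* The ring Z_p as the inverse limit of the Z/p^n: an element is the sequence
   of its residues, [padic_res x n] being the representative of x modulo p^n in
   [0, p^n) (the coherence condition at n forces this bound). *)
Record padic_int (p : nat) (p_pr : prime p) := PadicInt {
  padic_res : nat -> nat;
  _ : `[< forall n, padic_res n.+1 %% p ^ n = padic_res n >]%N
}.

HB.instance Definition _ (p : nat) (p_pr : prime p) :=
  [isSub for @padic_res p p_pr].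
HB.instance Definition _ (p : nat) (p_pr : prime p) :=
  [Choice of padic_int p_pr by <:].

Section PadicRing.
Variables (p : nat) (p_pr : prime p).
Local Notation Zp := (padic_int p_pr).
Implicit Types x y z : Zp.

Lemma padic_eqP x y : padic_res x =1 padic_res y -> x = y.
Proof. by move=> /funext; apply: val_inj. Qed.

Lemma padic_resS x n : (padic_res x n.+1 %% p ^ n = padic_res x n)%N.
Proof. by case: x => x /= /asboolP. Qed.

Lemma padic_res_mod x n : (padic_res x n %% p ^ n = padic_res x n)%N.
Proof. by rewrite -[in LHS]padic_resS modn_mod padic_resS. Qed.

Definition padic_of (f : nat -> nat)
    (fP : forall n, f n.+1 = f n %[mod p ^ n]) : Zp.
Proof.
exists (fun n => (f n %% p ^ n)%N); apply/asboolP => n.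
by rewrite modn_dvdm ?fP// dvdn_exp2l.
Defined.

Lemma padic_nat_subproof (k : nat) n : k = k %[mod p ^ n].
Proof. by []. Qed.

Lemma padic_add_subproof x y n :
  (padic_res x n.+1 + padic_res y n.+1 =
   padic_res x n + padic_res y n %[mod p ^ n])%N.
Proof. by rewrite -modnDm !padic_resS. Qed.

Lemma padic_mul_subproof x y n :
  (padic_res x n.+1 * padic_res y n.+1 =
   padic_res x n * padic_res y n %[mod p ^ n])%N.
Proof. by rewrite -modnMm !padic_resS. Qed.

Lemma padic_res_le x n : (padic_res x n <= p ^ n)%N.
Proof. by rewrite -padic_res_mod ltnW // ltn_mod expn_gt0 prime_gt0. Qed.

Lemma padic_opp_subproof x n :
  (p ^ n.+1 - padic_res x n.+1 = p ^ n - padic_res x n %[mod p ^ n])%N.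
Proof.
apply/eqP; rewrite -(eqn_modDr (padic_res x n.+1)) subnK ?padic_res_le//.
rewrite -[X in _ == X]modnDmr padic_resS subnK ?padic_res_le//.
by rewrite modnn expnS modnMl.
Qed.

Definition padic_nat (k : nat) : Zp :=
  @padic_of (fun=> k) (padic_nat_subproof k).
Definition padic_add x y : Zp :=
  @padic_of (fun n => padic_res x n + padic_res y n)%N
    (padic_add_subproof x y).
Definition padic_opp x : Zp :=
  @padic_of (fun n => p ^ n - padic_res x n)%N (padic_opp_subproof x).
Definition padic_mul x y : Zp :=
  @padic_of (fun n => padic_res x n * padic_res y n)%N
    (padic_mul_subproof x y).

Lemma padic_addA : associative padic_add.
Proof.
by move=> x y z; apply: padic_eqP => n /=; rewrite modnDml modnDmr addnA.
Qed.

Lemma padic_addC : commutative padic_add.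
Proof. by move=> x y; apply: padic_eqP => n /=; rewrite addnC. Qed.

Lemma padic_add0 : left_id (padic_nat 0) padic_add.
Proof. by move=> x; apply: padic_eqP => n /=; rewrite modnDml padic_res_mod. Qed.

Lemma padic_addN : left_inverse (padic_nat 0) padic_opp padic_add.
Proof.
move=> x; apply: padic_eqP => n /=.
by rewrite modnDml subnK ?padic_res_le// modnn mod0n.
Qed.

HB.instance Definition _ := GRing.isZmodule.Build Zp
  padic_addA padic_addC padic_add0 padic_addN.

Lemma padic_mulA : associative padic_mul.
Proof.
by move=> x y z; apply: padic_eqP => n /=; rewrite modnMml modnMmr mulnA.
Qed.

Lemma padic_mulC : commutative padic_mul.
Proof. by move=> x y; apply: padic_eqP => n /=; rewrite mulnC. Qed.

Lemma padic_mul1 : left_id (padic_nat 1) padic_mul.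
Proof.
by move=> x; apply: padic_eqP => n /=; rewrite modnMml mul1n padic_res_mod.
Qed.

Lemma padic_mulDl : left_distributive padic_mul padic_add.
Proof.
move=> x y z; apply: padic_eqP => n /=.
by rewrite modnMml modnDml modnDmr mulnDl.
Qed.

Lemma padic_oner_neq0 : padic_nat 1 != padic_nat 0.
Proof.
apply/eqP => /(congr1 (fun x : Zp => padic_res x 1)) /=.
by rewrite expn1 mod0n modn_small // prime_gt1.
Qed.

HB.instance Definition _ := GRing.Zmodule_isComNzRing.Build Zp
  padic_mulA padic_mulC padic_mul1 padic_mulDl padic_oner_neq0.

Definition padic_unit : {pred Zp} := fun x => `[< exists y, y * x = 1 >].

Definition padic_inv x : Zp := xget x [set y | y * x = 1].

Lemma padic_mulVx : {in padic_unit, left_inverse 1 padic_inv *%R}.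
Proof.
by move=> x /asboolP[y yx]; rewrite /padic_inv; case: xgetP => [//|/(_ y)].
Qed.

Lemma padic_unitPl x y : y * x = 1 -> padic_unit x.
Proof. by move=> yx; apply/asboolP; exists y. Qed.

Lemma padic_inv_out : {in [predC padic_unit], padic_inv =1 id}.
Proof.
move=> x xNunit; rewrite /padic_inv; case: xgetP => // y _ /= yx.
by case/negP: xNunit; exact: padic_unitPl yx.
Qed.

HB.instance Definition _ := GRing.ComNzRing_hasMulInverse.Build Zp
  padic_mulVx padic_unitPl padic_inv_out.

Lemma padic_resD x m n : (padic_res x (m + n) %% p ^ m = padic_res x m)%N.
Proof.
elim: n => [|n IHn]; first by rewrite addn0 padic_res_mod.
rewrite addnS -[RHS]IHn -[in RHS]padic_resS modn_dvdm//.
by rewrite dvdn_exp2l// leq_addr.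
Qed.

Lemma padic_neq0 x : x != 0 -> exists n, padic_res x n != 0%N.
Proof.
move=> x0; apply: contrapT => xN; move/eqP: x0; apply.
apply: padic_eqP => n; rewrite [RHS]mod0n; apply/eqP.
by case: eqP => // /eqP xn; case: xN; exists n.
Qed.

Lemma padic_mulf_eq0 x y : x * y = 0 -> (x == 0) || (y == 0).
Proof.
move=> xy0; case: (eqVneq x 0) => //= /padic_neq0[m xm].
case: (eqVneq y 0) => //= /padic_neq0[n yn]; exfalso.
have := congr1 (fun z : Zp => padic_res z (m + n)) xy0.
rewrite /= mod0n => /eqP.
set a := padic_res x (m + n); set b := padic_res y (m + n).
have pam : ~~ (p ^ m %| a)%N by rewrite /dvdn padic_resD.
have pbn : ~~ (p ^ n %| b)%N by rewrite /dvdn /b addnC padic_resD.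
have a0 : (0 < a)%N by case: (a) pam => //; rewrite dvdn0.
have b0 : (0 < b)%N by case: (b) pbn => //; rewrite dvdn0.
rewrite -/(dvdn _ _) pfactor_dvdn ?muln_gt0 ?a0//.
rewrite lognM// leqNgt => /negP; apply.
move: pam pbn; rewrite !pfactor_dvdn// -!ltnNge => am bn.
apply: (@leq_trans (logn p a + n)); first by rewrite ltn_add2l.
by rewrite leq_add2r ltnW.
Qed.

HB.instance Definition _ :=
  GRing.ComUnitRing_isIntegral.Build Zp padic_mulf_eq0.

(* The p-adic topology: residues converge pointwise in the discrete type nat. *)
HB.instance Definition _ := Topological.copy Zp
  (initial_topology (@padic_res p p_pr : Zp -> {ptws nat -> nat})).

Lemma padic_cvgP (u : nat -> Zp) x :
  u @ \oo --> x <->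
  forall k, \forall n \near \oo, padic_res (u n) k = padic_res x k.
Proof.
have init : u @ \oo --> x <->
    {ptws, (@padic_res p p_pr \o u) @ \oo --> padic_res x}.
  split=> [ux A /(@initial_continuous Zp {ptws nat -> nat}) /ux //|cv A].
  move=> /= [_ [[B Bop <-] Bx BA]].
  have /cv : nbhs (padic_res x : {ptws nat -> nat}) B.
    by rewrite nbhsE; exists B.
  by case=> N _ NB; exists N => // n /NB /BA.
rewrite init pointwise_cvgP; split=> cv k.
  have := cv k [set padic_res x k]; apply.
  exact: (@discrete_set1 nat).
move=> A /nbhs_singleton Ak; have [N _ NP] := cv k.
by exists N => // n /NP uk; rewrite /= uk.
Qed.

End PadicRing.


(* Q_p, with Z_p embedded by the ring morphism [tofrac]. *)
Definition padic (p : nat) (p_pr : prime p) := {fraction padic_int p_pr}.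

Section PadicFunctions.
Variables (p : nat) (p_pr : prime p).
Local Notation Zp := (padic_int p_pr).
Local Notation Qp := (padic p_pr).

Definition padic_modp (x : Zp) : 'F_p := (padic_res x 1)%:R.

Definition teichmuller (a : 'F_p) : Zp :=
  xget 0 [set w : Zp | w ^+ p.-1 = 1 /\ padic_modp w = a].

(* The power omega^m, extended by 0 at 0 for every m, including m = 0. *)
Definition teichmuller_exp (m : int) (a : 'F_p) : Zp :=
  if a == 0 then 0 else teichmuller a ^ m.

Definition Gammap_nat (n : nat) : Zp :=
  (-1) ^+ n * \prod_(1 <= j < n | ~~ (p %| j)%N) j%:R.

(* For x <> 0, the common limit of Gammap_nat along all the sequences of
   positive integers converging to x. *)
Definition Gammap (x : Zp) : Zp :=
  if x == 0 then 1 else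
  xget 1 [set y : Zp | forall u : nat -> nat,
    (forall n, (0 < u n)%N) ->
    ((u n)%:R : Zp) @[n --> \oo] --> x ->
    Gammap_nat (u n) @[n --> \oo] --> y].

Definition fracpart (x : rat) : rat := x - (Num.floor x)%:~R.

(* [ratr x] is the image in Z_p of a rational x whose denominator is prime to p.
   The parameters a and b are meant to range over such rationals. *)
Definition mcCarthyG (n : nat) (a b : n.-tuple rat) (t : 'F_p) : Qp :=
  -1 / (p%:R - 1) *
  \sum_(0 <= j < p.-1)
    (-1) ^+ (j * n) * tofrac (teichmuller_exp (- j%:Z) t) *
    \prod_(k < n)
      let ak := tnth a k in let bk := tnth b k in
      let r : rat := j%:R / (p%:R - 1) in
      (- p%:R) ^ (- Num.floor (fracpart ak - r)
                  - Num.floor (fracpart (- bk) + r)) *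
      (tofrac (Gammap (ratr (fracpart (ak - r)))) /
       tofrac (Gammap (ratr (fracpart ak)))) *
      (tofrac (Gammap (ratr (fracpart (- bk + r)))) /
       tofrac (Gammap (ratr (fracpart (- bk))))).

End PadicFunctions.

Section Eta.
Variable R : realType.
Implicit Type z : R[i].

(* exp (2 pi i z) *)
Definition expi2pi z : R[i] :=
  let x := 2 * pi * complex.Re z in
  let y := 2 * pi * complex.Im z in
  Complex (expR (- y) * cos x) (expR (- y) * sin x).

(* The topology on R[i] is that of the normed module [R[i]^o]; the factor
   q^(1/24) is exp (2 pi i z / 24). *)
Definition dedekind_eta z : R[i] :=
  let q := expi2pi z in
  expi2pi (z / 24) *
  lim ((\prod_(1 <= n < N) (1 - q ^+ n) : R[i]^o) @[N --> \oo]).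

End Eta.

(* Main.v *)
Require Import Defs.
From HB Require Import structures.
From mathcomp Require Import all_boot all_order all_algebra.
From mathcomp Require Import complex.
From mathcomp Require Import all_classical all_reals all_analysis.
From mathcomp Require Import all_fingroup cyclic.
From mathcomp Require Import ring lra zify.

(**
Both sides are expressed by the representation p = x^2 + 3 y^2, which exists when
p = 1 modulo 3: they are equal to 2 x^2 - 6 y^2. When p = 2 modulo 3, both vanish.

The hypergeometric side: from Gamma_p to points. By the formula of Gross and
Koblitz the values of Gamma_p at the multiples of 1/(p-1) are Gauss sums. It is
proved by Dwork's method. The additive character of F_p is the value of
exp (T + T^p / p) at a root pi of pi^(p-1) = - p; the Gauss sum is the trace of a
Frobenius operator, and an operator that commutes with it up to the factor p
reduces the trace to a one-dimensional cokernel, where Gamma_p appears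
([frob_trace], [gross_koblitz]). Gamma_p is only needed in products whose arguments
have an integral sum, which is why everything takes place over Q_p: see
[Gammap_product], whence the expression of Jacobi sums by Gamma_p
([Gammap_jacobi]). Together with the multiplication formula of Gauss for 2 and 3
([Gammap_mul]), each summand of McCarthy's function becomes a product of two
Jacobi sums ([hyp_term]), and the sum over all characters is the number of
solutions of 108 x (1 - x) y z (1 - y - z) = 1, up to a polynomial in p
([mcCarthyG_point_count]).

The number of points. It is written as a sum of quadratic characters. Substituting
v + 1/v for the variables in which such a sum is quadratic, one finds the sum of
phi (1 + a) phi (1 + s^3 / a) over nonzero a and s ([residual_sum_cubic]). The value of
McCarthy's function is this sum minus 1. If cubing is a permutation of the field,
the sum is 1 and the value 0. Otherwise the sum is a quadratic
form in three sums c_0, c_1, c_2, one for each class modulo cubes. Two relations,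
linear and quadratic, hold between them. They give p = x^2 + 3 y^2 with
2 x = 3 c_0 + 1, and the value 2 x^2 - 6 y^2 ([mcCarthyG_1mod3]).

The modular side. On the imaginary axis the hypothesis on b is an identity of real
functions near 0, which determines the coefficients b(n) ([eta_coefficients]).
Jacobi's identity expands the cube of the product of the 1 - q^n as the sum of
(-1)^j (2 j + 1) q^(j (j + 1) / 2); a finite form of it ([jacobi_finite]) is enough.
Hence b(p) is a sum over the solutions of 4 p = c^2 + 3 a^2 in positive odd numbers
c, a. There is none if p = 2 modulo 3, and if p = x^2 + 3 y^2 there are two,
(|x + 3 y|, |x - y|) and (|x - 3 y|, |x + y|); they contribute
(x + 3 y) (x - y) + (x - 3 y) (x + y) = 2 x^2 - 6 y^2 ([eta_coef_1mod3]).
*)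

Set Implicit Arguments.
Unset Strict Implicit.
Unset Printing Implicit Defensive.

Import Order.TTheory GRing.Theory Num.Theory numFieldNormedType.Exports.

Local Open Scope classical_set_scope.
Local Open Scope ring_scope.

(** * p-adic integers and Teichmueller representatives *)

Lemma finField_generator (K : finFieldType) : exists2 g : K, forall n, (g ^+ n == 1) = (#|K|.-1 %| n)%N &
  forall a : K, a != 0 -> exists i : nat, a = g ^+ i.
Proof.
have /cyclicP[u uG] := field_unit_group_cyclic [set: {unit K}]%G.
have valX (v : {unit K}) n : FinRing.uval (v ^+ n)%g = FinRing.uval v ^+ n.
  by elim: n => // n IH; rewrite expgS /= IH exprS.
have ou : #[u]%g = #|K|.-1 by rewrite orderE -uG /= card_finField_unit.
exists (FinRing.uval u) => [n|a a0].
  by rewrite -ou order_dvdn -valX -(inj_eq val_inj).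
have ua : a \is a GRing.unit by rewrite unitfE.
have : FinRing.Unit ua \in [set: {unit K}]%G by rewrite inE.
rewrite uG => /cycleP[i /(congr1 (@FinRing.uval _))] /=.
by rewrite valX; exists i.
Qed.

Section PadicBasics.
Variables (p : nat) (p_pr : prime p).
Local Notation Zp := (padic_int p_pr).
Implicit Types (x y z : Zp) (n N : nat).

Lemma padic_res_nat n k : padic_res (n%:R : Zp) k = (n %% p ^ k)%N.
Proof.
elim: n => [|n IHn]; first by rewrite [LHS]mod0n mod0n.
rewrite mulrSr /= IHn -modnDm modn_mod modn_mod; rewrite modnDm.
by rewrite addn1.
Qed.

Lemma padic_resDE x y k :
  padic_res (x + y) k = ((padic_res x k + padic_res y k) %% p ^ k)%N.
Proof. by []. Qed.

Lemma padic_resME x y k :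
  padic_res (x * y) k = ((padic_res x k * padic_res y k) %% p ^ k)%N.
Proof. by []. Qed.

(** Divisibility by p^N takes the place of the topology of Z_p: an identity is
    proved modulo p^N for all N ([pdvd_eqP]). *)
Definition pdvd N x := exists w, x = p%:R ^+ N * w.

Lemma expn_p_gt0 k : (0 < p ^ k)%N.
Proof. by rewrite expn_gt0 prime_gt0. Qed.

Lemma pdvd_res N x : pdvd N x <-> padic_res x N = 0%N.
Proof.
split=> [[w ->]|xN].
  by rewrite -natrX padic_resME padic_res_nat modnn mul0n mod0n.
pose f n := (padic_res x (n + N) %/ p ^ N)%N.
have dv n : (p ^ N %| padic_res x (n + N))%N.
  by rewrite /dvdn addnC padic_resD xN.
have fP n : f n.+1 = f n %[mod p ^ n].
  apply/eqP; rewrite -(@eqn_pmul2r (p ^ N)) ?expn_p_gt0 //.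
  rewrite !muln_modl -expnD /f !divnK //.
  rewrite addSn padic_resS.
  by rewrite padic_res_mod.
exists (padic_of p_pr fP); apply: padic_eqP => n.
rewrite -natrX padic_resME padic_res_nat /=.
rewrite modnMml modnMmr /f mulnC divnK // addnC addnC padic_resD //.
Qed.

Lemma pdvdD N x y : pdvd N x -> pdvd N y -> pdvd N (x + y).
Proof. by move=> [a ->] [b ->]; exists (a + b); rewrite mulrDr. Qed.

Lemma pdvdN N x : pdvd N x -> pdvd N (- x).
Proof. by move=> [a ->]; exists (- a); rewrite mulrN. Qed.

Lemma pdvdB N x y : pdvd N x -> pdvd N y -> pdvd N (x - y).
Proof. by move=> hx hy; apply: pdvdD => //; exact: pdvdN. Qed.

Lemma pdvdMl N x y : pdvd N y -> pdvd N (x * y).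
Proof. by move=> [a ->]; exists (x * a); rewrite mulrCA. Qed.

Lemma pdvdMr N x y : pdvd N x -> pdvd N (x * y).
Proof. by rewrite mulrC; exact: pdvdMl. Qed.

Lemma pdvdM M N x y : pdvd M x -> pdvd N y -> pdvd (M + N) (x * y).
Proof. by move=> [a ->] [b ->]; exists (a * b); rewrite mulrACA exprD. Qed.

Lemma pdvd_exp N : pdvd N (p%:R ^+ N).
Proof. by exists 1; rewrite mulr1. Qed.

Lemma pdvd0 N : pdvd N 0.
Proof. by exists 0; rewrite mulr0. Qed.

Lemma pdvd_le M N x : (M <= N)%N -> pdvd N x -> pdvd M x.
Proof.
by move=> le [a ->]; exists (p%:R ^+ (N - M) * a); rewrite mulrA -exprD subnKC.
Qed.

Lemma pdvd_sum N (I : Type) (r : seq I) (P : pred I) (F : I -> Zp) :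
  (forall i, P i -> pdvd N (F i)) -> pdvd N (\sum_(i <- r | P i) F i).
Proof. by move=> h; elim/big_ind: _ => //; [exact: pdvd0 | exact: pdvdD]. Qed.

Lemma pdvd_eq N x y : pdvd N (x - y) <-> padic_res x N = padic_res y N.
Proof.
rewrite pdvd_res; split=> h.
  have -> : x = (x - y) + y by rewrite subrK.
  by rewrite padic_resDE h add0n padic_res_mod.
have := padic_resDE (x - y) y N; rewrite subrK h -[LHS]padic_res_mod.
rewrite -{1}[padic_res y N]add0n => /eqP.
by rewrite eqn_modDr mod0n padic_res_mod eq_sym => /eqP.
Qed.

Lemma pdvd_sym N x y : pdvd N (x - y) -> pdvd N (y - x).
Proof. by move=> /pdvdN; rewrite opprB. Qed.

Lemma pdvd_trans N y x z : pdvd N (x - y) -> pdvd N (y - z) -> pdvd N (x - z).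
Proof.
move=> h1 h2; have -> : x - z = (x - y) + (y - z) by rewrite addrA subrK.
exact: pdvdD.
Qed.

Lemma pdvd_eq0 x : (forall N, pdvd N x) -> x = 0.
Proof.
move=> h; apply: padic_eqP => n; rewrite [RHS]mod0n.
by apply/pdvd_res.
Qed.

Lemma pdvd_eqP x y : (forall N, pdvd N (x - y)) -> x = y.
Proof. by move=> /pdvd_eq0/eqP; rewrite subr_eq0 => /eqP. Qed.

Lemma pdvd_subM N x x' y y' :
  pdvd N (x - x') -> pdvd N (y - y') -> pdvd N (x * y - x' * y').
Proof.
move=> h1 h2.
have -> : x * y - x' * y' = (x - x') * y + x' * (y - y') by ring.
by apply: pdvdD; [exact: pdvdMr | exact: pdvdMl].
Qed.

Lemma pdvd_subX N x x' k : pdvd N (x - x') -> pdvd N (x ^+ k - x' ^+ k).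
Proof.
move=> h; elim: k => [|k IHk]; first by rewrite subrr; exact: pdvd0.
by rewrite !exprS; exact: pdvd_subM.
Qed.

Lemma pdvd_approx N x : pdvd N (x - (padic_res x N)%:R).
Proof. by apply/pdvd_eq; rewrite padic_res_nat padic_res_mod. Qed.

Lemma pdvd_nat N n : pdvd N (n%:R : Zp) <-> (p ^ N %| n)%N.
Proof. by rewrite pdvd_res padic_res_nat /dvdn; split=> /eqP. Qed.

Lemma padic_nat_neq0 n : (0 < n)%N -> (n%:R : Zp) != 0.
Proof.
move=> n0; apply/eqP => h.
have /pdvd_nat : pdvd n (n%:R : Zp) by rewrite h; exact: pdvd0.
by move=> /(dvdn_leq n0); rewrite leqNgt ltn_expl // prime_gt1.
Qed.

Lemma padic_p_neq0 : (p%:R : Zp) != 0.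
Proof. by rewrite padic_nat_neq0 // prime_gt0. Qed.

(** An inverse modulo p^n is a power of the residue, by Euler's theorem; these
    inverses are coherent because they are unique. *)
Lemma padic_unitP x : reflect (~ pdvd 1 x) (x \is a GRing.unit).
Proof.
apply: (iffP idP) => [ux [w xw]|xN].
  have : pdvd 1 (1%:R : Zp).
    rewrite -[1%:R]/1 -(mulrV ux) {1}xw; exists (w / x).
    by rewrite mulrA.
  by rewrite pdvd_nat dvdn1 expn1 => /eqP p1; move: p_pr; rewrite p1.
pose f n := (padic_res x n ^ (totient (p ^ n)).-1)%N.
have cop n : coprime (padic_res x n) (p ^ n).
  case: n => [|n]; first by rewrite coprimen1.
  rewrite coprime_sym coprime_pexpl // prime_coprime //; apply/negP => d.
  apply: xN; apply/pdvd_res; rewrite -(padic_resD x 1 n) expn1 add1n.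
  exact/eqP.
have fV n : (f n * padic_res x n = 1 %[mod p ^ n])%N.
  rewrite /f -expnSr prednK ?totient_gt0 ?expn_p_gt0 //.
  exact: Euler_exp_totient.
have fP n : f n.+1 = f n %[mod p ^ n].
  have h : (f n.+1 * padic_res x n = 1 %[mod p ^ n])%N.
    rewrite -padic_resS modnMmr.
    have := fV n.+1 => /(congr1 (modn^~ (p ^ n)%N)).
    by rewrite !modn_dvdm // dvdn_exp2l.
  rewrite -[LHS]/((f n.+1) %% _)%N -[f n.+1]muln1 -modnMmr -(fV n) modnMmr.
  rewrite mulnCA -modnMmr.
  by rewrite h modnMmr muln1.
apply/unitrP; exists (padic_of p_pr fP).
have e : padic_of p_pr fP * x = 1.
  apply: padic_eqP => n; rewrite padic_resME /= modnMml fV.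
  by [].
by split=> //; rewrite mulrC.
Qed.

Lemma padic_nat_unit n : ((n%:R : Zp) \is a GRing.unit) = ~~ (p %| n)%N.
Proof.
apply/padic_unitP/idP; rewrite pdvd_nat expn1; by move/negP.
Qed.

Lemma pdvd_unit_cancel N x y : x \is a GRing.unit -> pdvd N (x * y) -> pdvd N y.
Proof. by move=> ux /(pdvdMl x^-1); rewrite mulKr. Qed.

Lemma unit_congr x y : pdvd 1 (x - y) -> x \is a GRing.unit -> y \is a GRing.unit.
Proof.
move=> h /padic_unitP ux; apply/padic_unitP => hy; apply: ux.
by rewrite -[x](subrK y); exact: pdvdD.
Qed.

(** Raising to the power p gains one digit of precision: the step that makes
    Teichmueller representatives exist and be unique. *)
Lemma pdvd_subXp N x y :
  (0 < N)%N -> pdvd N (x - y) -> pdvd N.+1 (x ^+ p - y ^+ p).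
Proof.
move=> N0 h; rewrite subrXX -addn1; apply: pdvdM => //.
pose q := p.-1; have pq : p = q.+1 by rewrite prednK ?prime_gt0.
have sumy : \sum_(i < p) y ^+ (p.-1 - i) * y ^+ i = p%:R * y ^+ q.
  rewrite (eq_bigr (fun=> y ^+ q)) => [|i _]; last first.
    by rewrite -exprD subnK // -ltnS prednK ?prime_gt0.
  by rewrite sumr_const card_ord mulr_natl.
rewrite -[X in pdvd 1 X](subrK (p%:R * y ^+ q)); apply: pdvdD; last first.
  by exists (y ^+ q); rewrite expr1.
rewrite -sumy -sumrB; apply: pdvd_sum => i _; rewrite -mulrBl.
by apply: pdvdMr; apply: pdvd_subX; exact: pdvd_le h.
Qed.

Lemma padic_modpE x y : (padic_modp x = padic_modp y) <-> pdvd 1 (x - y).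
Proof.
rewrite pdvd_eq /padic_modp; split=> [h|-> //].
have := congr1 val h; rewrite /= !val_Fp_nat // => {}h.
by have := padic_res_mod x 1; have := padic_res_mod y 1; rewrite expn1 h => -> ->.
Qed.

Lemma padic_modp_nat n : padic_modp (n%:R : Zp) = n%:R.
Proof.
rewrite /padic_modp padic_res_nat expn1; apply: val_inj.
by rewrite /= !val_Fp_nat // modn_mod.
Qed.

Lemma padic_modpD x y : padic_modp (x + y) = padic_modp x + padic_modp y.
Proof.
rewrite /padic_modp padic_resDE expn1 -natrD; apply: val_inj.
by rewrite /= !val_Fp_nat // modn_mod.
Qed.

Lemma padic_modpM x y : padic_modp (x * y) = padic_modp x * padic_modp y.
Proof.
rewrite /padic_modp padic_resME expn1 -natrM; apply: val_inj.
by rewrite /= !val_Fp_nat // modn_mod.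
Qed.

Lemma padic_modpX x k : padic_modp (x ^+ k) = padic_modp x ^+ k.
Proof.
elim: k => [|k IHk]; first by rewrite !expr0 -[1 in LHS]/(1%:R) padic_modp_nat.
by rewrite !exprS padic_modpM IHk.
Qed.

Lemma root1_uniq x y : x ^+ p.-1 = 1 -> y ^+ p.-1 = 1 -> pdvd 1 (x - y) -> x = y.
Proof.
move=> hx hy h.
have E z : z ^+ p.-1 = 1 -> z ^+ p = z.
  by move=> hz; rewrite -[X in _ ^+ X](prednK (prime_gt0 p_pr)) exprS hz mulr1.
have h1 N : pdvd N.+1 (x - y).
  by elim: N => // N IH; rewrite -(E x) // -(E y) //; exact: pdvd_subXp.
by apply: pdvd_eqP => N; apply: pdvd_le (h1 N).
Qed.

(** The sequence a^(p^n) is p-adically Cauchy: consecutive terms differ by a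
    factor a^(p^n (p-1)), which is 1 modulo p^n by Euler's theorem. *)
Lemma root1_ex (a : 'F_p) : a != 0 ->
  exists2 w : Zp, w ^+ p.-1 = 1 & padic_modp w = a.
Proof.
move=> a0.
have cop : coprime (val a) p.
  rewrite coprime_sym prime_coprime //; apply: contra a0 => d.
  apply/eqP; apply: val_inj => /=; apply/eqP; rewrite -[_ == _]negbK -lt0n.
  apply/negP => a_gt0; have := dvdn_leq a_gt0 d; rewrite leqNgt.
  by rewrite -[X in (_ < X)%N](Fp_cast p_pr) ltn_ord.
have eul n : (val a ^ (p ^ n * p.-1) = 1 %[mod p ^ n.+1])%N.
  have -> : (p ^ n * p.-1)%N = totient (p ^ n.+1).
    by rewrite totient_pfactor // mulnC.
  by apply: Euler_exp_totient; rewrite coprimeXr.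
pose f n := (val a ^ (p ^ n))%N.
have fP n : f n.+1 = f n %[mod p ^ n].
  have -> : f n.+1 = (f n * (val a ^ (p ^ n * p.-1)))%N.
    rewrite /f -expnD; congr (_ ^ _)%N.
    by rewrite -[X in (_ + X)%N]mulnC -mulSn prednK ?prime_gt0 // expnS.
  have := eul n => /(congr1 (modn^~ (p ^ n)%N)).
  rewrite !modn_dvdm ?dvdn_exp2l // => e.
  by rewrite -modnMmr e modnMmr muln1.
pose w := padic_of p_pr fP.
have wX k n : (padic_res (w ^+ k) n = f n ^ k %% p ^ n)%N.
  elim: k => [|k IH]; first by rewrite expr0 expn0.
  by rewrite exprS padic_resME IH expnS /= modnMm.
exists w.
  apply: padic_eqP => n; rewrite wX /f -expnM.
  have := eul n => /(congr1 (modn^~ (p ^ n)%N)).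
  by rewrite !modn_dvdm ?dvdn_exp2l // => ->.
apply: val_inj; rewrite /padic_modp /= val_Fp_nat // expn1 modn_mod /f expn1.
have := fermat_little (val a) p_pr => ->.
by rewrite modn_small // -[X in (_ < X)%N](Fp_cast p_pr) ltn_ord.
Qed.

Local Notation tau := (@teichmuller p p_pr).

Lemma teichP (a : 'F_p) : a != 0 -> tau a ^+ p.-1 = 1 /\ padic_modp (tau a) = a.
Proof.
move=> a0; rewrite /teichmuller; case: xgetP => [w _ //|h].
by have [w w1 w2] := root1_ex a0; case: (h w).
Qed.

Lemma predp_gt0 : (0 < p.-1)%N.
Proof. by rewrite -subn1 subn_gt0 prime_gt1. Qed.

Lemma teich0 : tau 0 = 0.
Proof.
rewrite /teichmuller; case: xgetP => // w _ /= [w1 w2].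
have : padic_modp (w ^+ p.-1) = 0 by rewrite padic_modpX w2 expr0n eqn0Ngt predp_gt0.
rewrite w1 -[1]/(1%:R) padic_modp_nat => /eqP.
by rewrite oner_eq0.
Qed.

Lemma teich_modp (a : 'F_p) : padic_modp (tau a) = a.
Proof.
have [->|/teichP[] //] := eqVneq a 0.
by rewrite teich0 -[0 in LHS]/(0%:R) padic_modp_nat.
Qed.

Lemma teich_uniq (a : 'F_p) w : w ^+ p.-1 = 1 -> padic_modp w = a -> tau a = w.
Proof.
move=> w1 wa.
have a0 : a != 0.
  apply/eqP => a0.
  have := padic_modpX w p.-1; rewrite w1 wa a0 expr0n eqn0Ngt predp_gt0 /=.
  by rewrite -[1]/(1%:R) padic_modp_nat => /eqP; rewrite oner_eq0.
have [t1 t2] := teichP a0.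
by apply: root1_uniq => //; apply/padic_modpE; rewrite t2.
Qed.

Lemma teich1 : tau 1 = 1.
Proof.
by apply: teich_uniq; rewrite ?expr1n // -[1 in LHS]/(1%:R) padic_modp_nat.
Qed.

Lemma teichM (a b : 'F_p) : tau (a * b) = tau a * tau b.
Proof.
have [->|a0] := eqVneq a 0; first by rewrite mul0r teich0 mul0r.
have [->|b0] := eqVneq b 0; first by rewrite mulr0 teich0 mulr0.
have [a1 a2] := teichP a0; have [b1 b2] := teichP b0.
by apply: teich_uniq; rewrite ?exprMn ?a1 ?b1 ?mulr1 // padic_modpM a2 b2.
Qed.

Lemma teichX (a : 'F_p) k : tau (a ^+ k) = tau a ^+ k.
Proof.
elim: k => [|k IHk]; first by rewrite !expr0 teich1.
by rewrite !exprS teichM IHk.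
Qed.

Lemma teich_inj : injective tau.
Proof. by move=> a b h; rewrite -(teich_modp a) h teich_modp. Qed.

Lemma teich_eq1 (a : 'F_p) : (tau a == 1) = (a == 1).
Proof. by rewrite -{1}teich1 (inj_eq teich_inj). Qed.

Lemma teich_expp (a : 'F_p) : tau a ^+ p = tau a.
Proof.
have [->|/teichP[h _]] := eqVneq a 0.
  by rewrite teich0 expr0n eqn0Ngt prime_gt0.
by rewrite -[X in _ ^+ X](prednK (prime_gt0 p_pr)) exprS h mulr1.
Qed.

Lemma teich_congr x : exists w, x = tau (padic_modp x) + p%:R * w.
Proof.
have : pdvd 1 (x - tau (padic_modp x)).
  by apply/padic_modpE; rewrite teich_modp.
by move=> [w hw]; exists w; rewrite expr1 in hw; rewrite -hw addrC subrK.
Qed.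

Lemma Fp_nat_eq0 n : ((n%:R : 'F_p) == 0) = (p %| n)%N.
Proof.
by rewrite -(inj_eq val_inj) /= val_Fp_nat.
Qed.

(** Multiplication by a generator permutes the summands and multiplies the sum by
    a number other than 1, unless the character is trivial. *)
Lemma sum_teichX n :
  \sum_(a : 'F_p) tau a ^+ n.+1 = if (p.-1 %| n.+1)%N then (p.-1)%:R else 0.
Proof.
case: ifP => [/dvdnP[k nk]|/negbT ndv].
  rewrite (bigD1 0) //= teich0 expr0n /= nk add0r.
  rewrite (eq_bigr (fun=> 1)) => [|a /teichP[h _]]; last first.
    by rewrite mulnC exprM h expr1n.
  by rewrite sumr_const cardC1 card_Fp.
have [g g1 _] := finField_generator 'F_p; rewrite card_Fp // in g1.
have g0 : g != 0.
  apply/eqP => g0; have := g1 p.-1; rewrite g0 expr0n eqn0Ngt predp_gt0 dvdnn.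
  by rewrite eq_sym oner_eq0.
have gn : g ^+ n.+1 != 1 by rewrite g1.
have e : tau g ^+ n.+1 * (\sum_(a : 'F_p) tau a ^+ n.+1)
       = \sum_(a : 'F_p) tau a ^+ n.+1.
  rewrite mulr_sumr [RHS](reindex_inj (mulfI g0)).
  by apply: eq_bigr => a _; rewrite teichM exprMn.
apply/eqP; have : (tau g ^+ n.+1 - 1) * (\sum_(a : 'F_p) tau a ^+ n.+1) == 0.
  by rewrite mulrBl mul1r e subrr.
by rewrite mulf_eq0 subr_eq0 -teichX teich_eq1 (negbTE gn).
Qed.

(** The exponents run over 1 .. p-1, not 0 .. p-2, so that the powers of
    [tau 0 = 0] contribute nothing. *)
Lemma sum_teich_exp (a : 'F_p) :
  \sum_(1 <= q < p) tau a ^+ q = if a == 1 then (p.-1)%:R else 0.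
Proof.
case: eqP => [->|/eqP a1].
  rewrite teich1 (eq_bigr (fun=> 1)) => [|i _]; last by rewrite expr1n.
  by rewrite sumr_const_nat subn1.
have [->|a0] := eqVneq a 0.
  rewrite big_nat big1 // => i /andP[i1 _].
  by rewrite teich0 expr0n eqn0Ngt i1.
have [h _] := teichP a0.
have : tau a * (tau a ^+ p.-1 - 1) == 0 by rewrite h subrr mulr0.
rewrite subrX1 mulrCA mulf_eq0 subr_eq0 teich_eq1 (negbTE a1) /= => /eqP e.
rewrite -[RHS]e mulr_sumr big_add1 big_mkord.
by apply: eq_bigr => i _; rewrite exprS.
Qed.
End PadicBasics.

(** * The p-adic gamma function *)

Section GammaP.
Variables (p : nat) (p_pr : prime p) (p_gt2 : (2 < p)%N).
Local Notation Zp := (padic_int p_pr).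
Local Notation Gn := (Gammap_nat p_pr).
Local Notation Gam := (@Gammap p p_pr).
Implicit Types (x y z : Zp) (n N : nat).

Let odd_p : odd p.
Proof. by case: (even_prime p_pr) p_gt2 => [->|]. Qed.

Lemma Gammap_natS n : Gn n.+1 = - (Gn n * (if (p %| n)%N then 1 else n%:R)).
Proof.
rewrite /Gammap_nat; case: n => [|n].
  by rewrite dvdn0 expr1 expr0 !big_geq // !mulr1.
rewrite big_mkcond big_nat_recr //= -big_mkcond /= exprS -!mulrA mulN1r.
by case: (p %| n.+1)%N => //=; rewrite !mulr1.
Qed.

Lemma Gammap_nat0 : Gn 0 = 1.
Proof. by rewrite /Gammap_nat expr0 mul1r big_geq. Qed.

Lemma arith_prod (x K : Zp) n : exists w,
  \prod_(i < n.+1) (x + i%:R * K)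
    = x ^+ n.+1 + K * ('C(n.+1, 2))%:R * x ^+ n + K ^+ 2 * w.
Proof.
elim: n => [|n [w IH]].
  by exists 0; rewrite big_ord1 bin_small //= mulr0n; ring.
rewrite big_ord_recr /= IH.
exists (n.+1%:R * ('C(n.+1, 2))%:R * x ^+ n + w * (x + n.+1%:R * K)).
have -> : ('C(n.+2, 2)) = ('C(n.+1, 2) + n.+1)%N by rewrite binS bin1.
rewrite natrD !exprS expr0; ring.
Qed.

(** Wilson's theorem modulo p^(N+1) by induction on N: split j below p^(N+2) as
    j0 + i p^(N+1) with i < p; then the product over i is j0^p, because the
    first-order terms add up to a multiple of C(p,2) p^(N+1), and raising to the
    power p gains the missing digit. *)
Lemma gen_wilson N :
  pdvd N.+1 (\prod_(0 <= j < p ^ N.+1 | ~~ (p %| j)%N) (j%:R : Zp) + 1).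
Proof.
elim: N => [|N IH].
  have := Wilson (prime_gt1 p_pr); rewrite p_pr => /esym d.
  rewrite expn1 big_ltn_cond ?prime_gt0 // dvdn0 /=.
  have -> : \prod_(1 <= j < p | ~~ (p %| j)%N) (j%:R : Zp) = (p.-1`!)%:R.
    rewrite fact_prod natr_prod prednK ?prime_gt0 //.
    rewrite big_nat_cond [RHS]big_nat_cond; apply: eq_bigl => j.
    case: (ltnP 0 j) => //= j0; case: (ltnP j p) => //= jp.
    by apply/negP => /(dvdn_leq j0); rewrite leqNgt jp.
  by rewrite -[1]/(1%:R) -natrD pdvd_nat expn1 addn1.
set P := (\prod_(0 <= j < p ^ N.+1 | _) _) in IH.
have -> : \prod_(0 <= j < p ^ N.+2 | ~~ (p %| j)%N) (j%:R : Zp) =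
  \prod_(0 <= j < p ^ N.+1 | ~~ (p %| j)%N)
     \prod_(i < p) (j%:R + i%:R * (p ^ N.+1)%:R).
  rewrite exchange_big /= expnS big_mkcond big_nat_mul big_mkord.
  apply: eq_bigr => i _; rewrite -{1}[(i * _)%N]add0n mulSn big_addn addnK.
  rewrite [RHS]big_mkcond; apply: eq_bigr => j _.
  by rewrite dvdn_addl ?dvdn_mull ?dvdn_exp // natrD natrM.
have h : pdvd N.+2 (\prod_(0 <= j < p ^ N.+1 | ~~ (p %| j)%N)
     \prod_(i < p) (j%:R + i%:R * (p ^ N.+1)%:R) - P ^+ p).
  rewrite -prodrXl; elim/big_rec2: _ => [|j a b _ IHj].
    by rewrite subrr; exact: pdvd0.
  apply: pdvd_subM => //.
  have [w] := arith_prod (j%:R) (p ^ N.+1)%:R p.-1.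
  rewrite prednK ?prime_gt0 // => ->.
  rewrite -!addrA [X in pdvd _ X]addrC addrA addrNK natrX; apply: pdvdD.
    apply: pdvdMr; rewrite -addn1; apply: pdvdM; first exact: pdvd_exp.
    by rewrite pdvd_nat expn1 prime_dvd_bin.
  apply: pdvdMr; rewrite -exprM; apply: pdvd_le (pdvd_exp _ _).
  by rewrite muln2 -addnn addSn !addnS ltnS ltnS leq_addr.
have -> : forall a : Zp, a + 1 = (a - P ^+ p) + (P ^+ p - (-1) ^+ p).
  by move=> a; rewrite -signr_odd odd_p expr1 opprK; ring.
by apply: pdvdD => //; apply: pdvd_subXp => //; rewrite opprK.
Qed.

(** Interpolation: [Gammap_nat] is p-adically continuous, by Wilson's theorem
    for one full period. *)
Lemma Gammap_nat_shift N n : pdvd N (Gn (n + p ^ N) - Gn n).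
Proof.
case: N => [|N]; first by exists (Gn (n + p ^ 0) - Gn n); rewrite expr0 mul1r.
elim: n => [|n IH].
  rewrite add0n Gammap_nat0 /Gammap_nat.
  have : (-1 : Zp) ^+ (p ^ N.+1) = -1.
    by rewrite -signr_odd oddX odd_p orbT expr1.
  move=> ->; have := gen_wilson N.
  rewrite big_ltn_cond ?expn_p_gt0 // dvdn0 /= => h.
  by rewrite mulN1r -opprD; exact: pdvdN.
rewrite addSn !Gammap_natS -opprD; apply/pdvdN/pdvd_subM => //.
rewrite dvdn_addl ?dvdn_exp //.
case: ifP => _; first by rewrite subrr; exact: pdvd0.
by rewrite natrD addrAC subrr add0r natrX; exact: pdvd_exp.
Qed.

Lemma Gammap_nat_congr N n m : n = m %[mod p ^ N] -> pdvd N (Gn n - Gn m).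
Proof.
have shift k j : pdvd N (Gn (k + j * p ^ N) - Gn k).
  elim: j => [|j IH]; first by rewrite addn0 subrr; exact: pdvd0.
  rewrite mulSn addnA addnAC; apply: pdvd_trans IH.
  exact: Gammap_nat_shift.
move=> e; rewrite (divn_eq n (p ^ N)) (divn_eq m (p ^ N)) e.
apply: (@pdvd_trans _ _ _ (Gn (m %% p ^ N))).
  by rewrite addnC; exact: shift.
by apply: pdvd_sym; rewrite addnC; exact: shift.
Qed.

(** This frees the sequel from limits: modulo p^N the value of Gamma_p is read
    off any natural number close to the argument. *)
Lemma GammapE N n x : pdvd N (x - n%:R) -> pdvd N (Gam x - Gn n).
Proof.
have key k : pdvd k (Gam x - Gn (padic_res x k)); last first.
  move=> h; apply: pdvd_trans (key N) _; apply: Gammap_nat_congr.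
  move/pdvd_eq : h; rewrite padic_res_nat => ->; by rewrite modn_mod.
rewrite /Gammap; case: eqP => [->|/eqP x0].
  by rewrite [padic_res 0 k]mod0n Gammap_nat0 subrr; exact: pdvd0.
pose f j := padic_res (Gn (padic_res x j)) j.
have fP j : f j.+1 = f j %[mod p ^ j].
  rewrite /f padic_resS padic_res_mod; apply/pdvd_eq; apply: Gammap_nat_congr.
  by rewrite padic_resS padic_res_mod.
pose y := padic_of p_pr fP.
have yE j : padic_res y j = padic_res (Gn (padic_res x j)) j.
  by rewrite /= /f padic_res_mod.
have cv (u : nat -> nat) : (u n)%:R @[n --> \oo] --> x -> Gn (u n) @[n --> \oo] --> y.
  move=> /padic_cvgP ux; apply/padic_cvgP => j.
  have [M _ MP] := ux j; exists M => // i /MP h.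
  rewrite yE; apply/pdvd_eq; apply: Gammap_nat_congr.
  by rewrite -h padic_res_nat modn_mod.
case: xgetP => [z _ /= zP|/(_ y)]; last by case=> u _; exact: cv.
pose u j := (padic_res x j + p ^ j)%N.
have u0 j : (0 < u j)%N by rewrite addn_gt0 (expn_p_gt0 p_pr) orbT.
have ux : ((u j)%:R : Zp) @[j --> \oo] --> x.
  apply/padic_cvgP => j; exists j => // i /= ji.
  rewrite padic_res_nat /u -modnDmr.
  have -> : (p ^ i %% p ^ j = 0)%N by apply/eqP; rewrite -/(dvdn _ _) dvdn_exp2l.
  by rewrite addn0 -(subnKC ji) padic_resD.
have /padic_cvgP/(_ k) [M1 _ h1] := zP u u0 ux.
have /padic_cvgP/(_ k) [M2 _ h2] := cv u ux.
apply/pdvd_eq; rewrite -yE.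
have e1 := h1 (M1 + M2)%N (leq_addr _ _); have e2 := h2 (M1 + M2)%N (leq_addl _ _).
by rewrite -e1 e2.
Qed.

Lemma Gammap_natE n : Gam n%:R = Gn n.
Proof. by apply: pdvd_eqP => N; apply: GammapE; rewrite subrr; exact: pdvd0. Qed.

Lemma Gammap0 : Gam 0 = 1.
Proof. by rewrite -[0]/(0%:R) Gammap_natE Gammap_nat0. Qed.

Lemma Gammap_congr N x y : pdvd N (x - y) -> pdvd N (Gam x - Gam y).
Proof.
move=> h; have hx := pdvd_approx N x; have hy := pdvd_approx N y.
apply: (pdvd_trans (GammapE hx)); apply: pdvd_sym; apply: GammapE.
by apply: pdvd_trans hx; exact: pdvd_sym.
Qed.

Lemma GammapS x :
  Gam (x + 1) = - (Gam x * (if x \is a GRing.unit then x else 1)).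
Proof.
apply: pdvd_eqP => N; apply: (@pdvd_le _ _ _ N.+1) => //.
set n := padic_res x N.+1; have hx : pdvd N.+1 (x - n%:R) := pdvd_approx N.+1 x.
have h1 : pdvd 1 (x - n%:R) by apply: pdvd_le hx.
apply: (@pdvd_trans _ _ _ (Gn n.+1)).
  by apply: GammapE; rewrite mulrSr opprD addrACA subrr addr0.
rewrite Gammap_natS -opprD; apply: pdvdN.
have -> : (x \is a GRing.unit) = ~~ (p %| n)%N.
  rewrite -(padic_nat_unit p_pr); apply/idP/idP; apply: unit_congr => //.
  exact: pdvd_sym.
rewrite if_neg; apply: pdvd_subM; first exact/pdvd_sym/GammapE.
by case: ifP => _; [rewrite subrr; exact: pdvd0 | exact: pdvd_sym].
Qed.

Lemma Gammap_unit x : Gam x \is a GRing.unit.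
Proof.
have h : pdvd 1 (x - (padic_res x 1)%:R) := pdvd_approx 1 x.
apply: (unit_congr (pdvd_sym (GammapE h))).
elim: (padic_res x 1) => [|n IH]; first by rewrite Gammap_nat0 unitr1.
rewrite Gammap_natS unitrN unitrM IH /=.
by case: ifP => [|/negbT]; rewrite ?unitr1 ?padic_nat_unit.
Qed.

(** The value at a negative integer is a quotient of factorials; this is how
    factorials, hence exponential series, enter the theory of Gamma_p. *)
Lemma Gammap_opp a m : (a < p)%N ->
  Gam (- (a + p * m)%:R) * ((a + p * m)`!)%:R = (- p%:R) ^+ m * (m`!)%:R.
Proof.
have step n : Gam (- n.+1%:R) * (if (p %| n.+1)%N then 1 else n.+1%:R)
   = Gam (- n%:R) * (if (p %| n.+1)%N then -1 else 1).
  have := GammapS (- n.+1%:R).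
  rewrite unitrN padic_nat_unit -[n.+1]addn1 natrD opprD addrNK => ->.
  by case: (p %| n + 1)%N; rewrite /= ?natrD; ring.
elim: m a => [|m IH] a.
  rewrite muln0 addn0 expr0 mul1r fact0.
  elim: a => [|a IHa] ap; first by rewrite oppr0 Gammap0 fact0 mulr1.
  have := step a; have -> : (p %| a.+1)%N = false.
    by apply/negP => /(dvdn_leq (ltn0Sn _)); rewrite leqNgt ap.
  by rewrite mulr1 factS natrM mulrA => ->; rewrite IHa // ltnW.
elim: a => [|a IHa] ap.
  have pm1 : (p.-1 < p)%N by rewrite prednK ?prime_gt0.
  have := IH _ pm1; have E : (0 + p * m.+1 = (p.-1 + p * m).+1)%N.
    by rewrite add0n mulnS -addSn prednK // prime_gt0.
  have := step (p.-1 + p * m)%N; rewrite -E add0n dvdn_mulr // mulr1 => -> h.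
  rewrite -[(p * m.+1)%N]add0n E factS -E add0n.
  move: h; rewrite factS !natrM exprS => h.
  transitivity (- p%:R * m.+1%:R * (Gam (- (p.-1 + p * m)%:R) * ((p.-1 + p * m)`!)%:R)); first by ring.
  by rewrite h; ring.
have := step (a + p * m.+1)%N.
have -> : (p %| (a + p * m.+1).+1)%N = false.
  rewrite -addSn dvdn_addl ?dvdn_mulr //.
  by apply/negP => /(dvdn_leq (ltn0Sn _)); rewrite leqNgt ap.
rewrite mulr1 addSn factS natrM mulrA => ->.
by rewrite IHa // ltnW.
Qed.
End GammaP.

(** * Truncated exponential power series *)
Section TruncatedSeries.
Variable (K : fieldType).
Implicit Types (f g D : {poly K}) (M n : nat) (w : K).

Definition eqX M f g := forall n, (n < M)%N -> f`_n = g`_n.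

Lemma eqX_mul M f f' g g' : eqX M f f' -> eqX M g g' -> eqX M (f * g) (f' * g').
Proof.
move=> hf hg n nM; rewrite !coefM; apply: eq_bigr => i _.
rewrite hf ?hg //; first by apply: leq_ltn_trans nM; exact: leq_subr.
by apply: leq_ltn_trans nM; rewrite -ltnS.
Qed.

(** Instead of power series, polynomials modulo X^M are used, and exponentials
    are recognised by the equation f' = D f with f(0) = 1. *)
Definition solves M D f := f`_0 = 1 /\ eqX M.-1 f^`() (D * f).

Lemma solves_mul M D D' f g :
  solves M D f -> solves M D' g -> solves M (D + D') (f * g).
Proof.
move=> [f0 hf] [g0 hg]; split; first by rewrite coef0M f0 g0 mulr1.
move=> n nM; rewrite derivM mulrDl !coefD.
rewrite (eqX_mul hf (fun n _ => erefl (g`_n)) nM).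
rewrite (eqX_mul (fun n _ => erefl (f`_n)) hg nM).
by rewrite -mulrA (mulrCA f).
Qed.

Lemma solves1 M : solves M 0 1.
Proof. by split=> [|n nM]; rewrite ?coef1 // mul0r derivC. Qed.

Hypothesis char0 : forall n, (n.+1%:R : K) != 0.

Lemma solves_uniq M D f g : solves M D f -> solves M D g -> eqX M f g.
Proof.
move=> [f0 hf] [g0 hg].
elim/ltn_ind => -[|n] IH nM; first by rewrite f0 g0.
have nM' : (n < M.-1)%N by rewrite -ltnS prednK // (leq_ltn_trans _ nM).
have := hf n nM'; have := hg n nM'; rewrite !coef_deriv !coefM.
rewrite -[f`__ *+ _]mulr_natr -[g`__ *+ _]mulr_natr.
move=> eg ef; apply: (mulIf (char0 n)); rewrite ef eg.
apply: eq_bigr => i _; rewrite IH //.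
  by rewrite ltnS leq_subr.
by apply: leq_ltn_trans nM; rewrite (leq_trans (leq_subr _ _)).
Qed.

Lemma factK_neq0 n : ((n`!)%:R : K) != 0.
Proof. by case: (n`!) (fact_gt0 n). Qed.

(** exp (w X^e), truncated *)
Definition expT e M w : {poly K} := \sum_(j < M) (w ^+ j / (j`!)%:R) *: 'X^(e * j).

Lemma coef_mul_expT e M w f n :
  (f * expT e M w)`_n
   = \sum_(j < M) if (n < e * j)%N then 0 else w ^+ j / (j`!)%:R * f`_(n - e * j).
Proof.
rewrite mulr_sumr coef_sum; apply: eq_bigr => j _.
rewrite -scalerAr coefZ coefMXn; case: ifP => // _; exact: mulr0.
Qed.

Lemma coef_expT e M w n :
  (expT e M w)`_n = \sum_(j < M) if n == (e * j)%N then w ^+ j / (j`!)%:R else 0.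
Proof.
rewrite coef_sum; apply: eq_bigr => j _; rewrite coefZ coefXn.
by case: eqP => _; rewrite ?mulr1 ?mulr0.
Qed.

Lemma deriv_expT e M w : (0 < e)%N ->
  (expT e M.+1 w)^`() = (e%:R * w)%:P * 'X^(e.-1) * expT e M w.
Proof.
case: e => // e _; rewrite /expT big_ord_recl muln0 expr0 derivD alg_polyC derivC add0r.
rewrite raddf_sum mulr_sumr /=; apply: eq_bigr => j _.
rewrite /bump leq0n add1n derivZ derivXn mulnS addSn /=.
rewrite -scalerAr -mulrA -exprD mul_polyC scalerA -scaler_nat scalerA.
congr (_ *: _); rewrite -addSn -mulnS factS exprS !natrM.
have h1 := char0 j; have h2 := factK_neq0 j.
by move: (j.+1%:R) (j`!%:R) h1 h2 => u v h1 h2; field; rewrite h1 h2.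
Qed.

Lemma solves_expT e M w : (0 < e)%N -> (0 < M)%N ->
  solves M ((e%:R * w)%:P * 'X^(e.-1)) (expT e M w).
Proof.
move=> e0; case: M => // M _; split.
  rewrite coef_expT big_ord_recl muln0 eqxx expr0 fact0 divr1 big1 ?addr0 // => j _.
  by rewrite lift0 mulnS; case: (e) e0.
rewrite deriv_expT //= ; apply: eqX_mul => // n nM.
rewrite !coef_expT big_ord_recr /=.
case: eqP => [E|_]; last by rewrite addr0.
by move: nM; rewrite E ltnNge leq_pmull.
Qed.
End TruncatedSeries.

(** * The series exp (T + T^p / p) *)
Section DworkNumbers.
Variables (p : nat) (p_pr : prime p).

(** [dwork_num n] counts the permutations of n letters whose p-th power is 1,
    and has exponential generating function exp (T + T^p / p). The recursion
    looks p steps back, hence the list of all earlier values. *)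
Fixpoint dwork_seq n : seq nat :=
  if n is n'.+1 then
    let s := dwork_seq n' in (head 0 s + n' ^_ p.-1 * nth 0 s p.-1)%N :: s
  else [:: 1%N].
Definition dwork_num n := head 0%N (dwork_seq n).

Lemma nth_dwork_seq n k :
  nth 0%N (dwork_seq n) k = if (k <= n)%N then dwork_num (n - k) else 0%N.
Proof.
elim: n k => [|n IH] [|k] //=; rewrite ?nth_nil // ?subSS ?IH //.
Qed.

Lemma dwork_numS n : dwork_num n.+1 =
  (dwork_num n + n ^_ p.-1 * (if (p <= n.+1)%N then dwork_num (n.+1 - p) else 0))%N.
Proof.
rewrite /dwork_num /= nth_dwork_seq -/(dwork_num _).
by congr (_ + _ * _)%N; case: p p_pr => [|q].
Qed.

Lemma ffact_Fp n m : ((n ^_ m)%:R : 'F_p) = \prod_(i < m) (n%:R - i%:R).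
Proof.
elim: m n => [|m IH] n; first by rewrite big_ord0.
rewrite ffactnSr natrM IH big_ord_recr /=.
have [mn|nm] := leqP m n; first by rewrite natrB.
rewrite (eqP (_ : (n - m)%N == 0%N)) ?subn_eq0 ?(ltnW nm) // mulr0.
suff -> : \prod_(i < m) (n%:R - i%:R : 'F_p) = 0 by rewrite mul0r.
by rewrite (bigD1 (Ordinal nm)) //= subrr mul0r.
Qed.

Lemma ffact_top m : (p %| ((p * m + p.-1) ^_ p.-1).+1)%N.
Proof.
rewrite -(Fp_nat_eq0 p_pr) -[(_ ^_ _).+1]addn1 natrD ffact_Fp.
rewrite natrD natrM pchar_Fp_0 // mul0r add0r -ffact_Fp ffactnn -natrD addn1.
by rewrite (Fp_nat_eq0 p_pr) -Wilson ?prime_gt1.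
Qed.

Lemma ffact_dvd m r : (r < p.-1)%N -> (p %| (p * m + r) ^_ p.-1)%N.
Proof.
move=> rp; rewrite -(Fp_nat_eq0 p_pr) ffact_Fp (bigD1 (Ordinal rp)) //=.
by rewrite natrD natrM pchar_Fp_0 // mul0r add0r subrr mul0r.
Qed.

Lemma dwork_step m r : (r < p.-1)%N ->
  dwork_num (p * m.+1 + r).+1 =
  (dwork_num (p * m.+1 + r) + (p * m.+1 + r) ^_ p.-1 * dwork_num (p * m + r.+1))%N.
Proof.
move=> rp; rewrite dwork_numS.
have -> : (p <= (p * m.+1 + r).+1)%N.
  by rewrite (leq_trans (leq_pmulr p (ltn0Sn m))) // -addnS leq_addr.
by congr (_ + _ * dwork_num _)%N; rewrite mulnS -addnS -addnA addKn.
Qed.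

(** Why exp (T + T^p / p) converges beyond the radius |p|^(1/(p-1)) of exp:
    within a block of p terms the numbers are congruent modulo one more power
    of p, and from one block to the next Wilson's theorem gains that power. *)
Lemma dwork_num_gain e m :
  (forall r, (r < p)%N -> (p ^ e %| dwork_num (p * m + r))%N) ->
  (forall r, (r < p)%N -> (p ^ e %| dwork_num (p * m.+1 + r))%N) ->
  forall r, (r < p)%N -> (p ^ e.+1 %| dwork_num (p * m.+2 + r))%N.
Proof.
move=> h0 h1.
have pp : p.-1.+1 = p by rewrite prednK ?prime_gt0.
have run k : (forall r, (r < p)%N -> (p ^ e %| dwork_num (p * k + r))%N) ->
  forall r, (r < p)%N ->
  dwork_num (p * k.+1 + r) = dwork_num (p * k.+1) %[mod p ^ e.+1].
  move=> hk; elim=> [|r IH] rp; first by rewrite addn0.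
  have rp' : (r < p.-1)%N by rewrite -ltnS pp.
  rewrite addnS dwork_step // -modnDmr.
  have -> : ((p * k.+1 + r) ^_ p.-1 * dwork_num (p * k + r.+1) %% p ^ e.+1 = 0)%N.
    by apply/eqP; rewrite -/(dvdn _ _) expnS dvdn_mul ?ffact_dvd ?hk.
  by rewrite addn0 IH // ltnW.
have base : (p ^ e.+1 %| dwork_num (p * m.+2))%N.
  have -> : (p * m.+2 = (p * m.+1 + p.-1).+1)%N by rewrite -addnS pp [in LHS]mulnS addnC.
  rewrite dwork_numS.
  have -> : (p <= (p * m.+1 + p.-1).+1)%N by rewrite -addnS pp leq_addl.
  have -> : ((p * m.+1 + p.-1).+1 - p = p * m.+1)%N by rewrite -addnS pp addnK.
  rewrite /dvdn -modnDml run // ?pp // modnDml.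
  rewrite -mulSn -/(dvdn _ _) expnS dvdn_mul ?ffact_top //.
  by have := h1 0%N (prime_gt0 p_pr); rewrite addn0.
move=> r rp; rewrite /dvdn run //; exact/eqP.
Qed.

Lemma dwork_num_dvd n : (p ^ (n %/ p)./2 %| dwork_num n)%N.
Proof.
have H m : (forall r, (r < p)%N -> (p ^ m./2 %| dwork_num (p * m + r))%N) /\
     (forall r, (r < p)%N -> (p ^ (m.+1)./2 %| dwork_num (p * m.+1 + r))%N).
  elim: m => [|m [h0 h1]]; first by split=> r _; rewrite dvd1n.
  split=> //; apply: dwork_num_gain => // r rp.
  apply: dvdn_trans (h1 r rp); apply: dvdn_exp2l; exact/half_leq.
have [h _] := H (n %/ p)%N.
by rewrite {2}(divn_eq n p) mulnC h // ltn_mod prime_gt0.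
Qed.

Lemma logn_fact_pm m a : (a < p)%N -> logn p ((a + p * m)`!) = (m + logn p (m`!))%N.
Proof.
have nd i k : (k < p.-1)%N -> logn p (k.+1 + p * i) = 0%N.
  move=> kp; rewrite lognE addn_gt0 /= p_pr /= dvdn_addl ?dvdn_mulr //.
  by rewrite gtnNdvd // -[p]prednK ?prime_gt0 // ltnS.
have aux i : logn p ((p * i)`!) = (i + logn p i`!)%N ->
  forall k, (k < p)%N -> logn p ((k + p * i)`!) = (i + logn p (i`!))%N.
  move=> e0; elim=> [|k IHk] kp; first by rewrite add0n.
  by rewrite addSn factS lognM ?fact_gt0 // -addSn nd ?add0n ?IHk // ?(ltnW kp) // -ltnS prednK // prime_gt0.
apply: (aux m) => {a}.
elim: m => [|m IH]; first by rewrite muln0 fact0 logn1.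
have E : (p * m.+1 = (p.-1 + p * m).+1)%N by rewrite mulnS -addSn prednK // prime_gt0.
have -> : (p * m.+1)`! = (p * m.+1 * (p.-1 + p * m)`!)%N by rewrite E factS.
rewrite (@lognM p (p * m.+1)) ?fact_gt0 ?muln_gt0 ?(prime_gt0 p_pr) //.
rewrite (@lognM p p m.+1 (prime_gt0 p_pr) (ltn0Sn m)) (@logn_prime p p) // eqxx.
by rewrite (aux m IH) ?prednK ?prime_gt0 // factS lognM ?fact_gt0 //; lia.
Qed.

Lemma logn_fact_le n : (p.-1 * logn p (n`!) <= n)%N.
Proof.
elim/ltn_ind: n => n IH; have [n0|n0] := posnP n.
  by rewrite n0 fact0 logn1 muln0.
have lt : (n %/ p < n)%N by rewrite ltn_Pdiv ?prime_gt1.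
have h := IH _ lt; have E : n = (n %% p + p * (n %/ p))%N.
  by rewrite addnC mulnC -divn_eq.
have -> : logn p n`! = (n %/ p + logn p (n %/ p)`!)%N.
  by rewrite {1}E logn_fact_pm // ltn_mod prime_gt0.
rewrite mulnDr {3}E; apply: leq_trans (leq_addl _ _).
apply: leq_trans (leq_add (leqnn _) h) _.
by rewrite -mulSnr prednK ?prime_gt0.
Qed.
End DworkNumbers.

(** * Divisibility in an extension of Z_p, and Dwork's trace formula *)
Section PadicField.
Variables (p : nat) (p_pr : prime p).
Local Notation Zp := (padic_int p_pr).
Variables (Qp : fieldType) (F : {rmorphism Zp -> Qp}) (F_inj : injective F).
Implicit Types (x y : Qp) (w : Zp).

Definition qdvd N x := exists2 w, pdvd N w & x = F w.

Lemma qdvd_F N w : pdvd N w -> qdvd N (F w).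
Proof. by move=> h; exists w. Qed.

Lemma qdvdE N w : qdvd N (F w) <-> pdvd N w.
Proof.
split=> [[v hv /F_inj ->] //|h]; by exists w.
Qed.

Lemma qdvd0 N : qdvd N 0.
Proof. by exists 0; [exact: pdvd0 | rewrite rmorph0]. Qed.

Lemma qdvdD N x y : qdvd N x -> qdvd N y -> qdvd N (x + y).
Proof. by move=> [v hv ->] [w hw ->]; exists (v + w); [exact: pdvdD|rewrite rmorphD]. Qed.

Lemma qdvdN N x : qdvd N x -> qdvd N (- x).
Proof. by move=> [v hv ->]; exists (- v); [exact: pdvdN|rewrite rmorphN]. Qed.

Lemma qdvdB N x y : qdvd N x -> qdvd N y -> qdvd N (x - y).
Proof. by move=> hx /qdvdN; exact: qdvdD. Qed.

Lemma qdvdM M N x y : qdvd M x -> qdvd N y -> qdvd (M + N) (x * y).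
Proof. by move=> [v hv ->] [w hw ->]; exists (v * w); [exact: pdvdM|rewrite rmorphM]. Qed.

Lemma qdvd_le M N x : (M <= N)%N -> qdvd N x -> qdvd M x.
Proof. by move=> h [v hv ->]; exists v => //; exact: pdvd_le hv. Qed.

Lemma qdvdMl N x y : qdvd 0 x -> qdvd N y -> qdvd N (x * y).
Proof. exact: qdvdM. Qed.

Lemma qdvd_sum N (I : Type) (r : seq I) (P : pred I) (G : I -> Qp) :
  (forall i, P i -> qdvd N (G i)) -> qdvd N (\sum_(i <- r | P i) G i).
Proof. by move=> h; elim/big_ind: _ => //; [exact: qdvd0 | exact: qdvdD]. Qed.

Lemma qdvdZ w : qdvd 0 (F w).
Proof. by exists w => //; exists w; rewrite mul1r. Qed.

Lemma qdvd_nat n : qdvd 0 n%:R.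
Proof. by rewrite -(rmorph_nat F); exact: qdvdZ. Qed.

Lemma qdvd_natN N n : (p ^ N %| n)%N -> qdvd N n%:R.
Proof. by move=> h; rewrite -(rmorph_nat F); apply/qdvd_F/pdvd_nat. Qed.

Lemma qdvdX k N x : qdvd N x -> qdvd (N * k) (x ^+ k).
Proof.
move=> h; elim: k => [|k IH]; first by rewrite muln0 expr0; exact: (qdvd_nat 1).
by rewrite mulnS exprS; exact: qdvdM.
Qed.

Lemma qdvd_negpX k : qdvd k ((- p%:R) ^+ k).
Proof.
rewrite -{1}[k]mul1n; apply: qdvdX; apply: qdvdN; apply: qdvd_natN.
by rewrite expn1.
Qed.

Lemma padic_char0 n : (n.+1%:R : Qp) != 0.
Proof. by rewrite -(rmorph_nat F) -(rmorph0 F) (inj_eq F_inj) padic_nat_neq0. Qed.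

Lemma qdvd_div N k x b : (0 < b)%N -> (logn p b <= k)%N -> qdvd (N + k) x ->
  qdvd N (x / b%:R).
Proof.
move=> b0 bk [w]; have := pfactor_coprime p_pr b0 => -[b' cb' E].
rewrite E; set v := logn p b in bk *.
move=> [u ->] ->; have ub : (b'%:R : Zp) \is a GRing.unit.
  by rewrite padic_nat_unit // -prime_coprime.
exists (p%:R ^+ (N + k - v) * (u / b'%:R)).
  apply: pdvdMr; apply: pdvd_le (pdvd_exp _ _).
  by rewrite -addnBA // leq_addr.
have h1 : (b'%:R : Qp) != 0 by rewrite -(rmorph_nat F) -(rmorph0 F) (inj_eq F_inj); apply: contraTneq ub => ->; rewrite unitr0.
have h2 : (p%:R : Qp) != 0 by rewrite -(rmorph_nat F) -(rmorph0 F) (inj_eq F_inj) padic_p_neq0.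
have {1}-> : (N + k = (N + k - v) + v)%N by rewrite subnK // (leq_trans bk) ?leq_addl.
rewrite exprD !rmorphM /= !rmorphXn /= !rmorph_nat ?natrM ?natrX.
have -> : F (b'%:R^-1) = (b'%:R)^-1.
  by rewrite -[b'%:R in RHS](rmorph_nat F) rmorphV.
have h3 : (p%:R : Qp) ^+ v != 0 by rewrite expf_neq0.
by move: (p%:R ^+ v) h3 => pv h3; field; rewrite h1 h3.
Qed.

Lemma qdvd_eq0 x : (forall N, qdvd N x) -> x = 0.
Proof.
move=> h; have [w _ xw] := h 0%N; rewrite xw (@pdvd_eq0 _ _ w) ?rmorph0 // => N.
by apply/qdvdE; rewrite -xw.
Qed.
End PadicField.

Section DworkSeries.
Variables (p : nat) (p_pr : prime p) (Qp : fieldType).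
Hypothesis char0 : forall n, (n.+1%:R : Qp) != 0.
Local Notation q := (p%:R : Qp).

Let q_neq0 : q != 0.
Proof. by have := char0 p.-1; rewrite prednK ?prime_gt0. Qed.

Definition dwork n : Qp := (dwork_num p n)%:R / (n`!)%:R.
Local Notation c := dwork.

Lemma dworkS n :
  n.+1%:R * c n.+1 = c n + (if (p <= n.+1)%N then c (n.+1 - p) else 0).
Proof.
rewrite /dwork dwork_numS // natrD natrM factS natrM.
have f0 k : ((k`!)%:R : Qp) != 0 := factK_neq0 char0 k.
have hn := char0 n; have hf := f0 n.
case: ifP => pn.
  have E : (n`!)%:R = (n ^_ p.-1)%:R * ((n.+1 - p)`!)%:R :> Qp.
    have pn' : (p.-1 <= n)%N by rewrite -ltnS prednK ?prime_gt0.
    rewrite -natrM -(ffact_fact pn'); congr ((_ * _ `!)%:R).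
    by case: (p) p_pr => [|k] //; rewrite subSS.
  move: hf; rewrite E mulf_eq0 negb_or => /andP[h1 h2].
  move: (n.+1%:R) (dwork_num p n)%:R (n ^_ p.-1)%:R hn h1 => u v w hu hw.
  move: (dwork_num p _)%:R ((n.+1 - p)`!)%:R h2 => x y hy.
  by field; rewrite hu hw hy.
move: (n.+1%:R) (dwork_num p n)%:R hn (n`!)%:R hf => u v hu w hw.
by rewrite mulr0 !addr0; field; rewrite hu hw.
Qed.

Definition theta M (x : Qp) : {poly Qp} := \poly_(n < M) (c n * x ^+ n).

(** [theta M x] is exp (x T + (x T)^p / p); for a Teichmueller representative
    x^p = x, so that its logarithmic derivative is linear in x. This makes the
    product of such series depend on the sum of the x only. *)
Lemma solves_theta M x : (0 < M)%N -> x ^+ p = x ->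
  solves M (x%:P * (1 + 'X^(p.-1))) (theta M x).
Proof.
move=> M0 xp; split; first by rewrite coef_poly M0 expr0 /dwork divr1 mulr1.
move=> n nM; have nM1 : (n.+1 < M)%N by rewrite -ltnS (prednK M0) in nM.
rewrite coef_deriv coef_poly nM1 -mulrA coefCM mulrDl mul1r coefD coefXnM.
rewrite coef_poly (ltnW nM1) -mulr_natl mulrA dworkS.
have -> : (n < p.-1)%N = ~~ (p <= n.+1)%N by rewrite -ltnNge -{2}[p]prednK ?prime_gt0 // ltnS.
case: ifP => pn /=; last by rewrite !addr0 exprS; ring.
rewrite coef_poly.
have -> : (n - p.-1 < M)%N by apply: leq_ltn_trans (ltnW nM1); exact: leq_subr.
have -> : (n - p.-1 = n.+1 - p)%N by case: (p) p_pr => [|k] //; rewrite subSS.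
have h : x * x ^+ (n.+1 - p) = x * x ^+ n.
  by rewrite -[X in X * _]xp -exprD subnKC // exprS.
rewrite exprS mulrDl mulrDr mulrCA; congr (_ + _).
by rewrite -h mulrCA.
Qed.

(** Comparing coefficients in exp T = exp (T + T^p/p) exp (- T^p/p). *)
Lemma dwork_sum_neg a m : (a < p)%N ->
  \sum_(j < m.+1) (m ^_ j)%:R * ((- q) ^+ j * c (p * j + a)) * ((a + p * m)`!)%:R
   = (- q) ^+ m * (m`!)%:R.
Proof.
move=> ap; pose n := (a + p * m)%N; pose M := n.+1.
have f0 k : ((k`!)%:R : Qp) != 0 := factK_neq0 char0 k.
have s1 := solves_expT char0 (1 : Qp) (ltn0Sn 0) (ltn0Sn n).
have := solves_mul (solves_theta (ltn0Sn n) (expr1n _ p))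
  (solves_expT char0 (- q^-1) (prime_gt0 p_pr) (ltn0Sn n)).
have -> : 1%:P * (1 + 'X^(p.-1)) + (q * - q^-1)%:P * 'X^(p.-1)
   = (1%:R * 1 : Qp)%:P * 'X^(1.-1) :> {poly Qp}.
  by rewrite mulrN mulfV // polyCN mulN1r mul1r addrK expr0 !mulr1.
move=> /(solves_uniq char0 s1)/(_ n (ltnSn n)).
rewrite coef_expT coef_mul_expT.
have -> : \sum_(j < M) (if n == (1 * j)%N then 1 ^+ j / (j`!)%:R else 0) = (n`!)%:R^-1 :> Qp.
  rewrite (bigD1 ord_max) //= mul1n eqxx expr1n mul1r big1 ?addr0 // => j.
  by rewrite -val_eqE /= mul1n eq_sym => /negbTE ->.
have mM : (m.+1 <= M)%N by rewrite ltnS /n (leq_trans _ (leq_addl _ _)) // leq_pmull ?prime_gt0.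
move=> E; rewrite -mulr_suml.
transitivity ((- q) ^+ m * (m`!)%:R * (n`!)%:R^-1 * (n`!)%:R); last first.
  by rewrite mulfVK.
rewrite E; congr (_ * _).
transitivity (\sum_(j < m.+1) (- q) ^+ m * (m`!)%:R *
    ((- q^-1) ^+ j / (j`!)%:R * c (n - p * j))).
  rewrite (reindex_inj rev_ord_inj) /=; apply: eq_bigr => j _.
  have jm : (j <= m)%N by rewrite -ltnS.
  have -> : (n - p * j = p * (m - j) + a)%N.
    by rewrite /n -{1}(subnK jm) mulnDr addnA addnK addnC.
  have -> : (- q) ^+ m = (- q) ^+ (m - j) * (- q) ^+ j by rewrite -exprD subnK.
  have -> : (m`!)%:R = (m ^_ (m - j))%:R * (j`!)%:R :> Qp.
    by rewrite -natrM -{2}(subKn jm) ffact_fact ?leq_subr.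
  rewrite subSS.
  have -> : (- q^-1) ^+ j = ((- q) ^+ j)^-1 by rewrite -invrN exprVn.
  have hq : (- q) ^+ j != 0 by rewrite expf_neq0 // oppr_eq0.
  have hf := f0 j; move: (j`!%:R) ((- q) ^+ j) hf hq => u v hu hv.
  by field; rewrite hu hv.
rewrite mulr_sumr (big_ord_widen M (fun j => (- q) ^+ m * (m`!)%:R *
    ((- q^-1) ^+ j / (j`!)%:R * c (n - p * j)))) // big_mkcond.
apply: eq_bigr => j _.
have -> : (n < p * j)%N = ~~ (j < m.+1)%N.
  rewrite -leqNgt /n; apply/idP/idP => h; last first.
    apply: leq_trans (_ : p * m.+1 <= _)%N; last by rewrite leq_mul2l h orbT.
    by rewrite mulnS ltn_add2r.
  rewrite ltnNge; apply/negP => jm; move: h; rewrite ltnNge => /negP; apply.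
  by apply: leq_trans (leq_addl _ _); rewrite leq_mul2l jm orbT.
case: ifP => jm; rewrite ?mulr0 //= coef_poly ltnS leq_subr expr1n mulr1 //.
Qed.

Section Trace.
Variables (a : nat) (z : Qp).
Hypothesis (a_lt : (a < p)%N) (zE : (q - 1) * z = a%:R).

(** The Frobenius operator U of Dwork's theory, written as a matrix on the basis
    e_0, e_1, ...: the j-th coordinate of U e_i. The operator D, given by
    D e_i = (z + i) e_i + e_(i+1), satisfies U D = p D U ([frobU_rel]). *)
Definition frobU j i := if (i <= p * j + a)%N then (- q) ^+ j * c (p * j + a - i) else 0.
Local Notation U := frobU.

(** Modulo the image of D the vector e_(k+1) is - (z + k) e_k, so that
    e_k = [neg_rising k] e_0 + D y_k for some y_k; [frobY j k] is the j-th
    coordinate of U y_k. *)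
Fixpoint frobY j k := if k is k'.+1 then U j k' - (z + k'%:R) * frobY j k' else 0.
Local Notation Y := frobY.

Definition neg_rising k := \prod_(i < k) (- (z + i%:R)).

Lemma frobU_rel j i :
  q * ((z + j%:R) * U j i + (if j is j'.+1 then U j' i else 0))
  = (z + i%:R) * U j i + U j i.+1.
Proof.
rewrite /frobU; have [hi|hi] := leqP i (p * j + a); last first.
  have -> : (i < p * j + a)%N = false by apply/negbTE; rewrite -leqNgt ltnW.
  case: j hi => [|j] hi; first by rewrite !mulr0 addr0 mulr0.
  have -> : (i <= p * j + a)%N = false.
    by apply/negbTE; rewrite -ltnNge (leq_ltn_trans _ hi) // leq_add2r leq_mul2l leqnSn orbT.
  by rewrite !mulr0 addr0 mulr0.
have [n nE] : exists n, (p * j + a = i + n)%N by exists (p * j + a - i)%N; rewrite subnKC.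
rewrite nE addKn.
have iE : i%:R = q * j%:R + a%:R - n%:R :> Qp.
  by rewrite -natrM -natrD nE natrD addrK.
have key : q * ((z + j%:R) * c n) = (z + i%:R) * c n + n%:R * c n.
  by rewrite iE -zE; ring.
case: n nE iE key => [|n] nE iE key.
  rewrite addn0 ltnn addr0 mul0r addr0 in key *.
  case: j hi nE iE key => [|j] hi nE iE key.
    by rewrite addr0 expr0 mul1r.
  have -> : (i <= p * j + a)%N = false.
    by apply/negbTE; rewrite -ltnNge -[X in (_ < X)%N](addn0 i) -nE mulnS -addnA -[X in (X < _)%N]add0n ltn_add2r prime_gt0.
  transitivity ((- q) ^+ j.+1 * (q * ((z + j.+1%:R) * c 0))); first by ring.
  by rewrite key; ring.
have -> : (i < i + n.+1)%N by rewrite -[X in (X < _)%N]addn0 ltn_add2l.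
have -> : (i + n.+1 - i.+1 = n)%N by rewrite addnS subSS addKn.
rewrite dworkS in key.
case: j hi nE iE key => [|j] hi nE iE key.
  have pn : (p <= n.+1)%N = false.
    apply/negbTE; rewrite -ltnNge; apply: leq_ltn_trans a_lt.
    by rewrite -[a]add0n -(muln0 p) nE leq_addl.
  by move: key; rewrite pn !expr0 !mul1r !addr0.
have E : (i <= p * j + a)%N = (p <= n.+1)%N.
  rewrite -(leq_add2l p) addnA -mulnS nE addnC leq_add2l //.
rewrite E; case: ifP key => pn key; last first.
  rewrite !addr0 in key *.
  transitivity ((- q) ^+ j.+1 * (q * ((z + j.+1%:R) * c n.+1))); first by ring.
  by rewrite key; ring.
have -> : (p * j + a - i = n.+1 - p)%N.
  by move: nE; rewrite mulnS => nE; apply/eqP; rewrite -(eqn_add2l p); lia.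
transitivity ((- q) ^+ j.+1 * (q * ((z + j.+1%:R) * c n.+1) - c (n.+1 - p))).
  by rewrite exprS; ring.
by rewrite key; ring.
Qed.

Lemma frobY_rel j k :
  q * ((z + j%:R) * Y j k + (if j is j'.+1 then Y j' k else 0))
  = U j k - neg_rising k * U j 0.
Proof.
elim: k => [|k IH].
  by rewrite /neg_rising big_ord0 mul1r subrr /=; case: j => [|j]; rewrite mulr0 addr0 mulr0.
have := frobU_rel j k; rewrite /neg_rising big_ord_recr /= -/(neg_rising k).
case: j IH => [|j] IH h.
  rewrite !addr0 in IH h *; transitivity (q * (z * U 0 k) - (z + k%:R) * (q * (z * Y 0 k))); first by ring.
  by rewrite IH h; ring.
transitivity (q * ((z + j.+1%:R) * U j.+1 k + U j k)
  - (z + k%:R) * (q * ((z + j.+1%:R) * Y j.+1 k + Y j k))); first by ring.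
by rewrite IH h; ring.
Qed.

(** The trace formula: as U D = p D U, the trace of U is its eigenvalue on the
    one-dimensional cokernel of D, plus p times the trace of U. The last term is
    the error from cutting the matrix off; it tends to 0. *)
Lemma frob_trace K :
  (1 - q) * (\sum_(j < K.+1) U j j)
  = \sum_(j < K.+1) neg_rising j * U j 0 - q * Y K K.+1.
Proof.
elim: K => [|K IH].
  rewrite !big_ord_recl !big_ord0 !addr0 /= mulr0 subr0.
  have := frobY_rel 0 0; rewrite /= !addr0 mulr0 mulr0 => /esym/eqP.
  by rewrite subr_eq0 => /eqP <-; ring.
rewrite big_ord_recr [X in _ = X - _]big_ord_recr mulrDr IH /=.
have /= h := frobY_rel K.+1 K.+1.
set Ykk := Y K K in h *; set Y1 := Y K.+1 K in h *.
have -> : neg_rising K.+1 * U K.+1 0 = U K.+1 K.+1 - (U K.+1 K.+1 - neg_rising K.+1 * U K.+1 0) by ring.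
by rewrite -h; ring.
Qed.
End Trace.
End DworkSeries.

Section GrossKoblitz.
Variables (p : nat) (p_pr : prime p) (p_gt3 : (3 < p)%N).
Local Notation Zp := (padic_int p_pr).
Local Notation Gam := (@Gammap p p_pr).
Variables (Qp : fieldType) (F : {rmorphism Zp -> Qp}) (F_inj : injective F).
Local Notation q := (p%:R : Qp).
Local Notation c := (dwork p Qp).
Local Notation qdvd := (qdvd F).
Let char0 := padic_char0 F_inj.

Let p_ge5 : (4 < p)%N.
Proof. by case: p p_gt3 p_pr => [|[|[|[|[|?]]]]]. Qed.

Lemma dwork_bound N t n : (N + logn p n`! <= t + (n %/ p)./2)%N ->
  qdvd N ((- q) ^+ t * c n).
Proof.
move=> h; rewrite /dwork mulrA; apply: (qdvd_div F_inj (fact_gt0 n) (leqnn _)).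
apply: qdvd_le h _; apply: qdvdM; first exact: qdvd_negpX.
by apply: qdvd_natN; exact: (dwork_num_dvd p_pr).
Qed.

(** As p is at least 5, the p-adic valuation of j! is at most j / 4; this is
    where the room for convergence comes from. *)
Lemma dwork_block_bound a j N : (a < p)%N -> (4 * N <= j)%N ->
  qdvd N ((- q) ^+ j * c (p * j + a)).
Proof.
move=> ap Nj; apply: dwork_bound; rewrite [in logn _ _]addnC logn_fact_pm //.
have -> : ((p * j + a) %/ p = j)%N.
  by rewrite mulnC divnMDl ?prime_gt0 // divn_small // addn0.
have := logn_fact_le p_pr j; set L := logn p _ => h.
have : (4 * L <= j)%N by apply: leq_trans h; rewrite leq_mul2r -ltnS prednK ?prime_gt0 // p_ge5 orbT.
lia.
Qed.

(** The error term of the trace formula tends to 0; the constants are not sharp. *)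
Lemma frobY_bound a (z : Zp) N K : (a < p)%N -> (20 * N + 40 <= K)%N ->
  qdvd N (frobY p a (F z) K K.+1).
Proof.
move=> ap NK.
have hU i : (i <= K)%N -> qdvd N (frobU p Qp a K i).
  move=> iK; rewrite /frobU; case: ifP => h; last exact: qdvd0.
  apply: dwork_bound; set n := (p * K + a - i)%N.
  have := logn_fact_le p_pr n; set L := logn p _ => hL.
  have := ltn_ceil n (prime_gt0 p_pr); set D := (n %/ p)%N => hD.
  have n1 : (n <= p * K + a)%N by exact: leq_subr.
  have n2 : (p * K <= n + K)%N by rewrite /n; lia.
  have hL' : (4 * (L - K - 1) <= K)%N.
    have [le|lt] := leqP L K.+1; first by rewrite -subnDA addn1 (eqP le).
    have [e eE] : exists e, L = (K + 1 + e)%N by exists (L - K - 1)%N; lia.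
    have -> : (L - K - 1 = e)%N by rewrite eE; lia.
    have : (p.-1 * e <= K)%N.
      have pE : p = p.-1.+1 by rewrite prednK ?prime_gt0.
      move: hL n1 ap; rewrite eE {2 3}pE mulSn !mulnDr; lia.
    by apply: leq_trans; rewrite leq_mul2r -ltnS prednK ?prime_gt0 // p_ge5 orbT.
  have hD' : (5 * (K - D - 1) <= K)%N.
    have [le|lt] := leqP K D.+1; first by rewrite -subnDA addn1 (eqP le).
    have [e eE] : exists e, K = (D + 1 + e)%N by exists (K - D - 1)%N; lia.
    have -> : (K - D - 1 = e)%N by rewrite eE; lia.
    have : (p * e <= K)%N.
      move: hD n2; rewrite {1}eE mulSn !mulnDr [(D * p)%N]mulnC; lia.
    by apply: leq_trans; rewrite leq_mul2r p_ge5 orbT.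
  clear -NK hL' hD'; lia.
suff H k : (k <= K.+1)%N -> qdvd N (frobY p a (F z) K k) by exact: H.
elim: k => [|k IH] kK /=; first exact: qdvd0.
apply: qdvdB; first exact: hU.
apply: qdvdMl; last by apply: IH; exact: ltnW.
by rewrite -(rmorph_nat F) -rmorphD; exact: qdvdZ.
Qed.

(** The argument a / (p - 1), at which Gamma_p takes Gauss sums as values. *)
Definition tick a : Zp := a%:R / (p.-1)%:R.

Lemma predp_unit : ((p.-1)%:R : Zp) \is a GRing.unit.
Proof.
rewrite padic_nat_unit //; apply/negP => /(dvdn_leq (predp_gt0 p_pr)).
by rewrite leqNgt prednK ?prime_gt0 // leqnn.
Qed.

Lemma tickE a : (p.-1)%:R * tick a = a%:R.
Proof. by rewrite mulrC divrK ?predp_unit. Qed.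

Lemma tick_approx a N : pdvd N (tick a + (a * \sum_(i < N) p ^ i)%:R).
Proof.
apply: (pdvd_unit_cancel predp_unit); exists a%:R.
rewrite mulrDr tickE natrM mulrCA natr_sum.
have -> : (p.-1)%:R * (\sum_(i < N) (p ^ i)%:R) = p%:R ^+ N - 1 :> Zp.
  rewrite subrX1 -[X in X%:R - 1](prednK (prime_gt0 p_pr)) -addn1 natrD addrK.
  by congr (_ * _); apply: eq_bigr => i _; rewrite natrX.
ring.
Qed.

Lemma neg_rising_opp m j : neg_rising (- m%:R : Qp) j = (m ^_ j)%:R.
Proof.
elim: j => [|j IH]; first by rewrite /neg_rising big_ord0.
rewrite /neg_rising big_ord_recr -/(neg_rising _ j) /= IH ffactnSr natrM.
have [jm|mj] := leqP j m; first by rewrite natrB // opprD opprK.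
by rewrite ffact_small // !mul0r.
Qed.

Lemma neg_rising_F (z : Zp) j : neg_rising (F z) j = F (\prod_(i < j) (- (z + i%:R))).
Proof.
by rewrite rmorph_prod; apply: eq_bigr => i _; rewrite rmorphN rmorphD rmorph_nat.
Qed.

(** The eigenvalue on the cokernel. It is continuous in z, hence can be computed
    at the negative integers - m close to a / (p - 1), where the sum is finite
    ([dwork_sum_neg]) and equals Gamma_p (- (a + p m)) by [Gammap_opp]. *)
Lemma coker_limit a N : (a < p)%N -> exists K0, forall K, (K0 <= K)%N ->
  qdvd N (\sum_(j < K.+1) neg_rising (F (tick a)) j * frobU p Qp a j 0 - F (Gam (tick a))).
Proof.
move=> ap; pose m := (a * \sum_(i < N) p ^ i)%N; exists m => K mK.
have hm : pdvd N (tick a + m%:R) := tick_approx a N.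
clearbody m.
have hG : pdvd N (Gam (- (a + p * m)%:R) - Gam (tick a)).
  apply: Gammap_congr; first by exact: ltnW.
  have -> : - (a + p * m)%:R - tick a = - p%:R * (tick a + m%:R).
    have pE : (p%:R : Zp) = (p.-1)%:R + 1 by rewrite natr1 prednK ?prime_gt0.
    by rewrite natrD natrM -(tickE a) pE; ring.
  exact: pdvdMl.
have -> : F (Gam (tick a)) = F (Gam (- (a + p * m)%:R)) - F (Gam (- (a + p * m)%:R) - Gam (tick a)).
  by rewrite rmorphB opprB addrC subrK.
rewrite opprB addrCA addrC; apply: qdvdD; last by exact: qdvd_F.
have -> : F (Gam (- (a + p * m)%:R)) = \sum_(j < K.+1) neg_rising (F (- m%:R)) j * frobU p Qp a j 0.
  have fn : ((a + p * m)`!%:R : Qp) != 0 by exact: factK_neq0.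
  apply: (mulIf fn).
  have := Gammap_opp p_pr (ltnW p_gt3) m ap => /(congr1 F).
  rewrite !rmorphM !rmorphXn rmorphN !rmorph_nat => ->.
  rewrite -(dwork_sum_neg p_pr char0 m ap) -mulr_suml; congr (_ * _).
  rewrite (big_ord_widen K.+1 (fun j => (m ^_ j)%:R * ((- q) ^+ j * c (p * j + a)))) //.
  rewrite big_mkcond; apply: eq_bigr => j _.
  rewrite (rmorphN F) (rmorph_nat F) neg_rising_opp /frobU leq0n subn0.
  by case: ltnP => // mj; rewrite ffact_small // mul0r.
rewrite -sumrB; apply: qdvd_sum => j _; rewrite -mulrBl mulrC.
apply: qdvdMl.
  by rewrite /frobU leq0n subn0; apply: dwork_block_bound.
rewrite !neg_rising_F -rmorphB; apply: qdvd_F.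
elim/big_rec2: _ => [|i x y _ IH]; first by rewrite subrr; exact: pdvd0.
apply: pdvd_subM => //; rewrite -opprD; apply: pdvdN.
by rewrite opprD addrACA subrr addr0 opprK.
Qed.

(** The Gross-Koblitz formula. With pi^(p-1) = - p, the sum on the left is, up to
    a power of pi, the value at pi of the terms of exponent a modulo p - 1 of
    Dwork's series, that is, a Gauss sum up to the factor p - 1. *)
Lemma gross_koblitz a N : (a < p)%N -> exists K0, forall K, (K0 <= K)%N ->
  qdvd N ((1 - q) * (\sum_(j < K.+1) (- q) ^+ j * c (p.-1 * j + a)) - F (Gam (tick a))).
Proof.
move=> ap; have [K0 h] := coker_limit N ap.
exists (K0 + (20 * N + 40))%N => K hK.
have zE : (q - 1) * F (tick a) = a%:R.
  have -> : q - 1 = (p.-1)%:R.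
    by rewrite -[X in X%:R - 1](prednK (prime_gt0 p_pr)) -addn1 natrD addrK.
  by rewrite -(rmorph_nat F p.-1) -rmorphM tickE rmorph_nat.
have := frob_trace p_pr char0 ap zE K.
have -> : \sum_(j < K.+1) frobU p Qp a j j = \sum_(j < K.+1) (- q) ^+ j * c (p.-1 * j + a).
  apply: eq_bigr => j _; rewrite /frobU.
  have E : (p * j + a = p.-1 * j + a + j)%N.
    by rewrite -{1}[p](prednK (prime_gt0 p_pr)) mulSn addnC addnA addnC addnA.
  by rewrite E leq_addl addnK.
move=> ->; rewrite addrAC; apply: qdvdB; first by apply: h; exact: leq_trans (leq_addr _ _) hK.
apply: qdvdMl; first exact: qdvd_nat.
by apply: frobY_bound => //; exact: leq_trans (leq_addl _ _) hK.
Qed.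
End GrossKoblitz.

(** * Products of values of Gamma_p as character sums *)
Section GaussSums.
Variables (p : nat) (p_pr : prime p) (p_gt3 : (3 < p)%N).
Local Notation Zp := (padic_int p_pr).
Local Notation Gam := (@Gammap p p_pr).
Local Notation tau := (@teichmuller p p_pr).
Variables (Qp : fieldType) (F : {rmorphism Zp -> Qp}) (F_inj : injective F).
Local Notation q := (p%:R : Qp).
Local Notation c := (dwork p Qp).
Local Notation qdvd := (qdvd F).
Let char0 := padic_char0 F_inj.
Implicit Types (f g : {poly Qp}) (N M C n : nat).

Let f0 k : ((k`!)%:R : Qp) != 0 := factK_neq0 char0 k.
Let pp : p = p.-1.+1.
Proof. by rewrite prednK ?prime_gt0. Qed.
Let p1_gt0 : (0 < p.-1)%N := predp_gt0 p_pr.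

(** Divisibility of the coefficients n! f_n is stable under products, and is
    enough for convergence at pi: n! is cancelled by pi^n up to bounded terms
    ([ev_small]). *)
Definition egf_dvd N f := forall n, qdvd N ((n`!)%:R * f`_n).
Definition egf_tail N C f := forall n, (C <= n)%N -> qdvd N ((n`!)%:R * f`_n).

Lemma egf_coefM f g n : (n`!)%:R * (f * g)`_n =
  \sum_(i < n.+1) ('C(n, i))%:R * (((i`!)%:R * f`_i) * (((n - i)`!)%:R * g`_(n - i))).
Proof.
rewrite coefM mulr_sumr; apply: eq_bigr => i _.
have le : (i <= n)%N by rewrite -ltnS.
by rewrite -(bin_fact le) !natrM; ring.
Qed.

Lemma egf_dvdM M N f g : egf_dvd M f -> egf_dvd N g -> egf_dvd (M + N) (f * g).
Proof.
move=> hf hg n; rewrite egf_coefM; apply: qdvd_sum => i _.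
by apply: qdvdMl; [exact: qdvd_nat | exact: qdvdM].
Qed.

Lemma egf_tailM N C C' f g : egf_dvd 0 f -> egf_dvd 0 g ->
  egf_tail N C f -> egf_tail N C' g -> egf_tail N (C + C') (f * g).
Proof.
move=> f0' g0 hf hg n hn; rewrite egf_coefM; apply: qdvd_sum => i _.
apply: qdvdMl; first exact: qdvd_nat.
have [Ci|iC] := leqP C i; first by rewrite -[N]addn0; apply: qdvdM => //; exact: hf.
by rewrite -[N]add0n; apply: qdvdM => //; apply: hg; lia.
Qed.

Lemma egf_theta M (x : Zp) : egf_dvd 0 (theta p M (F x)).
Proof.
move=> n; rewrite coef_poly; case: ifP => _; last by rewrite mulr0; exact: qdvd0.
rewrite mulrA /dwork mulrCA mulfV // mulr1 -rmorphXn.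
by apply: qdvdMl; [exact: qdvd_nat | exact: qdvdZ].
Qed.

Lemma egf_tail_theta N M (x : Zp) : egf_tail N (2 * N * p) (theta p M (F x)).
Proof.
move=> n hn; rewrite coef_poly; case: ifP => _; last by rewrite mulr0; exact: qdvd0.
rewrite mulrA /dwork mulrCA mulfV // mulr1 -rmorphXn mulrC.
apply: qdvdMl; first exact: qdvdZ.
apply: qdvd_natN; apply: dvdn_trans (dwork_num_dvd p_pr n); apply: dvdn_exp2l.
have : (2 * N <= n %/ p)%N by rewrite leq_divRL ?prime_gt0.
by move=> h; rewrite -(half_double N); apply: half_leq; rewrite -mul2n.
Qed.

Lemma coef_expT1 M (w : Qp) n : (expT 1 M w)`_n = if (n < M)%N then w ^+ n / (n`!)%:R else 0.
Proof.
rewrite coef_expT; case: ltnP => [nM|Mn].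
  rewrite (bigD1 (Ordinal nM)) //= mul1n eqxx big1 ?addr0 // => j.
  by rewrite -val_eqE /= mul1n eq_sym => /negbTE ->.
rewrite big1 // => j _; rewrite mul1n; case: eqP => // nj.
by move: (ltn_ord j); rewrite -nj ltnNge Mn.
Qed.

Lemma egf_expT1 M (w : Zp) n : qdvd n ((n`!)%:R * (expT 1 M (q * F w))`_n).
Proof.
rewrite coef_expT1; case: ifP => _; last by rewrite mulr0; exact: qdvd0.
rewrite mulrCA mulfV // mulr1 -(rmorph_nat F) -rmorphM -rmorphXn; apply: qdvd_F.
by rewrite exprMn; apply: pdvdMr; exact: pdvd_exp.
Qed.

Lemma egf_expTp N M (w : Zp) n : (p * N <= n)%N -> qdvd N ((n`!)%:R * (expT p M (F w))`_n).
Proof.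
move=> Nn; rewrite coef_expT mulr_sumr; apply: qdvd_sum => j _.
case: eqP => [nj|_]; last by rewrite mulr0; exact: qdvd0.
rewrite mulrCA -rmorphXn; apply: qdvdMl; first exact: qdvdZ.
have hj : (N <= j)%N by move: Nn; rewrite nj leq_pmul2l ?prime_gt0.
rewrite nj; apply: (qdvd_div F_inj (fact_gt0 j) (leqnn _)).
apply: qdvd_natN; rewrite pfactor_dvdn ?fact_gt0 //.
by rewrite -[(p * j)%N]add0n logn_fact_pm ?prime_gt0 // leq_add2r.
Qed.

(** Evaluation at pi, where pi^(p-1) = - p, takes values in Q_p(pi). Only its
    coordinate along 1 is needed, since Gamma_p occurs below in products whose
    arguments have an integral sum; that coordinate is a linear form with values
    in the base field, and no ramified extension has to be constructed. *)
Definition evX n : Qp := if (p.-1 %| n)%N then (- q) ^+ (n %/ p.-1) else 0.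
Definition ev f : Qp := \sum_(i < size f) f`_i * evX i.

Lemma evE B f : (size f <= B)%N -> ev f = \sum_(i < B) f`_i * evX i.
Proof.
move=> sB; rewrite /ev (big_ord_widen B (fun i => f`_i * evX i)) // big_mkcond.
by apply: eq_bigr => i _; case: ltnP => // si; rewrite nth_default // mul0r.
Qed.

Lemma evD f g : ev (f + g) = ev f + ev g.
Proof.
have sB := size_polyD f g.
rewrite (evE sB) (evE (leq_maxl (size f) (size g))) (evE (leq_maxr (size f) (size g))).
by rewrite -big_split /=; apply: eq_bigr => i _; rewrite coefD mulrDl.
Qed.

Lemma evZ (x : Qp) f : ev (x *: f) = x * ev f.
Proof.
rewrite (evE (size_scale_leq x f)) mulr_sumr.
by apply: eq_bigr => i _; rewrite coefZ mulrA.
Qed.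

Lemma ev0 : ev 0 = 0.
Proof. by rewrite /ev size_poly0 big_ord0. Qed.

Lemma evB f g : ev (f - g) = ev f - ev g.
Proof. by rewrite evD -scaleN1r evZ mulN1r. Qed.

Lemma ev_sum (I : Type) (r : seq I) (P : pred I) (G : I -> {poly Qp}) :
  ev (\sum_(i <- r | P i) G i) = \sum_(i <- r | P i) ev (G i).
Proof. exact: (big_morph ev evD ev0). Qed.

Lemma evXn n : ev 'X^n = evX n.
Proof.
rewrite (evE (_ : _ <= n.+1)%N) ?size_polyXn // (bigD1 ord_max) //= coefXn eqxx mul1r.
rewrite big1 ?addr0 // => i; rewrite -val_eqE /= coefXn => /negbTE ->.
by rewrite mul0r.
Qed.

Lemma ev_mulXn f k : ev (f * 'X^k) = \sum_(i < size f) f`_i * evX (i + k).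
Proof.
rewrite -{1}[f]coefK poly_def mulr_suml ev_sum.
by apply: eq_bigr => i _; rewrite -scalerAl -exprD evZ evXn.
Qed.

Lemma evX_shift n k : evX (n + p.-1 * k) = (- q) ^+ k * evX n.
Proof.
rewrite /evX dvdn_addl ?dvdn_mulr //; case: ifP => h; last by rewrite mulr0.
by rewrite [(p.-1 * k)%N]mulnC addnC divnMDl // exprD.
Qed.

(** The substitution rule T^p = - p T, valid at T = pi. *)
Lemma ev_mulXp f j : ev (f * 'X^(p * j)) = (- q) ^+ j * ev (f * 'X^j).
Proof.
rewrite !ev_mulXn mulr_sumr; apply: eq_bigr => i _.
by rewrite mulrCA -evX_shift -addnA -mulSn -pp.
Qed.

Lemma ev_small N f : egf_dvd N f -> qdvd N (ev f).
Proof.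
move=> h; apply: qdvd_sum => i _.
have -> : f`_i * evX i = (evX i / (i`!)%:R) * ((i`!)%:R * f`_i).
  by rewrite mulrA mulfVK // mulrC.
apply: qdvdMl => //; rewrite /evX; case: ifP => d; last by rewrite mul0r; exact: qdvd0.
apply: (@qdvd_div _ _ _ _ F_inj 0 (i %/ p.-1) _ _ (fact_gt0 i)).
  by rewrite leq_divRL // mulnC logn_fact_le.
exact: qdvd_negpX.
Qed.

Lemma ev_congr N M C C' f g : eqX M f g -> egf_tail N C f -> egf_tail N C' g ->
  (C <= M)%N -> (C' <= M)%N -> qdvd N (ev f - ev g).
Proof.
move=> e hf hg CM CM'; rewrite -evB; apply: ev_small => n; rewrite coefB mulrBr.
have [nM|Mn] := ltnP n M; first by rewrite e // subrr; exact: qdvd0.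
by apply: qdvdB; [apply: hf; exact: leq_trans Mn | apply: hg; exact: leq_trans Mn].
Qed.

Lemma F_teichp (x : 'F_p) : F (tau x) ^+ p = F (tau x).
Proof. by rewrite -rmorphXn teich_expp. Qed.

(** The additivity of the character defined by Dwork's series: the value at pi of
    a product of such series depends only on the sum of the arguments modulo p.
    Indeed, if s = t + p w with t a Teichmueller representative, the factor
    exp (p w T) exp (w T^p) is left over, and it is 1 at T = pi. *)
Lemma ev_additive N M C f (s : Zp) :
  solves M ((F s)%:P * (1 + 'X^(p.-1))) f -> egf_tail N C f ->
  (C <= M)%N -> (2 * N * p + (N + p * N) <= M)%N -> (0 < M)%N ->
  qdvd N (ev f - ev (theta p M (F (tau (padic_modp s))))).
Proof.
move=> sf tf CM NM M0; have [w sE] := teich_congr s.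
set t := tau _ in sE *; set th := theta p M (F t).
pose u := expT 1 M (q * F w); pose v := expT p M (F w).
pose v' := expT 1 M (q * F (- w)).
have hu : egf_dvd 0 u by move=> n; apply: qdvd_le (egf_expT1 M w n).
have hv : egf_dvd 0 v by move=> n; apply: egf_expTp; rewrite muln0.
have hv' : egf_dvd 0 v' by move=> n; apply: qdvd_le (egf_expT1 M (- w) n).
have tu : egf_tail N N u by move=> n Nn; apply: qdvd_le (egf_expT1 M w n).
have tv : egf_tail N (p * N) v by move=> n Nn; apply: egf_expTp.
have tv' : egf_tail N N v' by move=> n Nn; apply: qdvd_le (egf_expT1 M (- w) n).
have hth : egf_dvd 0 th := @egf_theta M t.
have s1 : solves M ((F s)%:P * (1 + 'X^(p.-1))) (th * (u * v)).
  have -> : (F s)%:P * (1 + 'X^(p.-1)) = (F t)%:P * (1 + 'X^(p.-1)) +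
     ((1%:R * (q * F w))%:P * 'X^(1.-1) + (q * F w)%:P * 'X^(p.-1)).
    rewrite sE rmorphD rmorphM rmorph_nat polyCD mul1r expr0.
    by move: 'X^(p.-1) => X; ring.
  apply: solves_mul; first by apply: solves_theta => //; exact: F_teichp.
  by apply: solves_mul; apply: solves_expT => //; exact: prime_gt0.
have step1 : qdvd N (ev f - ev (th * (u * v))).
  apply: (ev_congr (solves_uniq char0 sf s1) tf _ CM NM).
  apply: egf_tailM => //; last exact: egf_tailM.
    by move=> n; exact: (egf_dvdM hu hv).
  exact: egf_tail_theta.
have e2 : ev (th * (u * v)) = ev (th * (u * v')).
  rewrite !mulrA /v /v' /expT !mulr_sumr !ev_sum; apply: eq_bigr => j _.
  rewrite -!scalerAr !evZ ev_mulXp mul1n rmorphN mulrN -mulNr exprMn.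
  by move: (ev _) ((j`!)%:R) => x y; ring.
have s3 : solves M 0 (u * v').
  have -> : 0 = (1%:R * (q * F w))%:P * 'X^(1.-1) + (1%:R * (q * F (- w)))%:P * 'X^(1.-1) :> {poly Qp}.
    by rewrite rmorphN mulrN mulrN polyCN mulNr subrr.
  by apply: solves_mul; apply: solves_expT.
have e3 : eqX M (u * v') 1 := solves_uniq char0 s3 (solves1 Qp M).
have h3 : egf_dvd N (u * v' - 1).
  move=> n; rewrite coefB; have [nM|Mn] := ltnP n M.
    by rewrite e3 // subrr mulr0; exact: qdvd0.
  have -> : (1 : {poly Qp})`_n = 0 by rewrite coef1; case: (n) Mn M0 => //; case: (M).
  rewrite subr0; apply: (egf_tailM hu hv' tu tv').
  apply: leq_trans Mn; apply: leq_trans NM; rewrite -[X in (X <= _)%N]add0n.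
  by apply: leq_add => //; rewrite leq_add2l leq_pmull ?prime_gt0.
have -> : ev f - ev th = (ev f - ev (th * (u * v))) + ev (th * (u * v' - 1)).
  by rewrite mulrBr mulr1 evB -e2 addrA subrK.
by apply: qdvdD => //; apply: ev_small => n; exact: (egf_dvdM hth h3).
Qed.

(** With two or three exponents and t = 1 this is a Jacobi sum; with t = 0 it is
    the sum that a product of Gauss sums reduces to. *)
Fixpoint conv_sum (es : seq nat) (t : 'F_p) : Zp :=
  if es is e :: es' then \sum_(x : 'F_p) tau x ^+ e * conv_sum es' (t - x)
  else (t == 0)%:R.

(** The Gauss sum of the e-th power of the Teichmueller character, before the
    evaluation at pi. *)
Definition theta_sum M e : {poly Qp} :=
  \sum_(x : 'F_p) F (tau x) ^+ e *: theta p M (F (tau x)).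

(** The coordinate along 1 of the additive character at t *)
Definition char_value M (t : 'F_p) : Qp := ev (theta p M (F (tau t))).

Lemma ev_prod_theta_sum N M es C f s :
  solves M ((F s)%:P * (1 + 'X^(p.-1))) f -> egf_dvd 0 f -> egf_tail N C f ->
  (C + size es * (2 * N * p) <= M)%N -> (2 * N * p + (N + p * N) <= M)%N -> (0 < M)%N ->
  qdvd N (ev (f * \prod_(e <- es) theta_sum M e)
          - \sum_(t : 'F_p) F (conv_sum es t) * char_value M (padic_modp s + t)).
Proof.
move=> + + + + NM M0; elim: es C f s => [|e es IH] C f s sf hf tf CM.
  rewrite big_nil mulr1 (bigD1 0) //= ?eqxx rmorph1 mul1r addr0 big1 ?addr0.
    by apply: (ev_additive (C := C)) => //; move: CM; rewrite mul0n addn0.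
  by move=> t /negbTE ->; rewrite rmorph0 mul0r.
rewrite big_cons mulrA {1}/theta_sum mulr_sumr mulr_suml ev_sum.
have -> : \sum_(t : 'F_p) F (conv_sum (e :: es) t) * char_value M (padic_modp s + t) =
  \sum_(x : 'F_p) F (tau x) ^+ e *
    \sum_(t : 'F_p) F (conv_sum es t) * char_value M (padic_modp (s + tau x) + t).
  rewrite /= (eq_bigr (fun t => \sum_(x : 'F_p) (F (tau x) ^+ e *
    (F (conv_sum es (t - x)) * char_value M (padic_modp s + t))))); last first.
    move=> t _; rewrite rmorph_sum mulr_suml; apply: eq_bigr => x _.
    by rewrite rmorphM rmorphXn mulrA.
  rewrite exchange_big; apply: eq_bigr => x _; rewrite mulr_sumr.
  rewrite (reindex_inj (addIr x)); apply: eq_bigr => t _ /=.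
  by rewrite addrK padic_modpD teich_modp [t + x]addrC addrA.
rewrite -sumrB; apply: qdvd_sum => x _.
rewrite -scalerAr -scalerAl evZ -mulrBr; apply: qdvdMl.
  by rewrite -rmorphXn; exact: qdvdZ.
apply: (IH (C + 2 * N * p)%N).
- rewrite rmorphD polyCD mulrDl; apply: solves_mul => //.
  by apply: solves_theta => //; exact: F_teichp.
- by move=> n; apply: (egf_dvdM hf); exact: egf_theta.
- apply: egf_tailM => //; [exact: egf_theta | exact: egf_tail_theta].
- by rewrite -addnA -mulSn.
Qed.

Lemma conv_sum_total es :
  \sum_(t : 'F_p) conv_sum es t = \prod_(e <- es) \sum_(x : 'F_p) tau x ^+ e.
Proof.
elim: es => [|e es IH] /=.
  by rewrite big_nil (bigD1 0) //= ?eqxx big1 ?addr0 // => t /negbTE ->.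
rewrite big_cons exchange_big mulr_suml; apply: eq_bigr => x _ /=.
by rewrite -mulr_sumr -IH [in RHS](reindex_inj (addIr (- x))).
Qed.

Definition theta_section L a : {poly Qp} := \poly_(j < L) c (p.-1 * j + a).

(** Summing over the characters selects the terms of exponent a modulo p - 1. *)
Lemma theta_sumE L a : (a < p.-1)%N ->
  theta_sum (p.-1 * L) (p.-1 - a)
   = (p.-1)%:R *: ('X^a * (theta_section L a \Po 'X^(p.-1))).
Proof.
move=> ap; apply/polyP => n; rewrite coefZ coefXnM coef_sum.
have sumE : \sum_(x : 'F_p) (F (tau x) ^+ (p.-1 - a) *: theta p (p.-1 * L) (F (tau x)))`_n =
   if (n < p.-1 * L)%N then c n * (if (p.-1 %| (p.-1 - a) + n)%N then (p.-1)%:R else 0) else 0.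
  case: ifP => nL; last first.
    by rewrite big1 // => x _; rewrite coefZ coef_poly nL mulr0.
  have -> : (if (p.-1 %| p.-1 - a + n)%N then (p.-1)%:R else 0) =
     F (\sum_(x : 'F_p) tau x ^+ (p.-1 - a + n)).
    have [k kE] : exists k, (p.-1 - a + n = k.+1)%N.
      by exists (p.-1 - a + n).-1; rewrite prednK // addn_gt0 subn_gt0 ap.
    by rewrite kE sum_teichX; case: ifP => _; rewrite ?rmorph0 ?rmorph_nat.
  rewrite rmorph_sum mulr_sumr; apply: eq_bigr => x _.
  by rewrite coefZ coef_poly nL exprD rmorphM !rmorphXn mulrCA.
rewrite sumE coef_comp_poly_Xn // {sumE}.
have [na|an] := ltnP n a.
  have -> : (p.-1 %| p.-1 - a + n)%N = false.
    by apply/negbTE/negP => /dvdn_leq; rewrite addn_gt0 subn_gt0 ap => /(_ isT); lia.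
  by rewrite !mulr0; case: ifP.
have -> : (p.-1 - a + n = n - a + p.-1)%N by lia.
rewrite dvdn_addl //; case: (boolP (p.-1 %| n - a)%N) => [/dvdnP[j jE]|_]; last first.
  by rewrite !mulr0; case: ifP.
rewrite jE mulnK // coef_poly.
have nE : n = (p.-1 * j + a)%N by rewrite mulnC -jE subnK.
have -> : (n < p.-1 * L)%N = (j < L)%N.
  rewrite nE; apply/idP/idP => h.
    by rewrite -(ltn_pmul2l p1_gt0); apply: leq_ltn_trans h; exact: leq_addr.
  apply: (@leq_trans (p.-1 * j.+1)); last by rewrite leq_mul2l h orbT.
  by rewrite mulnS addnC ltn_add2r.
by rewrite nE; case: ifP => _; rewrite ?mulr0 // mulrC.
Qed.

Lemma ev_graded m g : ev ('X^(p.-1 * m) * (g \Po 'X^(p.-1))) = (- q) ^+ m * g.[- q].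
Proof.
rewrite comp_polyE mulr_sumr ev_sum horner_coef mulr_sumr; apply: eq_bigr => i _.
rewrite -scalerAr evZ -exprM -exprD evXn -mulnDr.
by rewrite /evX dvdn_mulr // mulKn // exprD mulrCA.
Qed.

Lemma ev_prod_graded L s m : all (fun a => a < p.-1)%N s -> sumn s = (p.-1 * m)%N ->
  ev (\prod_(a <- s) theta_sum (p.-1 * L) (p.-1 - a))
   = (p.-1)%:R ^+ size s * (- q) ^+ m * \prod_(a <- s) (theta_section L a).[- q].
Proof.
move=> sa sm; have -> : \prod_(a <- s) theta_sum (p.-1 * L) (p.-1 - a)
   = (p.-1)%:R ^+ size s *: ('X^(sumn s) * ((\prod_(a <- s) theta_section L a) \Po 'X^(p.-1))).
  elim: s sa {sm} => [|a s IH] /=.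
    by move=> _; rewrite !big_nil expr0 scale1r mul1r comp_polyC.
  move=> /andP[ap /IH {}IH]; rewrite !big_cons IH theta_sumE // comp_polyM.
  by rewrite -scalerAr -scalerAl scalerA exprD exprSr [in RHS]mulrACA.
by rewrite sm evZ ev_graded horner_prod mulrA.
Qed.

Lemma char_value0 M : (0 < M)%N -> char_value M 0 = 1.
Proof.
move=> M0; rewrite /char_value teich0 rmorph0.
have -> : theta p M 0 = 1 :> {poly Qp}.
  apply/polyP => n; rewrite coef_poly coef1; case: n => [|n] /=.
    by rewrite M0 expr0 mulr1 /dwork divr1.
  by rewrite expr0n mulr0; case: ifP.
by rewrite -(expr0 'X) evXn /evX dvdn0 div0n expr0.
Qed.

(** The coordinate of a nontrivial p-th root of unity along 1 is the same for all
    of them: rescaling the argument multiplies T^n by 1 when p - 1 divides n. *)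
Lemma char_valueE L t : t != 0 -> char_value (p.-1 * L) t = (theta_section L 0).[- q].
Proof.
have K1 (x : 'F_p) : x != 0 -> char_value (p.-1 * L) x = ev (theta p (p.-1 * L) 1).
  move=> x0; rewrite /char_value (evE (size_poly _ _)) (evE (size_poly _ _)).
  apply: eq_bigr => n _; rewrite !coef_poly ltn_ord /evX.
  case: ifP => [/dvdnP[k ->]|_]; last by rewrite !mulr0.
  have [h _] := teichP p_pr x0.
  by rewrite expr1n mulnC exprM -rmorphXn h rmorph1 expr1n.
move=> t0; rewrite K1 //.
have pm : ((p.-1)%:R : Qp) != 0 by rewrite -(prednK p1_gt0).
apply: (mulfI pm).
have := @theta_sumE L 0 p1_gt0; rewrite subn0 => /(congr1 ev).
rewrite evZ -[X in 'X^X](muln0 p.-1) ev_graded expr0 mul1r => <-.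
rewrite /theta_sum ev_sum (bigD1 0) //= teich0 rmorph0 expr0n eqn0Ngt p1_gt0 scale0r ev0 add0r.
rewrite (eq_bigr (fun=> ev (theta p (p.-1 * L) 1))); last first.
  move=> x x0; have [h _] := teichP p_pr x0.
  by rewrite evZ -rmorphXn h rmorph1 mul1r -/(char_value _ x) K1.
by rewrite sumr_const cardC1 card_Fp // mulr_natl.
Qed.

Lemma gross_koblitz_unif N b : (b <= p)%N -> exists K0, forall K a, (K0 <= K)%N -> (a < b)%N ->
  qdvd N ((q - 1) * (theta_section K.+1 a).[- q] + F (Gam (tick p_pr a))).
Proof.
elim: b => [|b IH] bp; first by exists 0%N.
have [K1 h1] := IH (ltnW bp); have [K2 h2] := gross_koblitz p_gt3 F_inj N bp.
exists (K1 + K2)%N => K a hK; rewrite ltnS leq_eqVlt => /orP[/eqP ->|ab]; last first.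
  by apply: h1 => //; exact: leq_trans (leq_addr _ _) hK.
have := h2 K (leq_trans (leq_addl _ _) hK) => /qdvdN.
rewrite opprB addrC -mulNr opprB horner_poly.
by congr (qdvd N (_ * _ + _)); apply: eq_bigr => j _; rewrite mulrC.
Qed.

Lemma qdvd_prod N (s : seq nat) (P : pred nat) (x y : nat -> Qp) : all P s ->
  (forall a, P a -> qdvd 0 (y a)) -> (forall a, P a -> qdvd N (x a - y a)) ->
  qdvd N (\prod_(a <- s) x a - \prod_(a <- s) y a).
Proof.
move=> sP hy hxy; elim: s sP => [|a s IH] /=.
  by move=> _; rewrite !big_nil subrr; exact: qdvd0.
move=> /andP[Pa Ps]; rewrite !big_cons.
set X := \prod_(_ <- _) _; set Y := \prod_(_ <- _) _.
have hX : qdvd 0 X.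
  rewrite /X; elim: (s) Ps => [|b r IHr] /=.
    by move=> _; rewrite big_nil; exact: (qdvd_nat F 1).
  move=> /andP[Pb /IHr]; rewrite big_cons; apply: qdvdMl.
  by rewrite -[x b](subrK (y b)); apply: qdvdD; [apply: qdvd_le (hxy b Pb)|exact: hy].
have -> : x a * X - y a * Y = X * (x a - y a) + y a * (X - Y) by ring.
by apply: qdvdD; [apply: qdvdMl => //; exact: hxy | apply: qdvdMl; [exact: hy|exact: IH]].
Qed.

(** Expand the product of the Gauss sums of s in two ways: factor by factor each
    is a value of Gamma_p ([gross_koblitz]); multiplied out, it is a sum over
    tuples of the additive character at their sum, where only the question
    whether that sum vanishes matters ([char_valueE]). *)
Theorem Gammap_product (s : seq nat) m :
  all (fun a => a < p.-1)%N s -> sumn s = (p.-1 * m)%N ->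
  (p.-1)%:R * ((-1) ^+ size s * (- p%:R) ^+ m * \prod_(a <- s) Gam (tick p_pr a))
  = p%:R * conv_sum [seq (p.-1 - a)%N | a <- s] 0
     - \prod_(a <- s) \sum_(x : 'F_p) tau x ^+ (p.-1 - a).
Proof.
move=> sa sm; apply: F_inj; apply/eqP; rewrite -subr_eq0; apply/eqP.
apply: (qdvd_eq0 F_inj) => N; rewrite -rmorphB.
have [K0 hK0] := gross_koblitz_unif N (leqnn p).
pose es := [seq (p.-1 - a)%N | a <- s].
pose K := (K0 + 1 + size s * (2 * N * p) + (2 * N * p + (N + p * N)))%N.
pose M := (p.-1 * K.+1)%N.
have KM : (K <= M)%N by rewrite /M mulnS; apply: leq_trans (leq_addl _ _); rewrite leq_pmull.
have GK a : (a < p)%N -> qdvd N ((q - 1) * (theta_section K.+1 a).[- q] + F (Gam (tick p_pr a))).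
  by move=> ap; apply: hK0 => //; rewrite /K -!addnA leq_addr.
have h1 := @ev_prod_theta_sum N M es 1 1 0.
have {h1} : qdvd N (ev (\prod_(e <- es) theta_sum M e) - \sum_(t : 'F_p) F (conv_sum es t) * char_value M t).
  have -> : \sum_(t : 'F_p) F (conv_sum es t) * char_value M t =
     \sum_(t : 'F_p) F (conv_sum es t) * char_value M (padic_modp (0 : Zp) + t).
    by apply: eq_bigr => t _; rewrite -[0]/(0%:R) padic_modp_nat add0r.
  rewrite -[X in ev X]mul1r; apply: h1.
  - by rewrite rmorph0 mul0r; exact: solves1.
  - move=> n; rewrite coef1; case: eqP => _; rewrite -?natrM; exact: qdvd_nat.
  - by move=> [//|n] _; rewrite coef1 mulr0; exact: qdvd0.
  - by apply: leq_trans KM; rewrite size_map /K; lia.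
  - by apply: leq_trans KM; rewrite /K; lia.
  - by rewrite muln_gt0 p1_gt0.
rewrite big_map (ev_prod_graded _ sa sm) => h2.
have t1 : ((p.-1)%:R : Qp) = q - 1.
  by rewrite -[X in X%:R - 1](prednK (prime_gt0 p_pr)) -addn1 natrD addrK.
rewrite t1 in h2.
set G := \prod_(a <- s) Gam (tick p_pr a).
set k := size s in h2 *; set P := \prod_(a <- s) (theta_section K.+1 a).[- q] in h2.
set B := \sum_(t : 'F_p) _ in h2.
have hA : qdvd N ((q - 1) ^+ k * P - (-1) ^+ k * F G).
  have pull (x : Qp) (h : nat -> Qp) (r : seq nat) :
      \prod_(a <- r) (x * h a) = x ^+ size r * \prod_(a <- r) h a.
    elim: r => [|a r IH] /=; first by rewrite !big_nil expr0 mulr1.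
    by rewrite !big_cons IH exprS; ring.
  rewrite rmorph_prod -!pull; apply: (qdvd_prod sa) => a ap.
    by rewrite mulN1r -rmorphN; exact: qdvdZ.
  by rewrite mulN1r opprK; apply: GK; apply: leq_trans ap (leq_pred _).
have hB : qdvd N ((q - 1) * B - (q * F (conv_sum es 0) - F (\sum_(t : 'F_p) conv_sum es t))).
  have -> : (q - 1) * B - (q * F (conv_sum es 0) - F (\sum_(t : 'F_p) conv_sum es t))
     = \sum_(t : 'F_p | t != 0) F (conv_sum es t) * ((q - 1) * (theta_section K.+1 0).[- q] + 1).
    rewrite /B (bigD1 0) //= [X in _ - (_ - F X)](bigD1 0) //=.
    rewrite char_value0 ?muln_gt0 ?p1_gt0 // rmorphD rmorph_sum.
    have -> : \sum_(t : 'F_p | t != 0) F (conv_sum es t) * char_value M t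
        = (\sum_(t : 'F_p | t != 0) F (conv_sum es t)) * (theta_section K.+1 0).[- q].
      by rewrite mulr_suml; apply: eq_bigr => t t0; rewrite char_valueE.
    by rewrite -mulr_suml; ring.
  apply: qdvd_sum => t _; apply: qdvdMl; first exact: qdvdZ.
  have := GK 0%N (prime_gt0 p_pr).
  by rewrite /tick mul0r Gammap0 ?rmorph1 // ltnW.
rewrite -/es rmorphB.
have -> : F ((p.-1)%:R * ((-1) ^+ k * (- p%:R) ^+ m * G)) = (q - 1) * ((- q) ^+ m * ((-1) ^+ k * F G)).
  by rewrite !rmorphM !rmorphXn !rmorphN rmorph1 !rmorph_nat t1; ring.
have -> : F (p%:R * conv_sum es 0 - \prod_(a <- s) \sum_(x : 'F_p) tau x ^+ (p.-1 - a))
  = q * F (conv_sum es 0) - F (\sum_(t : 'F_p) conv_sum es t).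
  by rewrite rmorphB rmorphM rmorph_nat conv_sum_total /es big_map.
move: (q * F (conv_sum es 0) - F (\sum_(t : 'F_p) conv_sum es t)) hB => Y hB.
have -> : (q - 1) * ((- q) ^+ m * ((-1) ^+ k * F G)) - Y =
  - ((q - 1) * ((- q) ^+ m * ((q - 1) ^+ k * P - (-1) ^+ k * F G)))
  + (q - 1) * ((q - 1) ^+ k * (- q) ^+ m * P - B) + ((q - 1) * B - Y) by ring.
have iq : qdvd 0 (q - 1) by apply: qdvdB; [exact: qdvd_nat | exact: (qdvd_nat F 1)].
apply: qdvdD => //; apply: qdvdD; last exact: qdvdMl.
apply: qdvdN; apply: qdvdMl => //; apply: qdvdMl => //.
by apply: qdvd_le (qdvd_negpX F m).
Qed.
End GaussSums.

(** * Jacobi sums, reflection and multiplication formulas *)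
Lemma tofrac_inj (p : nat) (p_pr : prime p) : injective (@tofrac (padic_int p_pr)).
Proof. by move=> x y /eqP; rewrite tofrac_eq => /eqP. Qed.

Section GammaIdentities.
Variables (p : nat) (p_pr : prime p) (p_gt3 : (3 < p)%N).
Local Notation Zp := (padic_int p_pr).
Local Notation Gam := (@Gammap p p_pr).
Local Notation tau := (@teichmuller p p_pr).
Local Notation tick := (tick p_pr).
Local Notation conv_sum := (conv_sum p_pr).

Let p1_gt0 : (0 < p.-1)%N := predp_gt0 p_pr.
Let pp : p.-1.+1 = p.
Proof. by rewrite prednK ?prime_gt0. Qed.
Let p_gt2 : (2 < p)%N := ltnW p_gt3.
Let odd_p : odd p.
Proof. by case: (even_prime p_pr) p_gt2 => [->|]. Qed.

Lemma conv_sum_homog es (c t : 'F_p) : c != 0 ->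
  conv_sum es (c * t) = tau c ^+ sumn es * conv_sum es t.
Proof.
move=> c0; elim: es t => [|e es IH] t /=.
  by rewrite expr0 mul1r mulf_eq0 (negbTE c0).
rewrite (reindex_inj (mulfI c0)) mulr_sumr /=; apply: eq_bigr => x _.
by rewrite -mulrBr IH teichM exprMn exprD; ring.
Qed.

Lemma sum_teich_eq0 e : (0 < e < p.-1)%N -> \sum_(x : 'F_p) tau x ^+ e = 0.
Proof.
case: e => // e /andP[_ ep]; rewrite sum_teichX.
by rewrite gtnNdvd.
Qed.

(** The scaling x |-> c x of the solutions turns the homogeneous count into an
    inhomogeneous one, a Jacobi sum. *)
Lemma Gammap_jacobi a s m : (a < p.-1)%N -> all (fun b => b < p.-1)%N s ->
  has (fun b => 0 < b)%N (a :: s) ->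
  (a + sumn s = p.-1 * m)%N -> let es := [seq (p.-1 - b)%N | b <- s] in
  (-1) ^+ size s * (- p%:R) ^+ m * (Gam (tick a) * \prod_(b <- s) Gam (tick b))
  = - (p%:R * (tau (-1) ^+ sumn es * conv_sum es 1)).
Proof.
move=> ap sa nz sm es.
have pz : ((p.-1)%:R : Zp) != 0 by rewrite padic_nat_neq0.
have al : all (fun b => b < p.-1)%N (a :: s) by rewrite /= ap.
have := Gammap_product p_gt3 (@tofrac_inj p p_pr) al sm.
have -> : \prod_(b <- a :: s) \sum_(x : 'F_p) tau x ^+ (p.-1 - b) = 0.
  apply/eqP; rewrite prodf_seq_eq0; apply/hasP.
  have /hasP[b bs b0] := nz; exists b => //=; apply/eqP/sum_teich_eq0.
  by have := allP al b bs; lia.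
rewrite subr0 big_cons /= -/es => H; apply: (mulfI pz).
have -> : (p.-1)%:R * ((-1) ^+ size s * (- p%:R) ^+ m * (Gam (tick a) * \prod_(b <- s) Gam (tick b)))
  = - ((p.-1)%:R * ((-1) ^+ (size s).+1 * (- p%:R) ^+ m * (Gam (tick a) * \prod_(b <- s) Gam (tick b)))).
  by rewrite exprS; ring.
rewrite H mulrN; congr (- _); rewrite mulrCA; congr (_ * _).
have ms k : (p.-1 %| k)%N -> forall x : 'F_p, x != 0 -> tau x ^+ k = 1.
  move=> /dvdnP[j ->] x x0; have [h _] := teichP p_pr x0.
  by rewrite mulnC exprM h expr1n.
have es_s : (sumn es + sumn s = size s * p.-1)%N.
  rewrite /es; elim: (s) sa => //= b r IH /andP[bp /IH h].
  by rewrite mulSn -h; lia.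
rewrite (bigD1 0) //= teich0 expr0n; have -> : (p.-1 - a == 0)%N = false by lia.
rewrite mul0r add0r (eq_bigr (fun=> tau (-1) ^+ sumn es * conv_sum es 1)); last first.
  move=> x x0; rewrite sub0r -[- x]mulr1 conv_sum_homog ?oppr_eq0 //.
  have -> : - x = -1 * x by rewrite mulN1r.
  rewrite teichM exprMn; set A := tau (-1) ^+ _; set B := conv_sum es 1.
  have -> : tau x ^+ (p.-1 - a) * (A * tau x ^+ sumn es * B)
          = tau x ^+ (p.-1 - a + sumn es) * (A * B) by rewrite exprD; ring.
  rewrite ms ?mul1r //.
  apply/dvdnP; exists ((size s).+1 - m)%N.
  by rewrite mulnBl mulSn -es_s mulnC -sm; lia.
by rewrite sumr_const cardC1 card_Fp // mulr_natl.
Qed.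

Lemma teichN1 : tau (-1) = -1.
Proof.
apply: teich_uniq; last first.
  apply/eqP; rewrite -subr_eq0 opprK; apply/eqP.
  have := padic_modpD (-1 : Zp) 1; rewrite addNr.
  by rewrite -[0 in LHS]/(0%:R) -{2}[1 in RHS]/(1%:R) !padic_modp_nat => <-.
by rewrite -signr_odd -subn1 oddB ?prime_gt0 // odd_p.
Qed.

Lemma Gammap_reflection a : (0 < a < p.-1)%N ->
  Gam (tick a) * Gam (tick (p.-1 - a)) = - (-1) ^+ a.
Proof.
move=> /andP[a0 ap].
have h := @Gammap_jacobi a [:: (p.-1 - a)%N] 1; move: h.
rewrite ap /= a0 big_seq1 addn0 subnKC ?(ltnW ap) // muln1 => /(_ isT).
rewrite andbT; have -> : (p.-1 - a < p.-1)%N by lia.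
move=> /(_ isT isT erefl); rewrite subKn ?(ltnW ap) // addn0 expr1 teichN1 expr1.
rewrite (bigD1 1) //= subrr eqxx teich1 expr1n mulr1 big1; last first.
  by move=> x x1; rewrite subr_eq0 eq_sym (negbTE x1) mulr0.
move=> h; apply: (mulfI (padic_p_neq0 p_pr)).
rewrite (_ : p%:R * _ = -1 * (- p%:R) * (Gam (tick a) * Gam (tick (p.-1 - a)))); last by ring.
by rewrite h; ring.
Qed.

(** Gauss' multiplication formula at a natural number, by induction on n: both
    sides change by the same factor, as Gamma_p (x + 1) = - x Gamma_p (x) or
    - Gamma_p (x). *)
Lemma Gammap_mul_nat m n : (0 < m)%N -> ~~ (p %| m)%N ->
  \prod_(h < m) Gam ((n + h)%:R / m%:R) * m%:R ^+ (\sum_(j < n) ~~ (p %| j)%N)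
  = Gam n%:R * \prod_(h < m) Gam (h%:R / m%:R).
Proof.
move=> m0 pm; have um : (m%:R : Zp) \is a GRing.unit by rewrite padic_nat_unit.
elim: n => [|n IH].
  by rewrite big_ord0 expr0 mulr1 Gammap0 // mul1r.
pose f h := Gam ((n + h)%:R / m%:R).
have sh : (\prod_(h < m) Gam ((n.+1 + h)%:R / m%:R)) * f 0%N = (\prod_(h < m) f h) * f m.
  rewrite -(big_ord_recr m f) big_ord_recl mulrC; congr (_ * _).
  by apply: eq_bigr => h _; rewrite /f lift0 addnS.
have fm : f m = - (f 0%N * (if (p %| n)%N then 1 else n%:R / m%:R)).
  rewrite /f natrD mulrDl divrr // GammapS // addn0; congr (- (_ * _)).
  by rewrite unitrM unitrV um andbT padic_nat_unit // if_neg.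
have uf : f 0%N \is a GRing.unit by apply: Gammap_unit.
have -> : \prod_(h < m) Gam ((n.+1 + h)%:R / m%:R) =
  - ((\prod_(h < m) f h) * (if (p %| n)%N then 1 else n%:R / m%:R)).
  by apply: (mulIr uf); rewrite sh fm; ring.
rewrite big_ord_recr /= exprD -addn1 natrD GammapS // padic_nat_unit //.
have -> : forall a b e c : Zp, - (a * b) * (e * c) = - (a * e * (b * c)) by move=> *; ring.
rewrite IH if_neg; case: ifP => _ /=; first by rewrite expr0; ring.
by rewrite expr1 divrK //; ring.
Qed.

Lemma count_prime_to s b : (b < p)%N -> (b <= p * s)%N ->
  ((\sum_(j < p * s - b) ~~ (p %| j)%N) + b = s * p.-1)%N.
Proof.
move=> bp bs.
have h1 k : (\sum_(j < p * k) ~~ (p %| j)%N = k * p.-1)%N.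
  elim: k => [|k IH]; first by rewrite muln0 big_ord0.
  rewrite mulnS addnC -(big_mkord xpredT (fun j => nat_of_bool (~~ (p %| j)%N))).
  rewrite (big_cat_nat (n := p * k)) //= ?leq_addr // big_mkord IH.
  rewrite mulSn addnC; congr (_ + _)%N.
  rewrite -{1}[(p * k)%N]add0n big_addn addKn big_ltn ?prime_gt0 //.
  rewrite add0n dvdn_mulr // add0n.
  rewrite (eq_big_nat _ _ (F2 := fun=> 1%N)); last first.
    move=> i /andP[i0 ip]; rewrite dvdn_addl ?dvdn_mulr //.
    by rewrite gtnNdvd.
  by rewrite sum_nat_const_nat muln1 subn1.
rewrite -h1 -!(big_mkord xpredT (fun j => nat_of_bool (~~ (p %| j)%N))).
rewrite [RHS](big_cat_nat (n := p * s - b)) //= ?leq_subr //; congr (_ + _)%N.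
rewrite (eq_big_nat _ _ (F2 := fun=> 1%N)); last first.
  move=> i /andP[i0 ip]; apply/eqP; rewrite eqb1; apply/negP => /dvdnP[k kE].
  have [s' sE] : exists s', s = s'.+1.
    by case: (s) ip => [|s' _]; [rewrite muln0 | exists s'].
  have : (k <= s')%N.
    by rewrite -ltnS -sE -(ltn_pmul2l (prime_gt0 p_pr)) mulnC -kE.
  move: i0; rewrite kE sE mulnS => i0 ks.
  have : (k * p <= p * s')%N by rewrite mulnC leq_mul2l ks orbT.
  lia.
by rewrite sum_nat_const_nat muln1 subKn.
Qed.

Lemma teich_pow_approx m N : pdvd N.+1 ((m%:R : Zp) ^+ (p ^ N) - tau m%:R).
Proof.
have h0 : pdvd 1 ((m%:R : Zp) - tau m%:R).
  by apply/padic_modpE; rewrite teich_modp padic_modp_nat.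
elim: N => [|N IH]; first by rewrite expr1.
by rewrite -teich_expp expnSr exprM; apply: pdvd_subXp.
Qed.

(** The same formula at b / (p - 1), by approximating it by natural numbers n.
    These are chosen such that the number of j < n prime to p is b (p - 2) p^N;
    then the power of m in [Gammap_mul_nat] tends to a power of its Teichmueller
    representative. *)
Lemma Gammap_mul m b : (0 < m)%N -> ~~ (p %| m)%N -> (b < p.-1)%N ->
  \prod_(h < m) Gam ((tick b + h%:R) / m%:R)
  = tau m%:R ^+ b * (Gam (tick b) * \prod_(h < m) Gam (h%:R / m%:R)).
Proof.
move=> m0 pm bp; have bp' : (b < p)%N by apply: leq_trans bp (leq_pred _).
have um : (m%:R : Zp) \is a GRing.unit by rewrite padic_nat_unit.
have tm0 : (m%:R : 'F_p) != 0 by rewrite (Fp_nat_eq0 p_pr).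
have [t1 _] := teichP p_pr tm0.
suff H : (\prod_(h < m) Gam ((tick b + h%:R) / m%:R)) * tau m%:R ^+ (b * (p - 2))
   = Gam (tick b) * \prod_(h < m) Gam (h%:R / m%:R).
  rewrite -H mulrCA -exprD -mulnS -[X in (b * X)%N]/((p - 2).+1).
  have -> : (p - 2).+1 = p.-1 by lia.
  by rewrite mulnC exprM t1 expr1n mulr1.
apply: pdvd_eqP => N; apply: (@pdvd_le _ _ _ N.+1) => //.
pose R k := (\sum_(i < k) p ^ i)%N.
have RS k : (R k.+1 = 1 + p * R k)%N.
  rewrite /R big_ord_recl big_distrr /=; congr (_ + _)%N.
  by apply: eq_bigr => i _; rewrite expnS.
have Rle k : (R k <= p ^ k)%N.
  elim: k => [|k IH]; first by rewrite /R big_ord0.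
  rewrite /R big_ord_recr /= -/(R k) expnS.
  apply: (@leq_trans (2 * p ^ k)); last by rewrite leq_mul2r prime_gt1 ?orbT.
  by rewrite mul2n -addnn leq_add2r.
pose s := (b * (p ^ N - R N))%N; pose n := (p * s - b)%N.
have Rp : (p.-1 * R N).+1 = (p ^ N)%N.
  elim: (N) => [|k IH]; first by rewrite /R big_ord0 muln0.
  rewrite /R big_ord_recr /= -/(R k) mulnDr -addSn IH -mulSn pp.
  by rewrite -expnS.
have bs : (b <= p * s)%N.
  rewrite /s mulnCA; apply: leq_pmulr; rewrite muln_gt0 prime_gt0 //= subn_gt0.
  rewrite -Rp ltnS leq_pmull //.
have En : (\sum_(j < n) ~~ (p %| j) = b * (p - 2) * p ^ N)%N.
  have := count_prime_to bp' bs; rewrite -/n => h.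
  apply/eqP; rewrite -(eqn_add2r b) h; apply/eqP.
  have [u uE] : exists u, (p.-1 = u.+1)%N by exists (p.-1).-1; rewrite prednK.
  have -> : (p - 2 = u)%N by lia.
  rewrite /s -Rp uE mulSn subSn ?leq_addr // addKn.
  by move: (R N) => r; ring.
have hn : pdvd N.+1 (tick b - n%:R).
  have := tick_approx p_pr b N.+1; rewrite -/(R N.+1).
  have -> : (n%:R : Zp) = b%:R * p%:R ^+ N.+1 - (b * R N.+1)%:R.
    rewrite /n natrB // /s RS !natrM natrB ?Rle // natrD natrM exprS natrX; ring.
  move=> h; rewrite opprB addrA; apply: pdvdB => //.
  by apply: pdvdMl; exact: pdvd_exp.
have := Gammap_mul_nat n m0 pm; rewrite En => hM.
apply: (@pdvd_trans _ _ _ (\prod_(h < m) Gam ((n + h)%:R / m%:R) * m%:R ^+ (b * (p - 2) * p ^ N))).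
  apply: pdvd_subM; last first.
    have -> : m%:R ^+ (b * (p - 2) * p ^ N) = (m%:R ^+ (p ^ N)) ^+ (b * (p - 2)) :> Zp.
      by rewrite -exprM mulnC.
    by apply: pdvd_subX; apply: pdvd_sym; exact: teich_pow_approx.
  elim/big_rec2: _ => [|h x y _ IH]; first by rewrite subrr; exact: pdvd0.
  apply: pdvd_subM => //; apply: Gammap_congr => //.
  by rewrite natrD -mulrBl opprD addrACA subrr addr0; exact: pdvdMr.
rewrite hM; apply: pdvd_subM; last by rewrite subrr; exact: pdvd0.
by apply: Gammap_congr => //; exact: pdvd_sym.
Qed.
End GammaIdentities.

(** * McCarthy's function as a point count *)

Lemma tick0 (p : nat) (p_pr : prime p) : tick p_pr 0 = 0.
Proof. by rewrite /tick mul0r. Qed.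
Section Hypergeometric.
Variables (p : nat) (p_pr : prime p) (p_gt3 : (3 < p)%N).
Local Notation Zp := (padic_int p_pr).
Local Notation Gam := (@Gammap p p_pr).
Local Notation tau := (@teichmuller p p_pr).
Local Notation tick := (tick p_pr).
Local Notation conv_sum := (conv_sum p_pr).

Let p1_gt0 : (0 < p.-1)%N := predp_gt0 p_pr.
Let pp : p.-1.+1 = p.
Proof. by rewrite prednK ?prime_gt0. Qed.
Let p_gt2 : (2 < p)%N := ltnW p_gt3.
Let p_ndvd2 : ~~ (p %| 2)%N. Proof. by rewrite gtnNdvd. Qed.
Let p_ndvd3 : ~~ (p %| 3)%N. Proof. by rewrite gtnNdvd. Qed.
Let p_ndvdp : ~~ (p %| p.-1)%N.
Proof. by rewrite -(padic_nat_unit p_pr) predp_unit. Qed.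
Let rat_p1 : (p%:R - 1 : rat) = (p.-1)%:R.
Proof. by rewrite -[X in X%:R - 1]pp -addn1 natrD addrK. Qed.
Let rat_p1_gt0 : (0 : rat) < (p.-1)%:R.
Proof. by rewrite ltr0n. Qed.

(** To evaluate the image of a rational number in Z_p it is enough to find a
    denominator prime to p. *)
Lemma ratr_Zp (x : rat) (n : int) d (u : Zp) : ~~ (p %| d)%N ->
  x * d%:R = n%:~R -> u * d%:R = n%:~R -> ratr x = u.
Proof.
move=> pd xd ud.
have uud : (d%:R : Zp) \is a GRing.unit by rewrite padic_nat_unit.
have E : numq x * d%:Z = n * denq x.
  have dx : (denq x)%:~R != 0 :> rat by rewrite intr_eq0 denq_neq0.
  apply: (@intr_inj rat); rewrite !rmorphM /= -xd mulrAC; congr (_ * _).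
  by rewrite -{2}[x]divq_num_den divfK.
have dd : (`|denq x| %| d)%N.
  have h : (denq x %| numq x * d%:Z)%Z by rewrite E dvdz_mull.
  move: h; rewrite dvdzE abszM Gauss_dvdr //.
  by rewrite coprime_sym coprime_num_den.
have ux : ((denq x)%:~R : Zp) \is a GRing.unit.
  have -> : denq x = `|denq x|%N%:Z by rewrite absz_denq.
  rewrite -pmulrn padic_nat_unit //; apply: contra pd => h; exact: dvdn_trans h dd.
apply: (mulIr uud); rewrite ud /ratr mulrAC; apply: (mulIr ux).
by rewrite divrK // -[d%:R]/(d%:Z%:~R) -!rmorphM E.
Qed.

Definition rat_tick j : rat := j%:R / (p%:R - 1).

Lemma rat_tick_ge s m j : (0 < m)%N -> (rat_tick j <= s%:R / m%:R) = (m * j <= s * p.-1)%N.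
Proof.
move=> m0; rewrite /rat_tick rat_p1 ler_pdivrMr // mulrAC ler_pdivlMr ?ltr0n //.
by rewrite -!natrM ler_nat [(m * j)%N]mulnC.
Qed.

Lemma ratr_shift s m j : ~~ (p %| m)%N ->
  ratr (s%:R / m%:R - rat_tick j) = s%:R / m%:R - tick j :> Zp.
Proof.
move=> pm; have m0 : (m%:R : rat) != 0.
  by rewrite pnatr_eq0; apply: contraNneq pm => ->; rewrite dvdn0.
have um : (m%:R : Zp) \is a GRing.unit by rewrite padic_nat_unit.
apply: (@ratr_Zp _ ((s * p.-1)%:Z - (m * j)%:Z) (m * p.-1)).
- by rewrite Euclid_dvdM // negb_or pm p_ndvdp.
- have := lt0r_neq0 rat_p1_gt0; rewrite /rat_tick rat_p1 rmorphB /= !natrM.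
  rewrite -!pmulrn !natrM; move: (p.-1)%:R (m%:R) m0 => P M M0 P0.
  by field; rewrite P0 M0.
- rewrite intrB /= -!pmulrn !natrM mulrBl mulrA divrK //; congr (_ - _).
  by rewrite mulrCA [_ * (p.-1)%:R]mulrC tickE.
Qed.

Lemma ratr_nat_div s m : ~~ (p %| m)%N -> ratr (s%:R / m%:R) = s%:R / m%:R :> Zp.
Proof.
by move=> pm; have := @ratr_shift s m 0 pm; rewrite /rat_tick tick0 mul0r !subr0.
Qed.

Lemma floor_eq (x : rat) (n : int) : n%:~R <= x -> x < n%:~R + 1 -> Num.floor x = n.
Proof. by move=> h1 h2; apply/floor_def; rewrite h1 intrD. Qed.

Lemma fracpart_id (x : rat) : 0 <= x -> x < 1 -> fracpart x = x.
Proof. by move=> h1 h2; rewrite /fracpart (@floor_eq x 0) ?add0r // subr0. Qed.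

Lemma tick_compl j : (j <= p.-1)%N -> 1 - tick j = tick (p.-1 - j).
Proof.
move=> jp; apply: (mulrI (predp_unit p_pr)).
by rewrite mulrBr !tickE mulr1 natrB.
Qed.

Lemma tick_frac m j b c : (m * j + b = c * p.-1)%N -> tick b = c%:R - m%:R * tick j.
Proof.
move=> E; apply: (mulrI (predp_unit p_pr)).
rewrite mulrBr tickE [X in _ - X]mulrCA tickE -!natrM mulnC -E natrD addrC addKr.
by [].
Qed.

Variables (Qp : fieldType) (F : {rmorphism Zp -> Qp}) (F_inj : injective F).

(** The contribution of one upper parameter to a summand *)
Definition hyp_factor (a : rat) j : Qp :=
  (- p%:R) ^ (- Num.floor (fracpart a - rat_tick j)) *
  (F (Gam (ratr (fracpart (a - rat_tick j)))) / F (Gam (ratr (fracpart a)))).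

Let FGam x : F (Gam x) != 0.
Proof.
rewrite -(rmorph0 F) (inj_eq F_inj).
by have := Gammap_unit p_gt2 x; apply: contraTneq => ->; rewrite unitr0.
Qed.

(** The floor is k = 0 or 1 according to the position of j / (p - 1) with respect
    to the parameter s / m. *)
Lemma hyp_factor_eq (s m k j : nat) : (m <= 3)%N -> (0 < m)%N -> (s < m)%N -> (j < p.-1)%N ->
  (if k == 0%N then (m * j <= s * p.-1)%N else (k == 1%N) && (s * p.-1 < m * j)%N) ->
  hyp_factor (s%:R / m%:R) j * F (Gam (s%:R / m%:R)) =
  (- p%:R) ^+ k * F (Gam ((s + k * m)%:R / m%:R - tick j)).
Proof.
move=> m3 m0 sm jp hk.
have pm : ~~ (p %| m)%N by rewrite gtnNdvd // (leq_ltn_trans m3).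
have M0 : (m%:R : rat) != 0 by rewrite pnatr_eq0 -lt0n.
have r0 : 0 <= rat_tick j by rewrite /rat_tick rat_p1 divr_ge0 // ler0n.
have r1 : rat_tick j < 1 by rewrite /rat_tick rat_p1 ltr_pdivrMr // mul1r ltr_nat.
have a0 : 0 <= (s%:R / m%:R : rat) by rewrite divr_ge0 // ler0n.
have a1 : (s%:R / m%:R : rat) < 1 by rewrite ltr_pdivrMr ?ltr0n // mul1r ltr_nat.
rewrite /hyp_factor (fracpart_id a0 a1) ratr_nat_div // -mulrA divfK ?FGam //.
case: k hk => [|[|k]] //= hk.
  rewrite mul0n addn0 expr0; have := rat_tick_ge s j m0; rewrite hk => h.
  have f0 : Num.floor (s%:R / m%:R - rat_tick j : rat) = 0.
    by apply: floor_eq; [rewrite subr_ge0 | rewrite add0r; lra].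
  by rewrite /fracpart f0 oppr0 expr0z subr0 ratr_shift.
have := rat_tick_ge s j m0; rewrite leqNgt hk /= => /negbT; rewrite -ltNge => h.
have f1 : Num.floor (s%:R / m%:R - rat_tick j : rat) = -1.
  by apply: floor_eq; [rewrite rmorphN1; lra | rewrite rmorphN1; lra].
rewrite /fracpart f1 opprK expr1z expr1 mul1n rmorphN1 opprK.
congr (_ * F (Gam _)); rewrite -ratr_shift //; congr (ratr _).
by rewrite natrD mulrDl divff // addrAC.
Qed.

Lemma Gammap_mul_shift m c b j : (0 < m)%N -> ~~ (p %| m)%N -> (b < p.-1)%N ->
  (m * j + b = c * p.-1)%N ->
  \prod_(h < m) Gam ((h + c)%:R / m%:R - tick j)
  = tau m%:R ^+ b * (Gam (tick b) * \prod_(h < m) Gam (h%:R / m%:R)).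
Proof.
move=> m0 pm bp E; rewrite -Gammap_mul //; apply: eq_bigr => h _; congr Gam.
have um : (m%:R : Zp) \is a GRing.unit by rewrite padic_nat_unit.
apply: (mulIr um); rewrite (tick_frac E) mulrBl !divrK // natrD; ring.
Qed.

(** The parameter 1/2 together with the lower parameter 0 gives the arguments
    h / 2 - j / (p - 1) for two consecutive h, to which the multiplication formula
    applies; b is - 2 j modulo p - 1. *)
Lemma hyp_factor2 j : (0 < j < p.-1)%N -> exists c b, [/\ (b < p.-1)%N,
  (2 * j + b = c.+1 * p.-1)%N &
  hyp_factor (1 / 2) j * F (Gam (tick (p.-1 - j)))
   = F ((- p%:R) ^+ c * tau 2%:R ^+ b * Gam (tick b))].
Proof.
move=> /andP[j0 jp]; have u2 : (2%:R : Zp) \is a GRing.unit by rewrite padic_nat_unit.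
suff [c [b [c2 bp E]]] : exists c b, [/\ (c < 2)%N, (b < p.-1)%N & (2 * j + b = c.+1 * p.-1)%N].
  exists c, b; split=> //; apply: (mulIf (FGam (1%:R / 2%:R))).
  have hf := @hyp_factor_eq 1 2 c j isT isT isT jp.
  rewrite -[LHS]mulrA [X in _ * X]mulrC mulrA hf; last first.
    by case: c c2 E {hf} => [|[|]] //= _; lia.
  have := @Gammap_mul_shift 2 c.+1 b j isT p_ndvd2 bp E.
  rewrite !big_ord_recr !big_ord0 /= mul0r Gammap0 // !mul1r => h.
  rewrite (_ : (- p%:R : Qp) ^+ c = F ((- p%:R) ^+ c)); last first.
    by rewrite rmorphXn rmorphN rmorph_nat.
  rewrite -!rmorphM; congr (F _).
  rewrite ?mul1r; transitivity ((- p%:R) ^+ c * (tau 2%:R ^+ b * (Gam (tick b) * Gam (2%:R^-1)))); last by ring.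
  rewrite -h -tick_compl ?(ltnW jp) // -mulrA; congr (_ * _).
  have -> : 1 - tick j = 2%:R / 2%:R - tick j by rewrite divrr.
  case: c c2 {E h hf} => [|[|//]] _; first by [].
  by rewrite [LHS]mulrC.
have [h|h] := leqP (2 * j) p.-1; [exists 0%N, (p.-1 - 2 * j)%N | exists 1%N, (2 * p.-1 - 2 * j)%N].
  by split=> //; lia.
by split=> //; lia.
Qed.

(** The same with the parameters 1/3, 2/3 and 0. *)
Lemma hyp_factor3 j : (0 < j < p.-1)%N -> exists c b, [/\ (b < p.-1)%N,
  (3 * j + b = c.+1 * p.-1)%N &
  hyp_factor (1 / 3) j * hyp_factor (2 / 3) j * F (Gam (tick (p.-1 - j)))
   = F ((- p%:R) ^+ c * tau 3%:R ^+ b * Gam (tick b))].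
Proof.
move=> /andP[j0 jp]; have u3 : (3%:R : Zp) \is a GRing.unit by rewrite padic_nat_unit.
suff [c [b [c3 bp E]]] : exists c b, [/\ (c < 3)%N, (b < p.-1)%N & (3 * j + b = c.+1 * p.-1)%N].
  exists c, b; split=> //.
  have n0 : F (Gam (1%:R / 3%:R)) * F (Gam (2%:R / 3%:R)) != 0 by rewrite mulf_neq0.
  apply: (mulIf n0).
  have h1 := @hyp_factor_eq 1 3 (0 < c)%N j isT isT isT jp.
  have h2 := @hyp_factor_eq 2 3 (1 < c)%N j isT isT isT jp.
  have -> : forall x y z u v : Qp, x * y * z * (u * v) = (x * u) * (y * v) * z.
    by move=> *; ring.
  rewrite [X in X * _ * _ = _]h1; last first.
    clear -c3 E bp; move: (p.-1) bp E => P bp E.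
    by case: c c3 E => [|[|[|]]] //= _ E; lia.
  rewrite [X in _ * X * _ = _]h2; last first.
    clear -c3 E bp; move: (p.-1) bp E => P bp E.
    by case: c c3 E => [|[|[|]]] //= _ E; lia.
  have := @Gammap_mul_shift 3 c.+1 b j isT p_ndvd3 bp E.
  rewrite !big_ord_recr !big_ord0 /= mul0r Gammap0 // !mul1r => h.
  have pF k : (- p%:R : Qp) ^+ k = F ((- p%:R) ^+ k).
    by rewrite rmorphXn rmorphN rmorph_nat.
  rewrite !pF -!rmorphM; congr (F _).
  rewrite ?mul1r; transitivity ((- p%:R) ^+ c * (tau 3%:R ^+ b * (Gam (tick b) * (Gam (3%:R^-1) * Gam (2%:R / 3%:R))))); last by ring.
  rewrite -h -tick_compl ?(ltnW jp) //.
  have -> : 1 - tick j = 3%:R / 3%:R - tick j by rewrite divrr.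
  case: c c3 {E h h1 h2} => [|[|[|//]]] _ /=.
  - rewrite !expr0 !mul1r; reflexivity.
  - rewrite !expr0.
    have -> : forall x y z u : Zp, x * y * (1 * z) * u = x * (z * u * y) by move=> *; ring.
    reflexivity.
  - rewrite !expr1 expr2.
    have -> : forall x y z u : Zp, x * y * (x * z) * u = x * x * (u * y * z) by move=> *; ring.
    reflexivity.
have [h|h] := leqP (3 * j) p.-1; first by exists 0%N, (p.-1 - 3 * j)%N; split=> //; lia.
have [h'|h'] := leqP (3 * j) (2 * p.-1).
  by exists 1%N, (2 * p.-1 - 3 * j)%N; split=> //; lia.
by exists 2%N, (3 * p.-1 - 3 * j)%N; split=> //; lia.
Qed.

Local Notation J2 e := (conv_sum [:: e; e] 1).
Local Notation J3 e := (conv_sum [:: e; e; e] 1).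

Lemma teich_exp_congr (x : 'F_p) a b k : x != 0 -> (a = b + k * p.-1)%N ->
  tau x ^+ a = tau x ^+ b.
Proof.
move=> x0 ->; have [h _] := teichP p_pr x0.
by rewrite exprD mulnC exprM h expr1n mulr1.
Qed.

(** Each of the two multiplication formulas leaves one value of Gamma_p at a
    multiple of 1/(p-1). Together with two, resp. three, factors
    Gamma_p (j / (p - 1)) it is a Jacobi sum, and all the powers of p cancel. The
    number 108 = 2^2 3^3 comes from the powers of 2 and 3 in the multiplication
    formulas. *)
Lemma hyp_term j : (0 < j < p.-1)%N -> let e := (p.-1 - j)%N in
  (-1) ^+ (j * 3) * (hyp_factor (1 / 2) j * hyp_factor (1 / 3) j * hyp_factor (2 / 3) j
    * F (Gam (tick j)) ^+ 3)
  = - F (tau 108%:R ^+ e * J2 e * J3 e).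
Proof.
move=> jb e; have /andP[j0 jp] := jb.
have [c2 [b2 [bp2 E2 H2]]] := hyp_factor2 jb.
have [c3 [b3 [bp3 E3 H3]]] := hyp_factor3 jb.
have pZ : (p%:R : Zp) != 0 := padic_p_neq0 p_pr.
have G0 := FGam (tick e).
have refl := Gammap_reflection p_pr p_gt3 jb; rewrite -/e in refl.
have teN1 : tau (-1) = -1 := teichN1 p_pr p_gt3.
have K2 : (- p%:R) ^+ c2 * Gam (tick b2) * Gam (tick j) ^+ 2 = J2 e.
  have al : all (fun b => b < p.-1)%N [:: j; j] by rewrite /= jp.
  have nz : has (fun b => 0 < b)%N [:: b2; j; j] by rewrite /= j0 orbT.
  have E : (b2 + sumn [:: j; j] = p.-1 * c2.+1)%N by rewrite /=; lia.
  have h : (-1) ^+ 2 * (- p%:R) ^+ c2.+1 * (Gam (tick b2) * \prod_(b <- [:: j; j]) Gam (tick b))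
    = - (p%:R * (tau (-1) ^+ (e + (e + 0)) * J2 e)) := Gammap_jacobi p_pr p_gt3 bp2 al nz E.
  rewrite teN1 big_cons big_seq1 in h; apply: (mulfI pZ).
  have -> : p%:R * J2 e = p%:R * ((-1) ^+ (e + (e + 0)) * J2 e).
    by rewrite addn0 addnn -mul2n exprM sqrrN expr1n expr1n mul1r.
  by rewrite -[RHS]opprK -h [_ ^+ c2.+1]exprS; ring.
have K3 : (- p%:R) ^+ c3 * Gam (tick b3) * Gam (tick j) ^+ 3 = - ((-1) ^+ e * J3 e).
  have al : all (fun b => b < p.-1)%N [:: j; j; j] by rewrite /= jp.
  have nz : has (fun b => 0 < b)%N [:: b3; j; j; j] by rewrite /= j0 orbT.
  have E : (b3 + sumn [:: j; j; j] = p.-1 * c3.+1)%N by rewrite /=; lia.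
  have h : (-1) ^+ 3 * (- p%:R) ^+ c3.+1 * (Gam (tick b3) * \prod_(b <- [:: j; j; j]) Gam (tick b))
    = - (p%:R * (tau (-1) ^+ (e + (e + (e + 0))) * J3 e)) := Gammap_jacobi p_pr p_gt3 bp3 al nz E.
  rewrite teN1 2!big_cons big_seq1 in h; apply: (mulfI pZ).
  have -> : p%:R * - ((-1) ^+ e * J3 e) = - (p%:R * ((-1) ^+ (e + (e + (e + 0))) * J3 e)).
    rewrite addn0 addnA addnn exprD -mul2n exprM sqrrN expr1n expr1n mul1r.
    by rewrite mulrN.
  by rewrite -h [_ ^+ c3.+1]exprS; ring.
have t2 : (2%:R : 'F_p) != 0 by rewrite (Fp_nat_eq0 p_pr).
have t3 : (3%:R : 'F_p) != 0 by rewrite (Fp_nat_eq0 p_pr).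
have T2 : tau 2%:R ^+ b2 = tau 2%:R ^+ (2 * e).
  apply/esym/(@teich_exp_congr _ _ _ (1 - c2)) => //.
  have : (c2 <= 1)%N by rewrite -ltnS -(ltn_pmul2r p1_gt0) in E2 *; lia.
  by case: (c2) E2 => [|[|//]] E2 _; rewrite /e; lia.
have T3 : tau 3%:R ^+ b3 = tau 3%:R ^+ (3 * e).
  apply/esym/(@teich_exp_congr _ _ _ (2 - c3)) => //.
  have : (c3 <= 2)%N by rewrite -ltnS -(ltn_pmul2r p1_gt0) in E3 *; lia.
  by case: (c3) E3 => [|[|[|//]]] E3 _; rewrite /e; lia.
have T108 : tau 108%:R = tau 2%:R ^+ 2 * tau 3%:R ^+ 3.
  by rewrite -!teichX -teichM -!natrX -natrM.
have sgn : (-1) ^+ (j * 3) = (-1) ^+ e :> Zp.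
  have odd_p : odd p by case: (even_prime p_pr) p_gt2 => [->|].
  rewrite -[LHS]signr_odd -[RHS]signr_odd oddM /= andbT /e oddB ?(ltnW jp) //.
  by rewrite -[in odd p.-1]subn1 oddB ?prime_gt0 // odd_p.
apply: (mulIf (mulf_neq0 G0 G0)).
have -> : forall s h1 h2 h3 g g' : Qp, s * (h1 * h2 * h3 * g ^+ 3) * (g' * g') =
   s * ((h1 * g') * (h2 * h3 * g') * g ^+ 3) by move=> *; ring.
rewrite [X in _ * (X * _ * _) = _]H2 [X in _ * (_ * X * _) = _]H3.
rewrite (_ : (-1) ^+ (j * 3) = F ((-1) ^+ e)); last first.
  by rewrite -sgn rmorphXn rmorphN1.
rewrite -rmorphXn -!rmorphM -rmorphN -rmorphM; congr (F _).
have sq : (-1) ^+ e * (-1) ^+ e = 1 :> Zp by rewrite -exprMn mulrNN mulr1 expr1n.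
have gg : Gam (tick j) ^+ 2 * Gam (tick e) ^+ 2 = 1.
  by rewrite -exprMn refl sqrrN -exprM mulnC exprM sqrrN !expr1n.
have J3E : J3 e = - ((-1) ^+ e * ((- p%:R) ^+ c3 * Gam (tick b3) * Gam (tick j) ^+ 3)).
  by rewrite K3 mulrN opprK mulrA sq mul1r.
rewrite T108 -K2 J3E T2 T3 exprMn -!exprM.
transitivity ((-1) ^+ e * tau 2%:R ^+ (2 * e) * tau 3%:R ^+ (3 * e) * ((- p%:R) ^+ c2 * Gam (tick b2))
   * ((- p%:R) ^+ c3 * Gam (tick b3)) * Gam (tick j) ^+ 3 * 1); first by ring.
by rewrite -gg; ring.
Qed.

(** The three lower parameters 0 contribute Gamma_p (j / (p - 1)) each. *)
Lemma hyp_inner (a : rat) j : (j < p.-1)%N ->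
  (- p%:R) ^ (- Num.floor (fracpart a - rat_tick j) - Num.floor (fracpart (- 0) + rat_tick j)) *
  (F (Gam (ratr (fracpart (a - rat_tick j)))) / F (Gam (ratr (fracpart a)))) *
  (F (Gam (ratr (fracpart (- 0 + rat_tick j)))) / F (Gam (ratr (fracpart (- 0)))))
  = hyp_factor a j * F (Gam (tick j)) :> Qp.
Proof.
move=> jp; have r0 : 0 <= rat_tick j by rewrite /rat_tick rat_p1 divr_ge0 // ler0n.
have r1 : rat_tick j < 1 by rewrite /rat_tick rat_p1 ltr_pdivrMr // mul1r ltr_nat.
have -> : fracpart (- 0) = 0 by rewrite oppr0 fracpart_id.
rewrite oppr0 !add0r (fracpart_id r0 r1) (@floor_eq (rat_tick j) 0) ?add0r // subr0.
have -> : ratr (rat_tick j) = tick j.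
  apply: (@ratr_Zp _ j p.-1) => //; last by rewrite mulrC tickE.
  by rewrite /rat_tick rat_p1 divfK ?lt0r_neq0.
have -> : ratr 0 = 0 :> Zp by apply: (@ratr_Zp _ 0 1); rewrite ?mul0r // gtnNdvd ?prime_gt1.
by rewrite Gammap0 // rmorph1 divr1 /hyp_factor.
Qed.

Lemma conv1E e t : conv_sum [:: e] t = tau t ^+ e.
Proof.
rewrite /= (bigD1 t) //= subrr eqxx mulr1 big1 ?addr0 // => x xt.
by rewrite subr_eq0 eq_sym (negbTE xt) mulr0.
Qed.

Lemma conv2E e t : conv_sum [:: e; e] t = \sum_(x : 'F_p) tau (x * (t - x)) ^+ e.
Proof.
transitivity (\sum_(x : 'F_p) tau x ^+ e * conv_sum [:: e] (t - x)); first by [].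
by apply: eq_bigr => x _; rewrite conv1E teichM exprMn.
Qed.

Lemma conv3E e : J3 e = \sum_(y : 'F_p) \sum_(z : 'F_p) tau (y * (z * (1 - y - z))) ^+ e.
Proof.
transitivity (\sum_(y : 'F_p) tau y ^+ e * conv_sum [:: e; e] (1 - y)); first by [].
apply: eq_bigr => y _; rewrite conv2E mulr_sumr; apply: eq_bigr => z _.
by rewrite [in RHS]teichM exprMn.
Qed.

Definition point_count : nat := \sum_(x : 'F_p) \sum_(y : 'F_p) \sum_(z : 'F_p)
  nat_of_bool (108%:R * (x * (1 - x)) * (y * (z * (1 - y - z))) == 1)%R.

(** Orthogonality of characters turns the sum of the products of Jacobi sums over
    all characters into a number of points. *)
Lemma sum_jacobi : \sum_(1 <= e < p) tau 108%:R ^+ e * J2 e * J3 e = (p.-1 * point_count)%:R.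
Proof.
rewrite natrM /point_count natr_sum mulr_sumr.
transitivity (\sum_(1 <= e < p) \sum_(x : 'F_p) \sum_(y : 'F_p) \sum_(z : 'F_p)
   tau (108%:R * (x * (1 - x)) * (y * (z * (1 - y - z)))) ^+ e).
  apply: eq_bigr => e _; rewrite conv2E conv3E [_ ^+ e * _]mulr_sumr mulr_suml.
  apply: eq_bigr => x _; rewrite mulr_sumr; apply: eq_bigr => y _.
  rewrite mulr_sumr; apply: eq_bigr => z _.
  by rewrite -!exprMn -!teichM.
rewrite exchange_big; apply: eq_bigr => x _; rewrite exchange_big natr_sum mulr_sumr.
apply: eq_bigr => y _; rewrite exchange_big natr_sum mulr_sumr.
apply: eq_bigr => z _; rewrite sum_teich_exp.
by case: eqP => _; rewrite ?mulr1 ?mulr0.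
Qed.

Lemma teich_exp_last (x : 'F_p) : tau x ^+ p.-1 = (x != 0)%:R.
Proof.
have [->|x0] := eqVneq x 0; first by rewrite teich0 expr0n eqn0Ngt p1_gt0.
by have [h _] := teichP p_pr x0.
Qed.

Lemma sum_neq2 (a b : 'F_p) : a != b ->
  \sum_(x : 'F_p) ((x != a) && (x != b))%:R = (p - 2)%:R :> Zp.
Proof.
move=> ab; rewrite -natr_sum; congr _%:R.
rewrite (eq_bigr (fun x : 'F_p => nat_of_bool (x \notin [:: a; b]))); last first.
  by move=> x _; rewrite !inE negb_or.
rewrite -big_mkcond /= sum1_card; have := cardC (mem [:: a; b]).
have -> : #|[:: a; b]| = 2%N by apply/card_uniqP; rewrite /= inE ab.
rewrite card_Fp // => h.
rewrite -[X in _ = (X - 2)%N]h addKn; apply: eq_card => x.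
by rewrite !inE.
Qed.

Lemma J2_last : J2 p.-1 = (p - 2)%:R.
Proof.
rewrite conv2E -(@sum_neq2 0 1) ?(eq_sym _ 1) ?oner_neq0 //.
by apply: eq_bigr => x _; rewrite teich_exp_last mulf_eq0 negb_or subr_eq0 (eq_sym 1).
Qed.

Lemma J3_last : J3 p.-1 = (p ^ 2 + 3)%:R - (3 * p)%:R.
Proof.
rewrite conv3E.
transitivity (\sum_(y : 'F_p) (y != 0)%:R * ((p - 2)%:R + (y == 1)%:R) : Zp).
  apply: eq_bigr => y _; have [->|y0] := eqVneq y 0.
    by rewrite mul0r big1 // => z _; rewrite mul0r teich0 expr0n eqn0Ngt p1_gt0.
  rewrite mul1r (eq_bigr (fun z : 'F_p => ((z != 0) && (z != 1 - y))%:R)); last first.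
    move=> z _; rewrite teich_exp_last !mulf_eq0 !negb_or y0 /=.
    by rewrite [1 - y - z == 0]subr_eq0 (eq_sym (1 - y)).
  have [->|y1] := eqVneq y 1.
    rewrite subrr (eq_bigr (fun z : 'F_p => (z != 0)%:R)) => [|z _]; last by rewrite andbb.
    rewrite (bigD1 0) //= ?eqxx add0r (eq_bigr (fun=> 1)) => [|z -> //].
    by rewrite sumr_const cardC1 card_Fp // -natrD; congr _%:R; lia.
  by rewrite sum_neq2 ?addr0 // eq_sym subr_eq0 eq_sym.
rewrite (bigD1 0) //= ?eqxx mul0r add0r.
rewrite (eq_bigr (fun y : 'F_p => (p - 2)%:R + (y == 1)%:R)) => [|y ->]; last by rewrite mul1r.
rewrite big_split /= sumr_const cardC1 card_Fp // (bigD1 1) ?oner_neq0 //= ?eqxx.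
rewrite big1 ?addr0; last by move=> y /andP[_ /negbTE ->].
rewrite -[_ *+ _]mulr_natr -natrM -{2}[1]/(1%:R) -natrD.
apply/eqP; rewrite eq_sym subr_eq -natrD; apply/eqP; congr _%:R.
have [u uE] : exists u, p = u.+2 by exists (p - 2)%N; lia.
by rewrite uE /= !subSS subn0; ring.
Qed.

Local Notation a3 := [tuple 1 / 2; 1 / 3; 2 / 3 : rat].
Local Notation b3 := [tuple 0; 0; 0 : rat].

(** The factor of McCarthy's summand for one pair of parameters *)
Definition hyp_inner_term j (ak bk : rat) : Qp :=
  let r : rat := j%:R / (p%:R - 1) in
  (- p%:R) ^ (- Num.floor (fracpart ak - r) - Num.floor (fracpart (- bk) + r)) *
  (F (Gam (ratr (fracpart (ak - r)))) / F (Gam (ratr (fracpart ak)))) *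
  (F (Gam (ratr (fracpart (- bk + r)))) / F (Gam (ratr (fracpart (- bk))))).

Lemma prod_tuple3 (f : rat -> rat -> Qp) :
  \prod_(k < 3) f (tnth a3 k) (tnth b3 k) = f (1 / 2) 0 * (f (1 / 3) 0 * f (2 / 3) 0).
Proof. by rewrite !big_ord_recl big_ord0 mulr1. Qed.

Lemma hyp_sum : \sum_(0 <= j < p.-1)
   (-1) ^+ (j * 3) * F (teichmuller_exp p_pr (- j%:Z) 1) *
    \prod_(k < 3) hyp_inner_term j (tnth a3 k) (tnth b3 k)
  = - ((p.-1)%:R * (point_count%:R - ((p ^ 2 + 5)%:R - (4 * p)%:R))) :> Qp.
Proof.
have inner j : (0 <= j < p.-1)%N -> (-1) ^+ (j * 3) * F (teichmuller_exp p_pr (- j%:Z) 1) *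
    \prod_(k < 3) hyp_inner_term j (tnth a3 k) (tnth b3 k)
  = (-1) ^+ (j * 3) * (hyp_factor (1 / 2) j * hyp_factor (1 / 3) j * hyp_factor (2 / 3) j
    * F (Gam (tick j)) ^+ 3) :> Qp.
  move=> /andP[_ jp]; have -> : F (teichmuller_exp p_pr (- j%:Z) 1) = 1.
    by rewrite /teichmuller_exp oner_eq0 teich1 exp1rz rmorph1.
  rewrite mulr1; congr (_ * _).
  rewrite (prod_tuple3 (hyp_inner_term j)).
  rewrite (hyp_inner (1 / 2) jp : hyp_inner_term j (1 / 2) 0 = _).
  rewrite (hyp_inner (1 / 3) jp : hyp_inner_term j (1 / 3) 0 = _).
  rewrite (hyp_inner (2 / 3) jp : hyp_inner_term j (2 / 3) 0 = _).
  by move: (hyp_factor _ _) (hyp_factor _ _) (hyp_factor _ _) => x y z; ring.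
rewrite (eq_big_nat _ _ inner).
rewrite big_ltn // mul0n expr0 mul1r.
have z0 : hyp_factor (1 / 2) 0 * hyp_factor (1 / 3) 0 * hyp_factor (2 / 3) 0 * F (Gam (tick 0)) ^+ 3 = 1.
  have h0 (s m : nat) : (m <= 3)%N -> (0 < m)%N -> (s < m)%N -> hyp_factor (s%:R / m%:R) 0 = 1.
    move=> m3 m0 sm; have := @hyp_factor_eq s m 0 0 m3 m0 sm p1_gt0.
    rewrite muln0 /= => /(_ isT); rewrite expr0 mul1r tick0 subr0 mul0n addn0.
    by rewrite -[RHS]mul1r => /(mulIf (FGam _)).
  rewrite (h0 1 2) // (h0 1 3) // (h0 2 3) // tick0 Gammap0 // rmorph1 expr1n.
  by rewrite !mulr1.
rewrite [X in X + _ = _]z0.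
rewrite (eq_big_nat _ _ (F2 := fun j => - F (tau 108%:R ^+ (p.-1 - j)%N * J2 (p.-1 - j)%N * J3 (p.-1 - j)%N))); last first.
  by move=> j h; exact: hyp_term.
rewrite sumrN -rmorph_sum.
have -> : \sum_(1 <= j < p.-1) tau 108%:R ^+ (p.-1 - j)%N * J2 (p.-1 - j)%N * J3 (p.-1 - j)%N
  = \sum_(1 <= e < p.-1) tau 108%:R ^+ e * J2 e * J3 e.
  rewrite big_nat_rev /=; apply: eq_big_nat => e /andP[e1 e2].
  by have -> : (p.-1 - (1 + p.-1 - e.+1) = e)%N by lia.
have := sum_jacobi; rewrite -[X in index_iota 1 X]pp big_nat_recr //.
rewrite J2_last J3_last teich_exp_last.
have -> : (108%:R : 'F_p) != 0.
  have -> : 108%:R = 2%:R ^+ 2 * 3%:R ^+ 3 :> 'F_p by rewrite -!natrX -natrM.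
  by rewrite mulf_neq0 // expf_neq0 // (Fp_nat_eq0 p_pr).
rewrite mul1r => H.
rewrite (_ : \sum_(1 <= e < p.-1) _ = (p.-1 * point_count)%:R -
  (p - 2)%:R * ((p ^ 2 + 3)%:R - (3 * p)%:R)); last by rewrite -H addrK.
rewrite !(rmorphB, rmorphM, rmorph_nat) /=.
have [u uE] : exists u, p = u.+2 by exists (p - 2)%N; lia.
move: point_count => C; have -> : p.-1 = u.+1 by rewrite uE.
have -> : (p - 2 = u)%N by rewrite uE subSS subSS subn0.
rewrite uE !(natrD, natrM, natrX) -addn2 -[u.+1]addn1 !natrD; ring.
Qed.

End Hypergeometric.

(** The sum over the characters in [hyp_sum] lacks the trivial one, which
    accounts for p^2 - 4 p + 5 together with the term j = 0. *)
Lemma mcCarthyG_point_count (p : nat) (p_pr : prime p) : (3 < p)%N ->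
  mcCarthyG p_pr [tuple 1 / 2; 1 / 3; 2 / 3] [tuple 0; 0; 0] 1
  = (point_count p)%:R - ((p ^ 2 + 5)%:R - (4 * p)%:R).
Proof.
move=> p_gt3.
have p1 : (p%:R - 1 : padic p_pr) = (p.-1)%:R.
  by rewrite -[X in X%:R - 1](prednK (prime_gt0 p_pr)) -addn1 natrD addrK.
have p0 : ((p.-1)%:R : padic p_pr) != 0.
  by have := padic_char0 (@tofrac_inj p p_pr) (p.-1).-1; rewrite prednK // predp_gt0.
have := hyp_sum p_gt3 (@tofrac_inj p p_pr).
rewrite /mcCarthyG p1 => h.
transitivity (-1 / (p.-1)%:R * (- ((p.-1)%:R * ((point_count p)%:R - ((p ^ 2 + 5)%:R - (4 * p)%:R))) : padic p_pr)).
  by rewrite -h.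
by rewrite mulN1r mulrNN mulKf.
Qed.

(** * Counting the points over a finite field *)
Section FiniteField.
Variable K : finFieldType.
Implicit Types (a b c x y z : K).
Local Notation q := #|K|.


Hypothesis two0 : (2%:R : K) != 0.
Hypothesis three0 : (3%:R : K) != 0.
Hypothesis q_odd : odd q.

(** The quadratic character *)
Fact phi_key : unit. Proof. by []. Qed.
Definition phi : K -> int := locked_with phi_key (fun a => \sum_(y : K) (y ^+ 2 == a)%:R - 1).

Lemma phiE a : phi a = \sum_(y : K) (y ^+ 2 == a)%:R - 1.
Proof. by rewrite [phi]unlock. Qed.

Lemma count_sqr a : \sum_(y : K) (y ^+ 2 == a)%:R = 1 + phi a.
Proof. by rewrite phiE addrCA subrr addr0. Qed.

Lemma phi0 : phi 0 = 0.
Proof.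
rewrite phiE (bigD1 0) //= expr0n eqxx big1 ?addr0 ?subrr // => y y0.
by rewrite sqrf_eq0 (negbTE y0).
Qed.

Lemma opp_neq x : x != 0 -> - x != x.
Proof.
move=> x0; rewrite -subr_eq0 -opprD oppr_eq0 -mulr2n -mulr_natl.
by rewrite mulf_neq0.
Qed.

Lemma phi_sqr x : x != 0 -> phi (x ^+ 2) = 1.
Proof.
move=> x0; rewrite phiE (bigD1 x) //= eqxx (bigD1 (- x)) ?opp_neq //= sqrrN eqxx.
rewrite big1 => [|y /andP[yx yNx]]; first by [].
by rewrite eqf_sqr (negbTE yx) (negbTE yNx).
Qed.

Lemma phi_nonsqr a : (forall y, y ^+ 2 != a) -> phi a = -1.
Proof.
by move=> h; rewrite phiE big1 ?sub0r // => y _; rewrite (negbTE (h y)).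
Qed.

Lemma phi_gen (g : K) i : (forall n, (g ^+ n == 1) = (q.-1 %| n)%N) ->
  (forall a, a != 0 -> exists i : nat, a = g ^+ i) -> phi (g ^+ i) = (-1) ^+ i.
Proof.
move=> g1 gen; have q1 : (1 < q)%N.
  by rewrite (cardD1 0) (cardD1 1) !inE oner_eq0.
have g0 : g != 0.
  apply/eqP => g0; have := g1 q.-1; rewrite g0 expr0n dvdnn.
  by case: (q) q1 => [|[|m]] //= _; rewrite eq_sym oner_eq0.
rewrite -[RHS]signr_odd; case: (boolP (odd i)) => oi; last first.
  rewrite -(odd_double_half i) (negbTE oi) add0n -mul2n mulnC exprM phi_sqr //.
  by rewrite expf_neq0.
rewrite expr1; apply: phi_nonsqr => y; apply/eqP => yi.
have y0 : y != 0 by apply: contraTneq (expf_neq0 i g0) => y0; rewrite -yi y0 expr0n /= eqxx.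
have [j yj] := gen y y0; move: yi; rewrite yj -exprM => e.
have e2 : odd q.-1 = false by case: (q) q1 q_odd => //= m _ /negbTE.
have key m n : g ^+ m = g ^+ n -> (m <= n)%N -> odd (n - m) = false.
  move=> emn mn; have : (q.-1 %| n - m)%N.
    rewrite -g1 -(inj_eq (mulfI (expf_neq0 m g0))) mulr1 -exprD subnKC //.
    by rewrite emn.
  by move=> /dvdnP[k ->]; rewrite oddM e2 andbF.
have [le|/ltnW le] := leqP (j * 2) i.
  by have := key _ _ e le; rewrite oddB // oi oddM andbF.
by have := key _ _ (esym e) le; rewrite oddB // oi oddM andbF.
Qed.

Lemma phiM a b : phi (a * b) = phi a * phi b.
Proof.
have [g g1 gen] := finField_generator K.
have [->|a0] := eqVneq a 0; first by rewrite mul0r phi0 mul0r.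
have [->|b0] := eqVneq b 0; first by rewrite mulr0 phi0 mulr0.
have [i ->] := gen a a0; have [j ->] := gen b b0.
by rewrite -exprD !(phi_gen _ g1 gen) exprD.
Qed.

Lemma phi1 : phi 1 = 1.
Proof. by rewrite -(expr1n _ 2) phi_sqr ?oner_neq0. Qed.

Lemma phi_sqrM a x : x != 0 -> phi (x ^+ 2 * a) = phi a.
Proof. by move=> x0; rewrite phiM phi_sqr // mul1r. Qed.

Lemma phi_sq a : a != 0 -> phi a * phi a = 1.
Proof. by move=> a0; rewrite -phiM -expr2 phi_sqr. Qed.

Lemma phiV a : phi a^-1 = phi a.
Proof.
have [->|a0] := eqVneq a 0; first by rewrite invr0.
by rewrite -[RHS](@phi_sqrM _ a^-1) ?invr_eq0 //; congr phi; field; rewrite a0.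
Qed.

Lemma phi_pm1 a : a != 0 -> phi a = 1 \/ phi a = -1.
Proof.
move=> a0; have := phi_sq a0; move=> /eqP; rewrite -expr2 sqrf_eq1.
by case/orP => /eqP; [left | right].
Qed.

Lemma sum_delta (I : finType) (i : I) (f : I -> int) : \sum_j (i == j)%:R * f j = f i.
Proof.
rewrite (bigD1 i) //= eqxx mul1r big1 ?addr0 // => j ji.
by rewrite eq_sym (negbTE ji) mul0r.
Qed.

Lemma sum_fiber (P : pred K) (w : K -> int) (f : K -> K) (G : K -> int) :
  \sum_(x | P x) w x * G (f x) = \sum_n (\sum_(x | P x) w x * (f x == n)%:R) * G n.
Proof.
under [RHS]eq_bigr do rewrite mulr_suml.
rewrite exchange_big /=; apply: eq_bigr => x _.
by under [RHS]eq_bigr do rewrite -mulrA; rewrite -mulr_sumr sum_delta.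
Qed.

Lemma sum_phi : \sum_x phi x = 0.
Proof.
have : \sum_(a : K) (1 + phi a) = \sum_(y : K) (1 : int).
  under eq_bigr do rewrite -count_sqr.
  rewrite exchange_big /=; apply: eq_bigr => y _.
  by rewrite -[RHS](sum_delta (y ^+ 2) (fun=> 1)); apply: eq_bigr => a _; rewrite mulr1.
by rewrite big_split /= => /eqP; rewrite -subr_eq0 addrAC subrr add0r => /eqP.
Qed.

Lemma sum_phi_affine a b : a != 0 -> \sum_x phi (a * x + b) = 0.
Proof.
move=> a0; transitivity (\sum_x phi x); last exact: sum_phi.
by rewrite [RHS](reindex_inj (addIr b)) [RHS](reindex_inj (mulfI a0)).
Qed.

Lemma sum_phi_shift a : \sum_x phi (a + x) = 0.
Proof. by rewrite -[RHS](@sum_phi_affine 1 a) ?oner_neq0 //; apply: eq_bigr => x _; rewrite mul1r addrC. Qed.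

Lemma sum_nz (f : K -> int) : \sum_(x | x != 0) f x = \sum_x f x - f 0.
Proof. by rewrite [in RHS](bigD1 0) //= [in RHS]addrAC subrr add0r. Qed.

Lemma sum_inv (f : K -> int) : \sum_(x | x != 0) f x^-1 = \sum_(x | x != 0) f x.
Proof. by rewrite [RHS](reindex_inj invr_inj); apply: eq_bigl => x; rewrite invr_eq0. Qed.

Lemma sum_scale c (f : K -> int) : c != 0 ->
  \sum_(x | x != 0) f (c * x) = \sum_(x | x != 0) f x.
Proof.
move=> c0; rewrite [RHS](reindex_inj (mulfI c0)); apply: eq_bigl => x.
by rewrite mulf_eq0 (negbTE c0).
Qed.

Lemma sum_opp (f : K -> int) : \sum_x f (- x) = \sum_x f x.
Proof. by rewrite [RHS](reindex_inj oppr_inj). Qed.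

Lemma four0 : (4%:R : K) != 0.
Proof. by rewrite (_ : 4%:R = 2%:R * 2%:R) ?mulf_neq0 // -natrM. Qed.

Lemma count_quad b c : \sum_x (x ^+ 2 - b * x + c == 0)%:R = 1 + phi (b ^+ 2 - 4%:R * c).
Proof.
rewrite -count_sqr [RHS](reindex_inj (addIr (- b))) [RHS](reindex_inj (mulfI two0)).
apply: eq_bigr => x _; congr (nat_of_bool _)%:R.
rewrite -[LHS](inj_eq (mulfI four0)) mulr0 -[RHS]subr_eq0; congr (_ == 0); ring.
Qed.

Lemma sum_phi_n : \sum_n phi (n * (n - 1)) = -1.
Proof.
rewrite (bigD1 0) //= mul0r phi0 add0r.
rewrite (eq_bigr (fun n => phi (1 - n^-1))); last first.
  by move=> n n0; rewrite -(@phi_sqrM (1 - _) n) //; congr phi; field; rewrite n0.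
rewrite (sum_inv (fun m => phi (1 - m))) sum_nz subr0 phi1.
by rewrite (sum_opp (fun m => phi (1 + m))) sum_phi_shift sub0r.
Qed.

(** The number of points to be determined, after the substitution x = u / 2,
    y = y' / 3, z = z' / 3, which absorbs 108 = 2^2 3^3. *)
Definition cubic_count : int := \sum_(u : K) \sum_(y : K) \sum_(z : K)
   (u * (2%:R - u) * (y * (z * (3%:R - y - z))) == 1)%:R.

(** What is left of the count after its main term: solving the two quadratic
    equations for u and y, with n the value of y z (3 - y - z). *)
Definition residual_sum : int := \sum_(z : K) \sum_(n : K)
   phi (n * (n - 1)) * phi (z * (z * (z - 3%:R) ^+ 2 - 4%:R * n)).

Lemma count_u w : \sum_(u : K) (u * (2%:R - u) * w == 1)%:R = (w != 0)%:R + phi (w * (w - 1)).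
Proof.
have [->|w0] := eqVneq w 0.
  rewrite mul0r phi0 addr0 big1 // => u _; by rewrite mulr0 eq_sym oner_eq0.
rewrite -[1%:R + _]/(1 + phi (w * (w - 1))).
have -> : phi (w * (w - 1)) = phi (2%:R ^+ 2 - 4%:R * w^-1).
  rewrite -(@phi_sqrM (w * (w - 1)) (2%:R / w)) ?mulf_neq0 ?invr_eq0 //.
  by congr phi; field; rewrite w0.
rewrite -count_quad; apply: eq_bigr => u _; congr (nat_of_bool _)%:R.
rewrite -[RHS](inj_eq (mulfI w0)) mulr0 -[LHS]subr_eq0 -[RHS]oppr_eq0.
by congr (_ == 0); field; rewrite w0.
Qed.

Lemma sum_const (c : int) : \sum_(x : K) c = q%:R * c.
Proof. by rewrite sumr_const mulr_natl; congr (_ *+ _); apply: eq_card. Qed.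

Lemma sum_neq (a : K) : \sum_x ((x != a)%:R : int) = q%:R - 1.
Proof.
rewrite (eq_bigr (fun x => 1 - (a == x)%:R * 1)); last first.
  by move=> x _; rewrite mulr1 eq_sym; case: eqP.
by rewrite sumrB sum_delta sum_const mulr1.
Qed.

Lemma count_triangle : \sum_(y : K) \sum_(z : K) ((y * (z * (3%:R - y - z)) != 0)%:R : int)
  = q%:R ^+ 2 - 3%:R * q%:R + 3%:R.
Proof.
transitivity (\sum_(y : K) (y != 0)%:R * (q%:R - 2%:R + (3%:R == y)%:R * 1 : int)).
  apply: eq_bigr => y _; have [->|y0] := eqVneq y 0.
    by rewrite mul0r big1 // => z _; rewrite mul0r eqxx.
  rewrite mul1r mulr1; transitivity (\sum_(z : K) (1 - (0 == z)%:R * 1 - (3%:R - y == z)%:R * (0 != z)%:R : int)).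
    apply: eq_bigr => z _; rewrite !mulf_eq0 !negb_or y0 /= subr_eq0 (eq_sym 0) mulr1.
    by case: (z == 0); case: (_ == z).
  rewrite !sumrB !sum_delta sum_const mulr1 eq_sym subr_eq0.
  by case: eqVneq => _ /=; ring.
rewrite (eq_bigr (fun y => (y != 0)%:R * (q%:R - 2%:R) + (3%:R == y)%:R * (y != 0)%:R)); last first.
  by move=> y _; rewrite mulrDr mulr1 [X in _ + X]mulrC.
by rewrite big_split /= -mulr_suml sum_neq sum_delta three0 /=; ring.
Qed.

Lemma cubic_countE : cubic_count = q%:R ^+ 2 - 4%:R * q%:R + 4%:R + residual_sum.
Proof.
rewrite /cubic_count exchange_big /=.
have -> : \sum_(y : K) \sum_(u : K) \sum_(z : K) (u * (2%:R - u) * (y * (z * (3%:R - y - z))) == 1)%:R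
  = \sum_(y : K) \sum_(z : K) ((y * (z * (3%:R - y - z)) != 0)%:R
     + phi (y * (z * (3%:R - y - z)) * (y * (z * (3%:R - y - z)) - 1))) :> int.
  by apply: eq_bigr => y _; rewrite exchange_big; apply: eq_bigr => z _; rewrite count_u.
rewrite (eq_bigr _ (fun y _ => big_split _ _ _ _ _)) big_split /= count_triangle.
rewrite exchange_big /=.
have -> : \sum_z \sum_y phi (y * (z * (3%:R - y - z)) * (y * (z * (3%:R - y - z)) - 1))
   = \sum_z ((0 == z)%:R * 1 - 1 + \sum_n phi (n * (n - 1)) * phi (z * (z * (z - 3%:R) ^+ 2 - 4%:R * n))).
  apply: eq_bigr => z _; have [<-|z0] := eqVneq 0 z.
    rewrite mul1r subrr add0r !big1 // => n _; rewrite ?mul0r ?phi0 ?mulr0 //.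
    by rewrite mul0r phi0.
  rewrite mul0r add0r.
  transitivity (\sum_(y | true) 1 * (fun n => phi (n * (n - 1))) (y * (z * (3%:R - y - z)))).
    by apply: eq_bigr => y _; rewrite mul1r.
  rewrite (sum_fiber xpredT (fun=> 1) (fun y => y * (z * (3%:R - y - z)))
    (fun n => phi (n * (n - 1)))) -sum_phi_n -big_split /=; apply: eq_bigr => n _.
  transitivity (phi (n * (n - 1)) * (1 + phi (z * (z * (z - 3%:R) ^+ 2 - 4%:R * n)))); last by ring.
  rewrite [LHS]mulrC; congr (_ * _).
  have -> : phi (z * (z * (z - 3%:R) ^+ 2 - 4%:R * n)) = phi ((3%:R - z) ^+ 2 - 4%:R * (n / z)).
    rewrite -[RHS](@phi_sqrM _ z) 1?eq_sym //; congr phi; field.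
    by rewrite eq_sym.
  rewrite -count_quad; apply: eq_bigr => y _; rewrite mul1r; congr (nat_of_bool _)%:R.
  have z0' : z != 0 by rewrite eq_sym.
  rewrite -[RHS](inj_eq (mulfI z0')) mulr0 -[LHS]subr_eq0 -[RHS]oppr_eq0.
  by congr (_ == 0); field; rewrite z0'.
rewrite big_split sumrB sum_delta sum_const /= -/residual_sum; ring.
Qed.

Lemma sum_add a (f : K -> int) : \sum_x f (x + a) = \sum_x f x.
Proof. by rewrite [RHS](reindex_inj (addIr a)). Qed.

Lemma sum_mul a (f : K -> int) : a != 0 -> \sum_x f (a * x) = \sum_x f x.
Proof. by move=> a0; rewrite [RHS](reindex_inj (mulfI a0)). Qed.

Lemma sum_nz_opp (f : K -> int) : \sum_(x | x != 0) f (- x) = \sum_(x | x != 0) f x.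
Proof. by rewrite [RHS](reindex_inj oppr_inj); apply: eq_bigl => x; rewrite oppr_eq0. Qed.

(** With z = w + 2 and n = (2 - t) / 4 the discriminants become t^2 - 4 and
    (w + 2) (w^3 - 3 w + t), where w^3 - 3 w is the third Chebyshev polynomial
    of v + 1/v. *)
Lemma residual_sum_shift : residual_sum = \sum_(w : K) \sum_(t : K)
  phi (t ^+ 2 - 4%:R) * phi ((w + 2%:R) * (w ^+ 3 - 3%:R * w + t)).
Proof.
rewrite /residual_sum -(sum_add 2%:R); apply: eq_bigr => w _.
have i4 : - (4%:R : K)^-1 != 0 by rewrite oppr_eq0 invr_eq0 four0.
rewrite -(sum_mul _ i4) -(sum_add (- 2%:R)); apply: eq_bigr => t _; congr (_ * _).
  rewrite -(@phi_sqrM (_ * (_ - 1)) _ four0); congr phi; field; exact: four0.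
congr phi; field; exact: four0.
Qed.

Lemma count_joukowski t : \sum_(r : K | r != 0) (r + r^-1 == t)%:R = 1 + phi (t ^+ 2 - 4%:R).
Proof.
rewrite -[X in _ - X]mulr1 -count_quad [RHS](bigD1 0) //=.
rewrite expr0n mulr0 subrr add0r oner_eq0 add0r; apply: eq_bigr => r r0.
congr (nat_of_bool _)%:R; rewrite -[LHS](inj_eq (mulfI r0)) -[LHS]subr_eq0.
by congr (_ == 0); field; rewrite r0.
Qed.

Lemma sum_phi_joukowski (f : K -> int) : \sum_(t : K) phi (t ^+ 2 - 4%:R) * f t =
  \sum_(r | r != 0) f (r + r^-1) - \sum_t f t.
Proof.
under [X in _ = X - _]eq_bigr => r _ do rewrite -[f _]mul1r.
rewrite (sum_fiber _ (fun=> 1) (fun r => r + r^-1)) -sumrB; apply: eq_bigr => t _.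
under eq_bigr => r _ do rewrite mul1r.
by rewrite count_joukowski; ring.
Qed.

Lemma residual_sum_joukowski : residual_sum = \sum_(w : K) \sum_(r : K | r != 0)
  phi ((w + 2%:R) * (w ^+ 3 - 3%:R * w + (r + r^-1))).
Proof.
rewrite residual_sum_shift; apply: eq_bigr => w _.
rewrite sum_phi_joukowski [X in _ - X](_ : _ = 0) ?subr0 //.
under eq_bigr => t _ do rewrite phiM.
by rewrite -mulr_sumr sum_phi_shift mulr0.
Qed.

(** If v + 1/v = w then v (w + 2) = (v + 1)^2 and v (w - 2) = (v - 1)^2, so that
    phi v is phi (w + 2) or phi (w - 2), whichever is not 0. *)
Lemma count_joukowski_phi w : \sum_(v : K | v != 0) phi v * (v + v^-1 == w)%:R =
  phi (w + 2%:R) + phi (w - 2%:R).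
Proof.
have main c : c ^+ 2 = 1 -> w + c * 2%:R != 0 ->
  \sum_(v : K | v != 0) phi v * (v + v^-1 == w)%:R = phi (w + c * 2%:R) + phi (w - c * 2%:R).
  move=> c1 wc; transitivity (\sum_(v : K | v != 0) phi (w + c * 2%:R) * (v + v^-1 == w)%:R).
    apply: eq_bigr => v v0; have [vw|_] := eqVneq; last by rewrite !mulr0.
    congr (_ * _); have e : w + c * 2%:R = (v + c) ^+ 2 / v.
      rewrite -vw; apply: (mulfI v0); rewrite mulrCA divff // mulr1 sqrrD c1.
      by field; rewrite v0.
    have vc : v + c != 0 by apply: contraNneq wc => vc; rewrite e vc expr0n mul0r.
    by rewrite e phi_sqrM // phiV.
  rewrite -mulr_sumr count_joukowski mulrDr mulr1; congr (_ + _).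
  have -> : w ^+ 2 - 4%:R = (w + c * 2%:R) * (w - c * 2%:R).
    have -> : (w + c * 2%:R) * (w - c * 2%:R) = w ^+ 2 - c ^+ 2 * 4%:R by ring.
    by rewrite c1 mul1r.
  by rewrite phiM mulrA phi_sq // mul1r.
have [w2|w2] := eqVneq (w + 2%:R) 0; last by have := main 1; rewrite !mul1r expr1n => ->.
have := main (-1); rewrite sqrrN expr1n !mulN1r opprK => ->//; first exact: addrC.
have -> : w = - 2%:R by apply/eqP; rewrite -addr_eq0 w2.
by rewrite -opprD oppr_eq0 -natrD four0.
Qed.

Lemma sum_phi_joukowski2 (G : K -> int) :
  \sum_w (phi (w + 2%:R) + phi (w - 2%:R)) * G w = \sum_(v | v != 0) phi v * G (v + v^-1).
Proof.
rewrite (sum_fiber _ phi (fun v => v + v^-1)); apply: eq_bigr => w _.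
by rewrite count_joukowski_phi.
Qed.

Definition cubic_phi_sum a : int := \sum_(s : K | s != 0) phi (a * s ^+ 3 + 1).

Lemma sum_sqr_nz (h : K -> int) :
  \sum_(v : K | v != 0) h (v ^+ 2) = \sum_(s | s != 0) (1 + phi s) * h s.
Proof.
transitivity (\sum_(v | v != 0) 1 * h (v ^+ 2)); first by under [RHS]eq_bigr do rewrite mul1r.
rewrite (sum_fiber _ (fun=> 1) (fun v => v ^+ 2)) [LHS](bigD1 0) //= big1 ?mul0r ?add0r; last first.
  by move=> v v0; rewrite sqrf_eq0 (negbTE v0) mulr0.
apply: eq_bigr => s s0; congr (_ * _); under eq_bigr do rewrite mul1r.
by rewrite sum_nz count_sqr expr0n eq_sym (negbTE s0) subr0.
Qed.

Lemma phi3 s : phi (s ^+ 3) = phi s.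
Proof.
have [->|s0] := eqVneq s 0; first by rewrite expr0n.
by rewrite -[RHS](@phi_sqrM s s) // -exprSr.
Qed.

(** Averaging over the symmetry (w, r) -> (- w, - r) brings in the weight
    phi (w + 2) + phi (w - 2), so that w = v + 1/v can be substituted, and
    w^3 - 3 w becomes v^3 + 1/v^3. With r = a v^3 the sum factors. *)
Lemma residual_sum_double : residual_sum *+ 2 = \sum_(v : K | v != 0) \sum_(a : K | a != 0)
  phi (a * (1 + a)) * phi (a * v ^+ 6 + 1).
Proof.
have eN : residual_sum = \sum_(w : K) \sum_(r : K | r != 0)
    phi ((w - 2%:R) * (w ^+ 3 - 3%:R * w + (r + r^-1))).
  rewrite residual_sum_joukowski -sum_opp; apply: eq_bigr => w _.
  rewrite -sum_nz_opp; apply: eq_bigr => r _; congr phi; rewrite invrN; ring.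
rewrite mulr2n {1}residual_sum_joukowski eN -big_split /=.
under eq_bigr => w _ do rewrite -big_split /=.
rewrite exchange_big /=.
transitivity (\sum_(r : K | r != 0) \sum_(v : K | v != 0)
    phi v * phi (v ^+ 3 + v ^- 3 + (r + r^-1))).
  apply: eq_bigr => r r0; rewrite -[LHS]/(\sum_(w : K) _).
  under eq_bigr => w _ do rewrite !phiM -mulrDl.
  rewrite (sum_phi_joukowski2 (fun w => phi (w ^+ 3 - 3%:R * w + (r + r^-1)))).
  by apply: eq_bigr => v v0; congr (_ * phi _); field; rewrite v0 r0.
rewrite exchange_big /=; apply: eq_bigr => v v0.
have v30 : v ^+ 3 != 0 by rewrite expf_neq0.
rewrite -(sum_scale _ v30); apply: eq_bigr => a a0; rewrite -!phiM.
rewrite -[RHS](@phi_sqrM _ (a * v)^-1) ?invr_eq0 ?mulf_neq0 //; congr phi; field.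
by rewrite a0 v0.
Qed.

(** Of the two terms 1 and phi s of the number of square roots of s, the second
    contributes as much as the first, by s -> 1/s and a -> a s^3. *)
Lemma residual_sum_cubic : residual_sum = \sum_(a : K | a != 0) phi (1 + a) * cubic_phi_sum a^-1.
Proof.
have dbl (m n : int) : m *+ 2 = n *+ 2 -> m = n by lia.
transitivity (\sum_(a : K | a != 0) phi (a * (1 + a)) * cubic_phi_sum a); last first.
  rewrite -sum_inv; apply: eq_bigr => a a0; congr (_ * _).
  by rewrite -(@phi_sqrM _ a) //; congr phi; field; rewrite a0.
apply: dbl; rewrite residual_sum_double exchange_big /=.
transitivity (\sum_(a : K | a != 0) \sum_(s : K | s != 0)
   (phi (a * (1 + a)) * phi (a * s ^+ 3 + 1) + phi (a * (1 + a)) * (phi s * phi (a * s ^+ 3 + 1)))).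
  apply: eq_bigr => a a0.
  rewrite -mulr_sumr.
  transitivity (phi (a * (1 + a)) * \sum_(v | v != 0) (fun s => phi (a * s ^+ 3 + 1)) (v ^+ 2)).
    by congr (_ * _); apply: eq_bigr => v _; rewrite -exprM.
  rewrite (sum_sqr_nz (fun s => phi (a * s ^+ 3 + 1))) mulr_sumr.
  by apply: eq_bigr => s _; ring.
rewrite (eq_bigr _ (fun a _ => big_split _ _ _ _ _)) big_split /= mulr2n; congr (_ + _).
  by apply: eq_bigr => a _; rewrite /cubic_phi_sum mulr_sumr.
under [RHS]eq_bigr => a _ do rewrite /cubic_phi_sum mulr_sumr.
rewrite exchange_big [RHS]exchange_big /= -sum_inv; apply: eq_bigr => s s0.
have s30 : s ^+ 3 != 0 by rewrite expf_neq0.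
rewrite -(sum_scale _ s30); apply: eq_bigr => a a0.
rewrite phiV -(phi3 s) -!phiM -[RHS](@phi_sqrM _ (s ^+ 3)) //.
by congr phi; field; rewrite s0.
Qed.

Lemma cubic_count_rescale : \sum_(x : K) \sum_(y : K) \sum_(z : K)
   (108%:R * (x * (1 - x)) * (y * (z * (1 - y - z))) == 1)%:R = cubic_count.
Proof.
have i2 : (2%:R : K)^-1 != 0 by rewrite invr_eq0.
have i3 : (3%:R : K)^-1 != 0 by rewrite invr_eq0.
rewrite /cubic_count -(sum_mul _ i2); apply: eq_bigr => x _.
rewrite -(sum_mul _ i3); apply: eq_bigr => y _.
rewrite -(sum_mul _ i3); apply: eq_bigr => z _.
by congr (nat_of_bool (_ == _))%:R; field; rewrite two0 three0.
Qed.

Lemma residual_sum_cube_inj : injective (fun x : K => x ^+ 3) -> residual_sum = 1.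
Proof.
move=> cinj; have B1 a : a != 0 -> cubic_phi_sum a = -1.
  move=> a0; rewrite /cubic_phi_sum sum_nz expr0n mulr0 add0r phi1.
  transitivity (\sum_s phi (a * s + 1) - 1); last by rewrite sum_phi_affine.
  by rewrite [X in _ = X - _](reindex_inj cinj).
rewrite residual_sum_cubic (eq_bigr (fun a => - phi (1 + a))); last first.
  by move=> a a0; rewrite B1 ?invr_eq0 // mulrN1.
by rewrite sumrN sum_nz sum_phi_shift addr0 phi1 sub0r opprK.
Qed.

Lemma q_gt1 : (1 < q)%N.
Proof. by rewrite (cardD1 0) (cardD1 1) !inE oner_eq0. Qed.

Lemma cube_inj : (q %% 3 = 2)%N -> injective (fun x : K => x ^+ 3).
Proof.
move=> q3 x y /= xy; have [y0|y0] := eqVneq y 0.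
  by move: xy => /eqP; rewrite y0 expr0n expf_eq0 => /eqP.
have x0 : x != 0 by apply: contraNneq y0 => x0; move: xy => /esym/eqP; rewrite x0 expr0n expf_eq0.
have [g g1 gen] := finField_generator K.
have xy0 : x / y != 0 by rewrite mulf_neq0 ?invr_eq0.
have [i xyi] := gen _ xy0.
have : (x / y) ^+ 3 == 1 by rewrite expr_div_n xy divff ?expf_neq0.
rewrite xyi -exprM g1 Gauss_dvdl; last first.
  have q1 := q_gt1; rewrite coprime_sym prime_coprime //; apply/negP => /dvdnP[m e]; lia.
by rewrite -g1 -xyi => /eqP/divr1_eq.
Qed.

Section CubicClasses.
Hypothesis q1mod3 : (q %% 3 = 1)%N.
Variable g : K.
Hypothesis g1 : forall n, (g ^+ n == 1) = (q.-1 %| n)%N.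
Hypothesis gen : forall a, a != 0 -> exists i : nat, a = g ^+ i.
Let k := (q.-1 %/ 3)%N.

Lemma q_k : q.-1 = (3 * k)%N.
Proof. by rewrite /k; have := q_gt1; lia. Qed.

Lemma k_gt0 : (0 < k)%N.
Proof. by have := q_gt1; rewrite /k; lia. Qed.

Lemma g_neq0 : g != 0.
Proof.
apply/eqP => g0; have := g1 q.-1; rewrite g0 expr0n dvdnn.
by have := q_gt1; case: (q) => [|[|m]] //= _; rewrite eq_sym oner_eq0.
Qed.

Lemma sum_gen (f : K -> int) : \sum_(a | a != 0) f a = \sum_(0 <= i < 3 * k) f (g ^+ i).
Proof.
rewrite -q_k big_mkord.
have inj : injective (fun i : 'I_q.-1 => g ^+ i).
  have key (i j : nat) : (j < q.-1)%N -> (i <= j)%N -> g ^+ i = g ^+ j -> i = j.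
    move=> jq ij e; have : (q.-1 %| j - i)%N.
      by rewrite -g1 -(inj_eq (mulfI (expf_neq0 i g_neq0))) mulr1 -exprD subnKC // e.
    rewrite /dvdn modn_small; last by lia.
    by lia.
  move=> i j e; apply: val_inj => /=; have [ij|/ltnW ji] := leqP i j.
    exact: key e.
  by apply/esym; apply: key (esym e).
rewrite (eq_bigl (mem [set g ^+ (i : 'I_q.-1) | i in 'I_q.-1]%SET)).
  by rewrite big_imset /= => [|i j _ _ /inj //]; apply: eq_bigl => i; rewrite inE.
move=> a /=; apply/idP/idP => [a0|/imsetP[i _ ->]]; last by rewrite expf_neq0 ?g_neq0.
have [i ->] := gen a0.
have lt : (i %% q.-1 < q.-1)%N by rewrite ltn_mod; have := q_gt1; lia.
apply/imsetP; exists (Ordinal lt) => //=; rewrite {1}(divn_eq i q.-1) exprD mulnC exprM.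
have /eqP -> : g ^+ q.-1 == 1 by rewrite g1.
by rewrite expr1n mul1r.
Qed.

Lemma sum_cube_one : \sum_(s : K | s != 0) ((s ^+ 3 == 1)%:R : int) = 3%:R.
Proof.
rewrite -(sum_scale _ g_neq0) sum_gen.
transitivity ((\sum_(1 <= i < (3 * k).+1) (k %| i))%N%:R : int); last first.
  by rewrite -divn_count_dvd mulnK ?k_gt0.
rewrite big_add1 /= natr_sum; apply: eq_bigr => i _; congr (nat_of_bool _)%:R.
by rewrite -exprS -exprM g1 q_k (mulnC i.+1) dvdn_pmul2l.
Qed.

(** The sum of phi (1 + a) over the class of g^i modulo cubes. The sums over the
    three classes are the cubic analogues of Jacobsthal sums. *)
Let class_sum i : int := \sum_(0 <= j < k) phi (1 + g ^+ (3 * j + i)).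

Lemma big_mod3 n (f : nat -> int) : \sum_(0 <= i < 3 * n) f i =
  \sum_(0 <= j < n) (f (3 * j)%N + f (3 * j + 1)%N + f (3 * j + 2)%N).
Proof.
elim: n => [|n IH]; first by rewrite muln0 !big_geq.
rewrite [RHS]big_nat_recr //= -IH (_ : 3 * n.+1 = (3 * n).+3)%N; last by rewrite mulnS addnC addn3.
by rewrite !big_nat_recr //= addn1 addn2 -!addrA.
Qed.

Lemma g_q : g ^+ (3 * k) = 1.
Proof. by apply/eqP; rewrite g1 q_k. Qed.

Lemma cubic_phi_sum_class i : cubic_phi_sum (g ^+ i) = 3%:R * class_sum i.
Proof.
rewrite /cubic_phi_sum sum_gen (_ : 3 * k = k + (k + k))%N; last by lia.
have per m : \sum_(m * k <= j < m * k + k) phi (g ^+ i * g ^+ j ^+ 3 + 1) = class_sum i.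
  rewrite addnC -{1}[(m * k)%N]add0n big_addn addnK /class_sum; apply: eq_bigr => j _.
  rewrite -!exprM -exprD (_ : i + (j + m * k) * 3 = 3 * j + i + 3 * k * m)%N; last by lia.
  by rewrite exprD (exprM g (3 * k)) g_q expr1n mulr1 addrC.
rewrite (big_cat_nat (leq0n k) (leq_addr (k + k) k)) /= (big_cat_nat (leq_addr k k)) ?leq_add2l ?leq_addr //=.
have := per 0%N; rewrite mul0n add0n => ->.
have := per 1%N; rewrite mul1n => ->.
have := per 2; rewrite (_ : 2 * k = k + k)%N; last by lia.
rewrite -addnA => ->.
ring.
Qed.

Lemma cubic_phi_sum_cube a c : c != 0 -> cubic_phi_sum (a * c ^+ 3) = cubic_phi_sum a.
Proof.
move=> c0; rewrite /cubic_phi_sum -(sum_scale (fun s => phi (a * s ^+ 3 + 1)) c0).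
by apply: eq_bigr => s _; congr phi; ring.
Qed.

Lemma class_sum_total : class_sum 0 + class_sum 1 + class_sum 2 = -1.
Proof.
have : \sum_(a | a != 0) phi (1 + a) = -1.
  by rewrite sum_nz sum_phi_shift addr0 phi1.
rewrite sum_gen big_mod3 !big_split /= => <-.
by congr (_ + _ + _); apply: eq_bigr => j _; rewrite ?addn0.
Qed.

Lemma cubic_phi_sum_mod j i : cubic_phi_sum (g ^+ (3 * j + i)) = 3%:R * class_sum i.
Proof. by rewrite -cubic_phi_sum_class exprD mulrC mulnC exprM cubic_phi_sum_cube ?expf_neq0 ?g_neq0. Qed.

Lemma cubic_phi_sum_modV j i l : (i + l = 3)%N -> cubic_phi_sum (g ^+ (3 * j + i))^-1 = 3%:R * class_sum l.
Proof.
move=> il; rewrite -cubic_phi_sum_class -(@cubic_phi_sum_cube _ (g ^+ j.+1)) ?expf_neq0 ?g_neq0 //.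
congr cubic_phi_sum; have g0 : g ^+ (3 * j + i) != 0 by rewrite expf_neq0 ?g_neq0.
apply: (mulfI g0); rewrite mulrA divff // mul1r -exprM -exprD; congr (_ ^+ _); lia.
Qed.

Lemma residual_sum_classes : residual_sum = 3%:R * (class_sum 0 ^+ 2 + 2%:R * (class_sum 1 * class_sum 2)).
Proof.
rewrite residual_sum_cubic sum_gen big_mod3.
have -> : 3%:R * (class_sum 0 ^+ 2 + 2%:R * (class_sum 1 * class_sum 2)) =
  class_sum 0 * (3%:R * class_sum 0) + class_sum 1 * (3%:R * class_sum 2) + class_sum 2 * (3%:R * class_sum 1) by ring.
rewrite /class_sum !mulr_suml -!big_split /=; apply: eq_bigr => j _.
rewrite -!/(class_sum _) addn0 (@cubic_phi_sum_modV j 1 2) // (@cubic_phi_sum_modV j 2 1) //.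
have e : (g ^+ (3 * j))^-1 = 1 * (g ^+ j)^-1 ^+ 3 by rewrite mul1r exprVn -exprM mulnC.
by rewrite e cubic_phi_sum_cube ?invr_eq0 ?expf_neq0 ?g_neq0 // -[1]/(g ^+ 0) cubic_phi_sum_class.
Qed.

Lemma sum_phi_mul2 b : b != 0 ->
  \sum_(a | a != 0) phi ((1 + a) * (a * b + 1)) = (b == 1)%:R * q%:R - phi b - 1.
Proof.
move=> b0; rewrite sum_nz addr0 mul0r add0r mulr1 phi1; congr (_ - 1).
have [->|b1] := eqVneq b 1.
  rewrite mul1r phi1 -(sum_add (-1)) -(sum_neq 0); apply: eq_bigr => x _.
  rewrite mulr1 addrC subrK; have [->|x0] := eqVneq x 0; first by rewrite mul0r phi0.
  by rewrite -expr2 phi_sqr.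
rewrite mul0r sub0r.
pose c := b^-1 - 1; have c0 : c != 0 by rewrite subr_eq0 invr_eq1.
rewrite -(sum_add (- 1)) -(sum_mul _ (_ : - c != 0)) ?oppr_eq0 //.
rewrite (eq_bigr (fun n => phi b * phi (n * (n - 1)))); last first.
  move=> n _; rewrite -phiM -[RHS](@phi_sqrM _ c) //; congr phi.
  by rewrite /c; field; rewrite b0.
by rewrite -mulr_sumr sum_phi_n mulrN1.
Qed.

(** Multiply phi (1 + a) by phi (1 + a s^3) and sum over a first. *)
Lemma class_sum_squares : 3%:R * (class_sum 0 ^+ 2 + class_sum 1 ^+ 2 + class_sum 2 ^+ 2) = 2%:R * q%:R + 1.
Proof.
transitivity (\sum_(a | a != 0) phi (1 + a) * cubic_phi_sum a).
  rewrite sum_gen big_mod3.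
  have -> : 3%:R * (class_sum 0 ^+ 2 + class_sum 1 ^+ 2 + class_sum 2 ^+ 2) =
    class_sum 0 * (3%:R * class_sum 0) + class_sum 1 * (3%:R * class_sum 1) + class_sum 2 * (3%:R * class_sum 2) by ring.
  rewrite /class_sum !mulr_suml -!big_split /=; apply: eq_bigr => j _.
  by rewrite -!/(class_sum _) !cubic_phi_sum_mod -(cubic_phi_sum_mod j 0) addn0.
under eq_bigr => a _ do rewrite /cubic_phi_sum mulr_sumr.
rewrite exchange_big /=.
transitivity (\sum_(s | s != 0) ((s ^+ 3 == 1)%:R * q%:R - phi s - 1)).
  apply: eq_bigr => s s0; rewrite -(phi3 s) -sum_phi_mul2 ?expf_neq0 //.
  by apply: eq_bigr => a _; rewrite phiM.
rewrite !sumrB -mulr_suml sum_cube_one sum_nz sum_phi phi0 sum_nz sum_const; ring.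
Qed.

(** Modulo 2, phi is the indicator of the nonzero elements, and three values of s
    have s^3 = - 1. *)
Lemma class_sum0_odd : exists m : int, class_sum 0 = 2%:R * m + 1.
Proof.
pose e (x : K) : int := (phi x == 1)%:R - (x != 0)%:R.
have phie x : phi x = (x != 0)%:R + 2%:R * e x.
  rewrite /e; have [->|x0] := eqVneq x 0; first by rewrite phi0.
  by have [->|->] := phi_pm1 x0.
have B1 : 3%:R * class_sum 0 = q%:R - 1 - 3%:R + 2%:R * \sum_(s | s != 0) e (s ^+ 3 + 1).
  rewrite -cubic_phi_sum_class expr0 /cubic_phi_sum mulr_sumr.
  transitivity (\sum_(s : K | s != 0) (1 - (s ^+ 3 == -1)%:R + 2%:R * e (s ^+ 3 + 1))).
    by apply: eq_bigr => s s0; rewrite mul1r phie addr_eq0; case: (_ == _).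
  rewrite big_split /= sumrB sum_nz sum_const mulr1; congr (_ - _ + _).
  rewrite -sum_nz_opp -sum_cube_one; apply: eq_bigr => s s0; congr (nat_of_bool _)%:R.
  by rewrite -(inj_eq oppr_inj) opprK; congr (_ == _); ring.
have [r qr] : exists r, q = r.*2.+1 by exists q./2; rewrite -[LHS]odd_double_half q_odd.
exists (r%:R - 1 - 1 + \sum_(s | s != 0) e (s ^+ 3 + 1) - class_sum 0).
move: B1; set S := \sum_(s | _) _; have -> : (q%:R : int) = 2%:R * r%:R + 1 by rewrite qr -addn1 natrD -mul2n natrM.
lia.
Qed.

(** The sum of the three class sums is - 1 and the sum of their squares is
    (2 q + 1) / 3. Eliminating, 4 q = (3 c_0 + 1)^2 + 3 (c_1 - c_2)^2, and both
    squares are even because c_0 is odd. *)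
Lemma residual_sum_three_classes : exists x y : int,
  q%:R = x ^+ 2 + 3%:R * y ^+ 2 /\ residual_sum = 2%:R * x ^+ 2 - 6%:R * y ^+ 2 + 1.
Proof.
have [m Dm] := class_sum0_odd.
pose s := 3%:R * m + 2%:R.
have e4 : (4%:R * q%:R = (2%:R * s) ^+ 2 + 3%:R * (class_sum 1 - class_sum 2) ^+ 2 :> int).
  have := class_sum_squares; have := class_sum_total; rewrite /s.
  move: (class_sum 1) (class_sum 2) => d1 d2; rewrite Dm => h1; have -> : d2 = - 2%:R - 2%:R * m - d1 by lia.
  nia.
have [y Dy] : exists y : int, class_sum 1 - class_sum 2 = 2%:R * y.
  exists (- 1 - m - class_sum 2); have := class_sum_total; rewrite Dm; lia.
exists s, y; move: e4; rewrite Dy => e4; split; first by nia.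
rewrite residual_sum_classes; have := class_sum_total; move: Dy; rewrite Dm /s.
move: (class_sum 1) (class_sum 2) => d1 d2 h1 h2.
have -> : d1 = y - 1 - m by lia.
have -> : d2 = - y - 1 - m by lia.
ring.
Qed.
End CubicClasses.

Lemma residual_sum_1mod3 : (q %% 3 = 1)%N -> exists x y : int,
  q%:R = x ^+ 2 + 3%:R * y ^+ 2 /\ residual_sum = 2%:R * x ^+ 2 - 6%:R * y ^+ 2 + 1.
Proof.
by move=> q3; have [g g1 gen] := finField_generator K; exact: residual_sum_three_classes q3 g g1 gen.
Qed.

End FiniteField.

(** * The value of McCarthy's function *)

Section Evaluation.
Variables (p : nat) (p_pr : prime p).
Hypothesis p_gt3 : (3 < p)%N.
Local Notation G := (mcCarthyG p_pr [tuple 1 / 2; 1 / 3; 2 / 3] [tuple 0; 0; 0] 1).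

Lemma Fp_two0 : (2%:R : 'F_p) != 0.
Proof. by rewrite (Fp_nat_eq0 p_pr) gtnNdvd // ltnW. Qed.

Lemma Fp_three0 : (3%:R : 'F_p) != 0.
Proof. by rewrite (Fp_nat_eq0 p_pr) gtnNdvd. Qed.

Lemma Fp_odd : odd #|'F_p|.
Proof. by rewrite card_Fp //; case: (even_prime p_pr) p_gt3 => [->|->]. Qed.

Lemma point_count_cubic : (point_count p)%:R = cubic_count 'F_p.
Proof.
rewrite -(cubic_count_rescale Fp_two0 Fp_three0).
rewrite /point_count natr_sum; apply: eq_bigr => x _.
rewrite natr_sum; apply: eq_bigr => y _.
by rewrite natr_sum.
Qed.

Lemma mcCarthyG_residual : G = (residual_sum 'F_p - 1)%:~R.
Proof.
rewrite (mcCarthyG_point_count p_pr p_gt3).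
have := cubic_countE Fp_two0 Fp_three0 Fp_odd; rewrite -point_count_cubic card_Fp //.
move=> e; have -> : ((point_count p)%:R : padic p_pr) = ((point_count p)%:R : int)%:~R.
  by rewrite rmorph_nat.
rewrite e.
rewrite [(p ^ 2 + 5)%:R]pmulrn [(4 * p)%:R]pmulrn -!rmorphB /=; congr (_%:~R).
by rewrite -!natz natrD natrX natrM; ring.
Qed.

Lemma mcCarthyG_2mod3 : (p %% 3 = 2)%N -> G = 0.
Proof.
move=> p3; rewrite mcCarthyG_residual residual_sum_cube_inj ?subrr //.
- exact: Fp_two0.
- exact: Fp_three0.
- exact: Fp_odd.
- have c3 : (#|'F_p| %% 3 = 2)%N by rewrite card_Fp.
  exact: cube_inj Fp_two0 Fp_three0 Fp_odd c3.
Qed.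

Lemma mcCarthyG_1mod3 : (p %% 3 = 1)%N -> exists x y : int,
  p%:R = x ^+ 2 + 3%:R * y ^+ 2 /\ G = (2%:R * x ^+ 2 - 6%:R * y ^+ 2)%:~R.
Proof.
move=> p3; have [||||x [y [pE rE]]] := @residual_sum_1mod3 'F_p.
- exact: Fp_two0.
- exact: Fp_three0.
- exact: Fp_odd.
- by rewrite card_Fp.
by exists x, y; rewrite -pE card_Fp // mcCarthyG_residual rE addrK.
Qed.
End Evaluation.

(** * A truncation of Jacobi's identity for the cube of the Euler product *)

Section QBinomial.
Implicit Types m n k N : nat.
Local Notation P := {poly int}.

Definition euler_poly n : P := \prod_(1 <= i < n.+1) (1 - 'X^i).

Lemma euler_polyS n : euler_poly n.+1 = euler_poly n * (1 - 'X^(n.+1)).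
Proof. by rewrite /euler_poly big_nat_recr. Qed.

Lemma euler_poly0 : euler_poly 0 = 1.
Proof. by rewrite /euler_poly big_geq. Qed.

Lemma euler_poly_neq0 n : euler_poly n != 0.
Proof.
suff: (euler_poly n).[0] = 1 by apply: contra_eqN => /eqP->; rewrite horner0 eq_sym oner_eq0.
elim: n => [|n IH]; first by rewrite euler_poly0 hornerE.
by rewrite euler_polyS hornerM IH !hornerE expr0n subr0.
Qed.

(** Gaussian binomial coefficients, with X for q *)
Fixpoint qbin N m : P :=
  match N, m with
  | _, 0 => 1
  | 0, _.+1 => 0
  | N.+1, m.+1 => qbin N m + 'X^(m.+1) * qbin N m.+1
  end.

Lemma qbin0 N : qbin N 0 = 1. Proof. by case: N. Qed.

Lemma qbinS N m : qbin N.+1 m.+1 = qbin N m + 'X^(m.+1) * qbin N m.+1.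
Proof. by []. Qed.

Lemma qbin_small N m : (N < m)%N -> qbin N m = 0.
Proof.
elim: N m => [|N IH] [|m] //; rewrite ltnS => Nm.
by rewrite qbinS !IH ?mulr0 ?addr0 // ltnW.
Qed.

Lemma qbin_euler m k : euler_poly m * euler_poly k * qbin (m + k) m = euler_poly (m + k).
Proof.
move e : (m + k)%N => N; elim: N m k e => [|N IH] m k e.
  have [-> ->] : m = 0%N /\ k = 0%N by lia.
  by rewrite euler_poly0 !mulr1.
case: m e => [|m] e; first by rewrite qbin0 euler_poly0 mul1r mulr1 -e.
rewrite qbinS mulrDr; have -> : euler_poly m.+1 * euler_poly k * qbin N m =
    (1 - 'X^(m.+1)) * euler_poly N by rewrite -(IH m k) 1?euler_polyS; [ring|lia].
case: k e => [|k] e.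
  rewrite qbin_small ?mulr0 ?addr0; last by lia.
  by rewrite euler_polyS mulrC; congr (_ * (1 - 'X^_)); lia.
rewrite (euler_polyS k) [X in _ + X](_ : _ = 'X^(m.+1) * (1 - 'X^(k.+1)) * (euler_poly m.+1 * euler_poly k * qbin N m.+1)); last by ring.
rewrite IH; last by lia.
rewrite euler_polyS (_ : 'X^(N.+1) = 'X^(m.+1) * 'X^(k.+1)); last by rewrite -exprD; congr ('X^_); lia.
by ring.
Qed.

Lemma qbin_sym m k : qbin (m + k) m = qbin (m + k) k.
Proof.
have e0 : euler_poly m * euler_poly k != 0 by rewrite mulf_neq0 ?euler_poly_neq0.
apply: (mulfI e0); rewrite qbin_euler [euler_poly m * _]mulrC addnC.
by rewrite qbin_euler.
Qed.

Lemma qbinS_sym N m : (m <= N)%N -> qbin N.+1 m.+1 = 'X^(N - m) * qbin N m + qbin N m.+1.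
Proof.
move=> mN; have [k ->] : exists k, N = (m + k)%N by exists (N - m)%N; lia.
rewrite -addSn qbin_sym addKn; case: k {N mN} => [|k].
  by rewrite qbin_sym !qbin0 mul1r qbin_small ?addn0 // addr0.
by rewrite addSn qbinS -addSnnS -qbin_sym addSnnS -qbin_sym [RHS]addrC.
Qed.

Lemma qbin_step1 N : qbin N.+2 1 = (1 + 'X^(N.+1)) * qbin N 0 + 'X^1 * qbin N 1.
Proof.
by rewrite qbinS_sym // subn0 !qbin0 qbinS qbin0; ring.
Qed.

Lemma qbin_step N m : (m <= N)%N -> qbin N.+2 m.+2 =
  'X^(N - m) * qbin N m + (1 + 'X^(N.+1)) * qbin N m.+1 + 'X^(m.+2) * qbin N m.+2.
Proof.
move=> mN; rewrite qbinS_sym ?ltnS // subSS !qbinS mulrDr mulrA -exprD.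
by rewrite (_ : N - m + m.+1 = N.+1)%N; [ring|lia].
Qed.

Definition tri j := (j * j.+1 %/ 2)%N.

Lemma triE j : (tri j * 2 = j * j.+1)%N.
Proof. by rewrite /tri divnK // dvdn2 oddM /= andbN. Qed.

Lemma triS j : tri j.+1 = (tri j + j.+1)%N.
Proof. have := triE j; have := triE j.+1; lia. Qed.

Definition jacobi_term j : P := (-1) ^+ j * (2 * j + 1)%:R * 'X^(tri j).

Lemma jacobi_termS n j m : (j + m).+1 = n ->
  jacobi_term j.+2 * 'X^m + jacobi_term j * 'X^(2 * n + 1 - m) = - 2%:R * 'X^(n.+1) * jacobi_term j.+1.
Proof.
move=> e; rewrite /jacobi_term !triS.
have -> : (-1) ^+ j.+2 = (-1) ^+ j :> P by rewrite -addn2 exprD sqrrN expr1n mulr1.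
have -> : (-1) ^+ j.+1 = - (-1) ^+ j :> P by rewrite -addn1 exprD mulrN1.
rewrite -!mulrA -!exprD [_ * 'X^(_ + _)]mulrC.
rewrite [X in _ = - _ * X]mulrCA [_ 'X^(n.+1) _]mulrCA -exprD.
have -> : (n.+1 + (tri j + j.+1) = tri j + j.+1 + j.+2 + m)%N by lia.
have -> : (tri j + (2 * n + 1 - m) = tri j + j.+1 + j.+2 + m)%N by lia.
move: ('X^_) => Z.
rewrite (_ : 2 * j.+2 + 1 = 2 * j + 5)%N; last by lia.
rewrite (_ : 2 * j.+1 + 1 = 2 * j + 3)%N; last by lia.
rewrite !natrD; move: ((-1) ^+ j) => e0; ring.
Qed.

(** A finite form of Jacobi's identity. Denote by S_n the right-hand side. Applying
    the two Pascal rules to the binomials of S_(n+1) and collecting the multiples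
    of each binomial of S_n gives S_(n+1) = (1 - X^(n+1))^2 S_n; the boundary
    term j = 0 fits in by the symmetry of the binomial coefficients. *)
Lemma jacobi_finite n : euler_poly n ^+ 2 =
  \sum_(0 <= m < n.+1) jacobi_term (n - m) * qbin (2 * n + 1) m.
Proof.
elim: n => [|n IH].
  by rewrite euler_poly0 big_nat1 expr1n qbin0 /jacobi_term /tri /=; rewrite !mulr1.
rewrite euler_polyS exprMn IH (_ : 2 * n.+1 + 1 = (2 * n + 1).+2)%N; last by lia.
set N := (2 * n + 1)%N; set b := qbin N; set s := jacobi_term.
have -> : \sum_(0 <= m < n.+2) s (n.+1 - m)%N * qbin N.+2 m =
   \sum_(0 <= m < n.+2) s (n.+1 - m)%N * ('X^m * b m)
   + \sum_(0 <= m < n.+1) s (n - m)%N * ((1 + 'X^(N.+1)) * b m)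
   + \sum_(0 <= m < n) s (n - m.+1)%N * ('X^(N - m) * b m).
  pose u m := s (n.+1 - m)%N * ('X^m * b m).
  pose v m := s (n - m)%N * ((1 + 'X^(N.+1)) * b m).
  pose w m := s (n - m.+1)%N * ('X^(N - m) * b m).
  rewrite -[RHS]/(\sum_(0 <= m < n.+2) u m + \sum_(0 <= m < n.+1) v m + \sum_(0 <= m < n) w m).
  rewrite 2?[LHS]big_nat_recl // [X in _ + X = _]big_nat_recl //.
  rewrite [X in X + _ + _]big_nat_recl // [X in _ + X + _ + _]big_nat_recl //.
  rewrite [X in _ + X + _]big_nat_recl // qbin_step1.
  have -> : \sum_(0 <= i < n) s (n.+1 - i.+2)%N * qbin N.+2 i.+2 =
    \sum_(0 <= i < n) u i.+2 + \sum_(0 <= i < n) v i.+1 + \sum_(0 <= i < n) w i.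
    rewrite -!big_split; apply: eq_big_nat => i /andP[_ iN].
    rewrite -[RHS]/(u i.+2 + v i.+1 + w i).
    rewrite qbin_step; last by rewrite /N; lia.
    by rewrite /u /v /w subSS -/b; ring.
  by rewrite /u /v subSS !qbin0 /b !qbin0 subn0; ring.
have -> : \sum_(0 <= m < n.+2) s (n.+1 - m)%N * ('X^m * b m) =
    \sum_(0 <= m < n) s (n.+1 - m)%N * ('X^m * b m) - 2%:R * 'X^(n.+1) * b n.
  rewrite !big_nat_recr //= subnn subSnn -addrA; congr (_ + _).
  have -> : b n.+1 = b n by rewrite /b /N (_ : 2 * n + 1 = n + n.+1)%N ?qbin_sym //; lia.
  by rewrite /s /jacobi_term /tri /= (exprS _ n); ring.
have -> : \sum_(0 <= m < n) s (n.+1 - m)%N * ('X^m * b m) =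
   - 2%:R * 'X^(n.+1) * (\sum_(0 <= m < n) s (n - m)%N * b m) - \sum_(0 <= m < n) s (n - m.+1)%N * ('X^(N - m) * b m).
  rewrite mulr_sumr -sumrB; apply: eq_big_nat => m /andP[_ mn].
  apply/eqP; rewrite -subr_eq opprK; apply/eqP.
  have := @jacobi_termS n (n - m.+1)%N m; rewrite -/s -/N => /(_ ltac:(lia)).
  rewrite (_ : (n - m.+1).+2 = n.+1 - m)%N; last by lia.
  rewrite (_ : (n - m.+1).+1 = n - m)%N; last by lia.
  move=> h.
  transitivity ((s (n.+1 - m)%N * 'X^m + s (n - m.+1)%N * 'X^(N - m)) * b m); first by ring.
  by rewrite h; ring.
rewrite !big_nat_recr //= subnn [s 0%N](_ : _ = 1); last by rewrite /s /jacobi_term /tri /= !mulr1.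
have -> : \sum_(0 <= m < n) s (n - m)%N * ((1 + 'X^(N.+1)) * b m) =
    (1 + 'X^(N.+1)) * \sum_(0 <= m < n) s (n - m)%N * b m.
  by rewrite mulr_sumr; apply: eq_bigr => m _; ring.
rewrite (_ : 'X^(N.+1) = 'X^(n.+1) ^+ 2); last by rewrite -exprM; congr ('X^_); rewrite /N; lia.
move: (\sum_(_ <= m < _) s (n - m)%N * b m) => A; ring.
Qed.

Lemma euler_poly_cat n k : exists B : P,
  \prod_(n.+1 <= i < n.+1 + k) (1 - 'X^i) = 1 + 'X^(n.+1) * B.
Proof.
elim: k => [|k [B IH]]; first by exists 0; rewrite addn0 big_geq // mulr0 addr0.
exists (B - (1 + 'X^(n.+1) * B) * 'X^k).
by rewrite addnS big_nat_recr ?leq_addr //= IH exprD; ring.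
Qed.

(** The product is itself a product of factors 1 - X^i with i > m, all the factors
    with small i having cancelled. *)
Lemma qbin_euler_mod n m : (m <= n)%N -> exists B : P,
  qbin (2 * n + 1) m * euler_poly n = 1 + 'X^(m.+1) * B.
Proof.
move=> mn; have [k nk] : exists k, (2 * n + 1 = m + k)%N by exists (2 * n + 1 - m)%N; lia.
have split a c : euler_poly (a + c) = euler_poly a * \prod_(a.+1 <= i < a.+1 + c) (1 - 'X^i).
  by rewrite /euler_poly (big_cat_nat (n := a.+1)) // ?ltnS ?leq_addr // addSn.
have e : qbin (2 * n + 1) m * euler_poly n =
    (\prod_(m.+1 <= i < m.+1 + (n - m)) (1 - 'X^i)) * (\prod_(k.+1 <= i < k.+1 + m) (1 - 'X^i)).
  apply: (mulfI (euler_poly_neq0 m)); apply: (mulIf (euler_poly_neq0 k)).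
  have := qbin_euler m k; rewrite -nk => h.
  transitivity (euler_poly (2 * n + 1) * euler_poly n); first by rewrite -h; ring.
  by rewrite nk {1}addnC -{1}(subnKC mn) !split; ring.
have [B1 e1] := euler_poly_cat m (n - m).
have [B2 e2] := euler_poly_cat k m.
rewrite e e1 e2 (_ : k.+1 = m.+1 + (k - m))%N; last by lia.
by exists (B1 + 'X^(k - m) * B2 + B1 * 'X^(m.+1 + (k - m)) * B2); rewrite exprD; ring.
Qed.

Definition jacobi_poly n : P := \sum_(0 <= j < n.+1) jacobi_term j.

(** The error of the m-th term, j = n - m, starts at X^(tri j + n - j + 1), and
    tri j is at least j. *)
Lemma euler_poly_cube n : exists B : P, euler_poly n ^+ 3 = jacobi_poly n + 'X^(n.+1) * B.
Proof.
have step m : (m <= n)%N -> exists B : P,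
    \sum_(0 <= i < m.+1) jacobi_term (n - i) * qbin (2 * n + 1) i * euler_poly n =
    \sum_(0 <= i < m.+1) jacobi_term (n - i) + 'X^(n.+1) * B.
  have term i : (i <= n)%N -> exists B : P, jacobi_term (n - i) * qbin (2 * n + 1) i * euler_poly n
      = jacobi_term (n - i) + 'X^(n.+1) * B.
    move=> le_in; have [B e] := qbin_euler_mod le_in; rewrite -mulrA e.
    have t : (n - i <= tri (n - i))%N by have := triE (n - i); nia.
    exists ((-1) ^+ (n - i) * (2 * (n - i) + 1)%:R * 'X^(tri (n - i) - (n - i)) * B).
    rewrite mulrDr mulr1; congr (_ + _); rewrite /jacobi_term -(subnK t) {1}exprD addnK.
    rewrite (_ : 'X^(n.+1) = 'X^(n - i) * 'X^(i.+1)); last by rewrite -exprD; congr ('X^_); lia.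
    by ring.
  elim: m => [|m IH] mn; first by have [B e] := term 0%N isT; exists B; rewrite !big_nat1.
  have [B1 e1] := IH (ltnW mn); have [B2 e2] := term _ mn.
  by exists (B1 + B2); rewrite !(@big_nat_recr _ _ _ m.+1) //= e1 e2; ring.
have [B e] := step n (leqnn n); exists B.
rewrite exprSr jacobi_finite mulr_suml e; congr (_ + _).
rewrite /jacobi_poly [RHS]big_nat_rev /=; apply: eq_bigr => i _; congr (jacobi_term _); lia.
Qed.

(** The eta product, with each infinite product cut off after n factors *)
Definition eta_poly n : P :=
  'X * (euler_poly n \Po 'X^2) ^+ 3 * (euler_poly n \Po 'X^6) ^+ 3.

Definition eta_coef n r : int := \sum_(0 <= j < n.+1) \sum_(0 <= k < n.+1)
  ((-1) ^+ (j + k) * ((2 * j + 1) * (2 * k + 1))%:R) * (1 + j * j.+1 + 3 * (k * k.+1) == r)%N%:R.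

Lemma euler_poly_cube_comp n d : (0 < d)%N -> exists B : P,
  (euler_poly n \Po 'X^d) ^+ 3 =
  \sum_(0 <= j < n.+1) ((-1) ^+ j * (2 * j + 1)%:R)%:P * 'X^(d * tri j) + 'X^(n.+1) * B.
Proof.
move=> d0; have [B e] := euler_poly_cube n.
exists ('X^(d.-1 * n.+1) * (B \Po 'X^d)).
rewrite -rmorphXn /= e comp_polyD comp_polyM comp_Xn_poly mulrA -exprD -exprM.
congr (_ + 'X^_ * _); last by rewrite -mulSn prednK.
rewrite /jacobi_poly raddf_sum; apply: eq_bigr => j _.
rewrite -[LHS]/(jacobi_term j \Po 'X^d) /jacobi_term comp_polyM comp_Xn_poly -exprM; congr (_ * _).
by rewrite !(rmorphM, rmorphXn, rmorphN, rmorph1, rmorph_nat).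
Qed.

Lemma eta_polyE n r : (r <= n)%N -> (eta_poly n)`_r = eta_coef n r.
Proof.
move=> rn; have [B2 e2] := @euler_poly_cube_comp n 2 isT.
have [B6 e6] := @euler_poly_cube_comp n 6 isT.
rewrite /eta_poly e2 e6; set S2 := \sum_(_ <= _ < _) _; set S6 := \sum_(_ <= _ < _) _.
have -> : 'X * (S2 + 'X^(n.+1) * B2) * (S6 + 'X^(n.+1) * B6) =
  'X * (S2 * S6) + 'X^(n.+1) * ('X * (B2 * S6 + S2 * B6 + B2 * 'X^(n.+1) * B6)) by ring.
rewrite coefD coefXnM ltnS rn addr0 /S2 /S6 mulr_suml mulr_sumr coef_sum; apply: eq_bigr => j _.
rewrite mulr_sumr mulr_sumr coef_sum; apply: eq_bigr => k _.
set c := (_ * (2 * j + 1)%:R); set d := (_ * (2 * k + 1)%:R).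
rewrite (_ : 'X * _ = (c * d) *: 'X^(1 + j * j.+1 + 3 * (k * k.+1))).
  rewrite coefZ coefXn eq_sym; congr (_ * _).
  by rewrite /c /d exprD natrM mulrACA.
have -> : (1 + j * j.+1 + 3 * (k * k.+1) = 1 + 2 * tri j + 6 * tri k)%N.
  by have := triE j; have := triE k; lia.
have -> : (c * d) *: 'X^(1 + 2 * tri j + 6 * tri k) =
    c%:P * d%:P * ('X^1 * 'X^(2 * tri j) * 'X^(6 * tri k)).
  by rewrite -!exprD -mul_polyC -polyCM.
rewrite expr1; move: (c%:P) (d%:P) ('X^_) ('X^_) => c' d' U V; ring.
Qed.
End QBinomial.

(** * The representations of 4 p by the form c^2 + 3 a^2 *)
Section Representations.
Implicit Types x y u v : int.

Definition odd_idx u : nat := (`|u| %/ 2)%N.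

Lemma odd_idxE u : (u %% 2)%Z = 1 -> 2%:R * (odd_idx u)%:R + 1 = `|u|%:Z :> int.
Proof. by rewrite /odd_idx !natz; lia. Qed.

(** (-1)^k (2 k + 1) is the one of u and - u which is 1 modulo 4. *)
Lemma odd_idx_sign u m : u = 4%:R * m + 1 -> (-1) ^+ odd_idx u * (`|u|%N)%:Z = u :> int.
Proof.
move=> um; case: (lerP 0 m) => m0.
  have -> : odd_idx u = (2 * `|m|%N)%N by rewrite /odd_idx; lia.
  by rewrite exprM sqrrN !expr1n mul1r; lia.
have -> : odd_idx u = (2 * `|m|%N.-1).+1 by rewrite /odd_idx; lia.
by rewrite exprS exprM sqrrN !expr1n mulr1 mulN1r; lia.
Qed.

(** The signs cancel when u and v agree modulo 4. *)
Lemma odd_idx_sign2 u v y : (u %% 2)%Z = 1 -> u - v = 4%:R * y ->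
  (-1) ^+ (odd_idx u + odd_idx v) * ((2 * odd_idx u + 1) * (2 * odd_idx v + 1))%:R = u * v.
Proof.
move=> u2 uv; have v2 : (v %% 2)%Z = 1 by lia.
have -> : ((2 * odd_idx u + 1) * (2 * odd_idx v + 1))%:R = (`|u|%N)%:Z * (`|v|%N)%:Z :> int.
  rewrite -(odd_idxE u2) -(odd_idxE v2).
  by rewrite natrM; congr (_ * _); rewrite !natz; lia.
rewrite exprD mulrACA.
have N w : odd_idx (- w) = odd_idx w by rewrite /odd_idx abszN.
have [[m um]|[m um]] : (exists m, u = 4%:R * m + 1) \/ (exists m, - u = 4%:R * m + 1).
  have [h|h] : (u %% 4)%Z = 1 \/ (u %% 4)%Z = 3 by lia.
    by left; exists (u %/ 4)%Z; lia.
  by right; exists (- (u %/ 4)%Z - 1); lia.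
  rewrite (odd_idx_sign um) (@odd_idx_sign v (m - y)) //; lia.
rewrite -(N u) -(N v) -(abszN u) -(abszN v) (odd_idx_sign um) (@odd_idx_sign (- v) (m + y)); last by lia.
by rewrite mulrNN.
Qed.

Variables (p : nat) (p_pr : prime p).
Hypothesis p_gt3 : (3 < p)%N.
Variables x y : int.
Hypothesis pE : p%:R = x ^+ 2 + 3%:R * y ^+ 2.

Lemma rep_odd : ((x + y) %% 2)%Z = 1.
Proof.
have op : odd p by case: (even_prime p_pr) p_gt3 => [->|].
have : (p%:R = 2%:R * (p./2)%:R + 1 :> int).
  by rewrite -[in LHS](odd_double_half p) op natrD addrC -mul2n natrM.
rewrite pE => h.
have sq2 (u : int) : exists t, u ^+ 2 = u + 2%:R * t.
  have [e|e] : u = 2%:R * (u %/ 2)%Z \/ u = 2%:R * (u %/ 2)%Z + 1 by lia.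
    by exists (2%:R * (u %/ 2)%Z ^+ 2 - (u %/ 2)%Z); rewrite {1 2}e; ring.
  by exists (2%:R * (u %/ 2)%Z ^+ 2 + (u %/ 2)%Z); rewrite {1 2}e; ring.
have [t xt] := sq2 x; have [t' yt] := sq2 y; move: h; rewrite xt yt natz; lia.
Qed.

Lemma rep_neq0 : x != 0 /\ y != 0.
Proof.
split; apply/eqP => z0.
  have : (p %% 3 = 0)%N by have := pE; rewrite z0 natz; lia.
  move=> /eqP p3; have := p3; rewrite -/(dvdn 3 p) dvdn_prime2 // => /eqP; lia.
have e : (p = `|x| * `|x|)%N by have := pE; rewrite z0 natz; nia.
have : (`|x| %| p)%N by rewrite [X in (_ %| X)%N]e dvdn_mulr.
case/primeP: p_pr => p1 /[apply] /orP[] /eqP h; move: e; rewrite h => e.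
  by move: p_gt3; rewrite e.
by have := ltn_Pmull p1 (prime_gt0 p_pr); rewrite -e ltnn.
Qed.
End Representations.

Lemma small_sq (m : int) : 0 <= 4%:R - 3%:R * m ^+ 2 -> m = 0 \/ m = 1 \/ m = -1.
Proof.
move=> h; have h1 : m < 2 by rewrite ltNge; apply/negP => h2; nia.
have h2 : -2 < m by rewrite ltNge; apply/negP => h2; nia.
by lia.
Qed.

Lemma cross_odd (x y c a : int) : ((x + y) %% 2)%Z = 1 -> (c %% 2)%Z = 1 -> (a %% 2)%Z = 1 ->
  x * a - c * y <> 0.
Proof.
have odd_ex (u : int) : (u %% 2)%Z = 1 -> exists v, u = 2%:R * v + 1 by exists (u %/ 2)%Z; lia.
move=> xy2 /odd_ex[c' ->] /odd_ex[a' ->] e; move: xy2.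
have -> : x + y = 2%:R * (y + (c' * y - x * a')) by lia.
by move: (y + _) => t; lia.
Qed.

(** p divides (x a - c y) (x a + c y) = p (a^2 - 4 y^2); either factor determines
    (c, a), by composition of forms: (c x + 3 a y)^2 + 3 (x a - c y)^2 = 4 p^2. *)
Lemma rep_solve (p : nat) (x y c a m : int) : (0 < p)%N ->
  p%:R = x ^+ 2 + 3%:R * y ^+ 2 -> ((x + y) %% 2)%Z = 1 -> (c %% 2)%Z = 1 -> (a %% 2)%Z = 1 ->
  c ^+ 2 + 3%:R * a ^+ 2 = 4%:R * p%:R -> x * a - c * y = p%:R * m ->
  (`|c| = `|x - 3%:R * y| /\ `|a| = `|x + y|) \/ (`|c| = `|x + 3%:R * y| /\ `|a| = `|x - y|).
Proof.
move=> p0 pE xy2 c2 a2 cE mE.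
pose P : int := p%:R; have P0 : 0 < P by rewrite /P natz; lia.
pose s := c * x + 3%:R * a * y.
have sE : s ^+ 2 = (4%:R - 3%:R * m ^+ 2) * P ^+ 2.
  transitivity ((c ^+ 2 + 3%:R * a ^+ 2) * (x ^+ 2 + 3%:R * y ^+ 2) - 3%:R * (x * a - c * y) ^+ 2).
    by rewrite /s; ring.
  by rewrite cE -pE mE /P; ring.
have m1 : m = 0 \/ m = 1 \/ m = -1.
  have : 0 <= (4%:R - 3%:R * m ^+ 2) * P ^+ 2 by rewrite -sE sqr_ge0.
  rewrite pmulr_lge0 ?exprn_gt0 // => h.
  by apply: small_sq.
have cP : c * P = x * s - 3%:R * y * (P * m) by rewrite -mE /P pE /s; ring.
have aP : a * P = x * (P * m) + y * s by rewrite -mE /P pE /s; ring.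
have Pn : P != 0 by rewrite gt_eqF.
have m0 : m != 0.
  apply/eqP => m0; move: mE; rewrite m0 mulr0 => e.
  by case: (cross_odd xy2 c2 a2 e).
have mm : m ^+ 2 = 1 by case: m1 m0 => [->|[->|->]] //; rewrite eqxx.
have : s ^+ 2 == P ^+ 2 by rewrite sE mm; apply/eqP; ring.
rewrite eqf_sqr => /orP[] /eqP sP.
  have c1 : c = x - 3%:R * y * m by apply: (mulIf Pn); rewrite cP sP; ring.
  have a1 : a = x * m + y by apply: (mulIf Pn); rewrite aP sP; ring.
  by case: m1 m0 c1 a1 => [->|[->|->]] //; rewrite ?eqxx // ?mulr1 => _ -> ->; clear; lia.
have c1 : c = - x - 3%:R * y * m by apply: (mulIf Pn); rewrite cP sP; ring.
have a1 : a = x * m - y by apply: (mulIf Pn); rewrite aP sP; ring.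
by case: m1 m0 c1 a1 => [->|[->|->]] //; rewrite ?eqxx // ?mulr1 => _ -> ->; clear; lia.
Qed.

Lemma odd_natE (j : nat) : ((2%:R * j%:R + 1) %% 2 = 1 :> int)%Z.
Proof. by rewrite natz; lia. Qed.

Lemma odd_idx_uniq (j : nat) (u : int) : `|2%:R * j%:R + 1 : int| = `|u| -> j = odd_idx u.
Proof. by rewrite natz /odd_idx; lia. Qed.

Lemma absz_dvd (p q : nat) (t : int) : `|t|%N = (q * p)%N -> exists m : int, t = p%:R * m.
Proof.
move=> tq; have [h|h] := lerP 0 t; [exists q%:R|exists (- q%:R)]; rewrite !natz; move: tq;
  have : (q * p)%N%:Z = q%:Z * p%:Z by [].
  by move: (q%:Z * p%:Z) => w; lia.
by move=> e tq; rewrite mulrN mulrC -e -tq; lia.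
Qed.

(** The two solutions come from the two ways of multiplying x + y sqrt(-3) by a
    sixth root of unity that is not in Z[sqrt(-3)]. *)
Lemma rep_unique (p : nat) (p_pr : prime p) (p_gt3 : (3 < p)%N) (x y : int) (j k : nat) :
  p%:R = x ^+ 2 + 3%:R * y ^+ 2 ->
  (2%:R * j%:R + 1) ^+ 2 + 3%:R * (2%:R * k%:R + 1) ^+ 2 = 4%:R * p%:R :> int ->
  j = odd_idx (x + 3%:R * y) /\ k = odd_idx (x - y) \/
  j = odd_idx (x - 3%:R * y) /\ k = odd_idx (x + y).
Proof.
move=> pE; have := odd_natE j; have := odd_natE k.
have := @odd_idx_uniq j; have := @odd_idx_uniq k.
move: (2%:R * j%:R + 1 : int) (2%:R * k%:R + 1 : int) => c a ka jc a2 c2 e.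
have xy2 := rep_odd p_pr p_gt3 pE.
have : (p %| absz (x * a - c * y)%R * absz (x * a + c * y)%R)%N.
  rewrite -abszM; apply/dvdnP; exists (absz (a ^+ 2 - 4%:R * y ^+ 2)%R).
  rewrite -{1}(absz_nat p) -abszM; congr absz; rewrite -[Posz p]natz.
  transitivity (a ^+ 2 * (x ^+ 2 + 3%:R * y ^+ 2) - (c ^+ 2 + 3%:R * a ^+ 2) * y ^+ 2); first by ring.
  by rewrite -pE e; ring.
rewrite Euclid_dvdM // => /orP[] /dvdnP[q /absz_dvd[m mE]].
  have [[/jc -> /ka ->]|[/jc -> /ka ->]] := rep_solve (prime_gt0 p_pr) pE xy2 c2 a2 e mE.
    by right.
  by left.
have pE' : p%:R = x ^+ 2 + 3%:R * (- y) ^+ 2 by rewrite sqrrN.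
have xy2' : ((x + - y) %% 2)%Z = 1 by clear -xy2; lia.
have mE' : x * a - c * (- y) = p%:R * m by rewrite mulrN opprK.
have [[/jc -> /ka ->]|[/jc -> /ka ->]] := rep_solve (prime_gt0 p_pr) pE' xy2' c2 a2 e mE'.
  by rewrite mulrN opprK; left.
by rewrite mulrN opprK; right.
Qed.

Lemma eta_cond_le j k r : (1 + j * j.+1 + 3 * (k * k.+1) = r)%N -> (j <= r)%N /\ (k <= r)%N.
Proof. by move=> <-; rewrite !mulnS; split; nia. Qed.

Section EtaCoefficient.
Variables (p : nat) (p_pr : prime p).
Hypothesis p_gt3 : (3 < p)%N.

Lemma eta_condE j k : (1 + j * j.+1 + 3 * (k * k.+1) == p)%N =
  ((2%:R * j%:R + 1) ^+ 2 + 3%:R * (2%:R * k%:R + 1) ^+ 2 == 4%:R * p%:R :> int).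
Proof. by rewrite !natz; apply/eqP/eqP; nia. Qed.

Lemma eta_coef_2mod3 n : (p %% 3 = 2)%N -> eta_coef n p = 0.
Proof.
move=> p3; rewrite /eta_coef big1 // => j _; rewrite big1 // => k _.
case: eqP => [e|]; last by rewrite mulr0.
have [t [tE|tE]] : exists t, (j * j.+1 = 3 * t \/ j * j.+1 = 3 * t + 2)%N.
  have [r [->|->|->]] : exists r, [\/ j = 3 * r, j = 3 * r + 1 | j = 3 * r + 2]%N.
  + by exists (j %/ 3)%N; have := ltn_pmod j (isT : 0 < 3)%N; have := divn_eq j 3; case: (j %% 3)%N => [|[|[|]]] // ? _; [constructor 1|constructor 2|constructor 3]; lia.
  + by exists (r * (3 * r).+1)%N; left; lia.
  + by exists (3 * r * r + 3 * r)%N; right; lia.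
  + by exists ((3 * r + 2) * r.+1)%N; left; lia.
  by exfalso; move: e; rewrite tE; move: (k * _)%N => s; lia.
by exfalso; move: e; rewrite tE; move: (k * _)%N => s; lia.
Qed.

Lemma sum_delta2 n j k (f : nat -> nat -> int) : (j <= n)%N -> (k <= n)%N ->
  \sum_(0 <= i < n.+1) \sum_(0 <= l < n.+1) f i l * ((i == j) && (l == k))%:R = f j k.
Proof.
move=> jn kn; rewrite (bigD1_seq j) ?mem_index_iota ?iota_uniq //= [X in _ + X]big1 ?addr0; last first.
  by move=> i /negbTE ij; rewrite big1 // => l _; rewrite ij mulr0.
rewrite (bigD1_seq k) ?mem_index_iota ?iota_uniq //= !eqxx mulr1 big1 ?addr0 //.
by move=> l /negbTE lk; rewrite lk andbF mulr0.
Qed.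

Lemma eta_coef_1mod3 n (x y : int) : (p <= n)%N -> p%:R = x ^+ 2 + 3%:R * y ^+ 2 ->
  eta_coef n p = 2%:R * x ^+ 2 - 6%:R * y ^+ 2.
Proof.
move=> pn pE; have xy2 := rep_odd p_pr p_gt3 pE.
have [x0 y0] := rep_neq0 p_pr p_gt3 pE.
pose j1 := odd_idx (x + 3%:R * y); pose k1 := odd_idx (x - y).
pose j2 := odd_idx (x - 3%:R * y); pose k2 := odd_idx (x + y).
have oj1 : ((x + 3%:R * y) %% 2)%Z = 1 by lia.
have ok1 : ((x - y) %% 2)%Z = 1 by lia.
have oj2 : ((x - 3%:R * y) %% 2)%Z = 1 by lia.
have sqa (u : int) : (`|u|%N%:Z) ^+ 2 = u ^+ 2 by rewrite abszE real_normK // num_real.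
have cond1 : (1 + j1 * j1.+1 + 3 * (k1 * k1.+1) == p)%N.
  by rewrite eta_condE !odd_idxE // !sqa pE; apply/eqP; ring.
have cond2 : (1 + j2 * j2.+1 + 3 * (k2 * k2.+1) == p)%N.
  by rewrite eta_condE !odd_idxE // !sqa pE; apply/eqP; ring.
have le j k : (1 + j * j.+1 + 3 * (k * k.+1) == p)%N -> (j <= n)%N /\ (k <= n)%N.
  by move=> /eqP/eta_cond_le[jp kp]; split; exact: leq_trans pn.
have [j1n k1n] := le _ _ cond1; have [j2n k2n] := le _ _ cond2.
have ne : j1 != j2.
  apply/eqP => e; have := odd_idxE oj2; rewrite -/j2 -e odd_idxE //.
  by clear -x0 y0; lia.
have condP j k : (1 + j * j.+1 + 3 * (k * k.+1) == p)%N%:R =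
    ((j == j1) && (k == k1))%:R + ((j == j2) && (k == k2))%:R :> int.
  case: (boolP ((j == j1) && (k == k1))) => [/andP[/eqP -> /eqP ->]|n1].
    by rewrite cond1 (negbTE ne).
  case: (boolP ((j == j2) && (k == k2))) => [/andP[/eqP -> /eqP ->]|n2].
    by rewrite cond2.
  case: (boolP (_ == p)) => //; rewrite eta_condE => /eqP e; exfalso.
  have [[jj kk]|[jj kk]] := rep_unique p_pr p_gt3 pE e.
    by move: n1; rewrite jj kk !eqxx.
  by move: n2; rewrite jj kk !eqxx.
rewrite /eta_coef.
under eq_bigr => j _.
  under eq_bigr => k _ do rewrite condP mulrDr.
  rewrite big_split /=; over.
rewrite big_split /= (sum_delta2 (fun j k => (-1) ^+ (j + k) * ((2 * j + 1) * (2 * k + 1))%:R)) //.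
rewrite (sum_delta2 (fun j k => (-1) ^+ (j + k) * ((2 * j + 1) * (2 * k + 1))%:R)) //.
rewrite (@odd_idx_sign2 _ _ y) //; last by ring.
rewrite (@odd_idx_sign2 _ _ (- y)) //; last by ring.
ring.
Qed.
End EtaCoefficient.

(** * Comparison of the two expansions of the eta product *)
Section EulerProduct.
Variable R : realType.
Implicit Types (x y : R) (n k N : nat).

Definition euler_prod x N : R := \prod_(1 <= n < N) (1 - x ^+ n).
Definition euler_lim x : R := limn (euler_prod x).

Lemma euler_prodS x N : (0 < N)%N -> euler_prod x N.+1 = euler_prod x N * (1 - x ^+ N).
Proof. by move=> N0; rewrite /euler_prod big_nat_recr. Qed.

Lemma euler_prod_bounds x N : 0 <= x <= 1 -> 0 <= euler_prod x N <= 1.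
Proof.
move=> /andP[x0 x1]; elim: N => [|N /andP[h0 h1]]; first by rewrite /euler_prod big_geq // ler01 lexx.
case: N h0 h1 => [|N] h0 h1; first by rewrite /euler_prod big_geq // ler01 lexx.
have a0 : 0 <= x ^+ N.+1 by rewrite exprn_ge0.
have a1 : x ^+ N.+1 <= 1 by rewrite exprn_ile1.
by rewrite euler_prodS // mulr_ge0 ?subr_ge0 //= mulr_ile1 ?subr_ge0 // gerBl.
Qed.

Lemma euler_prod_noninc x : 0 <= x <= 1 -> nonincreasing_seq (euler_prod x).
Proof.
move=> x01; apply/nonincreasing_seqP => N; case: N => [|N].
  by rewrite /euler_prod !big_geq.
have /andP[h0 _] := euler_prod_bounds N.+1 x01; move/andP: x01 => [x0 x1].
by rewrite euler_prodS // ler_piMr // gerBl exprn_ge0.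
Qed.

Lemma euler_prod_cvg x : 0 <= x <= 1 -> cvgn (euler_prod x).
Proof.
move=> x01; apply: nonincreasing_is_cvgn; first exact: euler_prod_noninc.
by exists 0 => _ [N _ <-]; case/andP: (euler_prod_bounds N x01).
Qed.

(** All partial products lie in [0, 1], so that the factor 1 - x^N lowers them by
    at most x^N; the last term on the left makes the induction go through. *)
Lemma euler_prod_tail x n k : 0 <= x -> x <= 2^-1 ->
  euler_prod x n.+1 - 2 * x ^+ n.+1 + 2 * x ^+ (n.+1 + k) <= euler_prod x (n.+1 + k).
Proof.
move=> x0 x1; elim: k => [|k IH]; first by rewrite addn0 subrK.
have x01 : 0 <= x <= 1 by rewrite x0 (le_trans x1) //; lra.
have /andP[h0 h1] := euler_prod_bounds (n.+1 + k) x01.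
rewrite addnS (@euler_prodS x (n.+1 + k)) //.
have a0 : 0 <= x ^+ (n.+1 + k) by rewrite exprn_ge0.
have : 2 * x ^+ (n.+1 + k).+1 <= x ^+ (n.+1 + k).
  rewrite exprS mulrA -[leRHS]mul1r ler_wpM2r //; lra.
have : euler_prod x (n.+1 + k) * x ^+ (n.+1 + k) <= x ^+ (n.+1 + k) by rewrite ler_piMl.
rewrite mulrBr mulr1; move: IH.
move: (x ^+ (n.+1 + k).+1) (x ^+ (n.+1 + k)) (euler_prod x (n.+1 + k)) => a b c.
move: (c * b) => d; lra.
Qed.

Lemma euler_lim_bounds x : 0 <= x <= 1 -> 0 <= euler_lim x <= 1.
Proof.
move=> x01; apply/andP; split.
  apply: limr_ge; first exact: euler_prod_cvg.
  by apply: nearW => N; case/andP: (euler_prod_bounds N x01).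
have := nonincreasing_cvgn_ge (euler_prod_noninc x01) (euler_prod_cvg x01) 0%N.
by rewrite {2}/euler_prod big_geq.
Qed.

Lemma euler_lim_approx x n : 0 <= x -> x <= 2^-1 ->
  `|euler_lim x - euler_prod x n.+1| <= 2 * x ^+ n.+1.
Proof.
move=> x0 x1; have x01 : 0 <= x <= 1 by rewrite x0 (le_trans x1) //; lra.
have h1 := nonincreasing_cvgn_ge (euler_prod_noninc x01) (euler_prod_cvg x01) n.+1.
have h2 : euler_prod x n.+1 - 2 * x ^+ n.+1 <= euler_lim x.
  apply: limr_ge; first exact: euler_prod_cvg.
  exists n.+1 => // N /= nN; rewrite -(subnKC nN).
  apply: le_trans (euler_prod_tail n (N - n.+1) x0 x1).
  by rewrite lerDl mulr_ge0 ?exprn_ge0.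
rewrite -/(euler_lim x) in h1.
rewrite ler_norml; apply/andP; split; lra.
Qed.

(** The eta product at z = i t, as a function of x = exp (- 2 pi t) *)
Definition eta_real x : R := x * euler_lim (x ^+ 2) ^+ 3 * euler_lim (x ^+ 6) ^+ 3.

Lemma horner_euler_poly n d x :
  (map_poly intr (euler_poly n \Po 'X^d)).[x] = euler_prod (x ^+ d) n.+1 :> R.
Proof.
rewrite map_comp_poly horner_comp map_polyXn hornerXn /euler_poly rmorph_prod horner_prod.
by apply: eq_bigr => i _; rewrite rmorphB /= rmorph1 map_polyXn !hornerE.
Qed.

Lemma horner_eta_poly n x : (map_poly intr (eta_poly n)).[x] =
  x * euler_prod (x ^+ 2) n.+1 ^+ 3 * euler_prod (x ^+ 6) n.+1 ^+ 3 :> R.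
Proof. by rewrite /eta_poly rmorphM [X in X * _]rmorphM !rmorphXn /= map_polyX hornerM [X in X * _]hornerM hornerX !horner_exp !horner_euler_poly. Qed.

Lemma cube_diff (a c : R) : 0 <= a <= 1 -> 0 <= c <= 1 -> `|a ^+ 3 - c ^+ 3| <= 3 * `|a - c|.
Proof.
move=> /andP[a0 a1] /andP[c0 c1].
rewrite (_ : a ^+ 3 - c ^+ 3 = (a ^+ 2 + a * c + c ^+ 2) * (a - c)); last by ring.
have h0 : 0 <= a ^+ 2 + a * c + c ^+ 2 by rewrite !addr_ge0 ?mulr_ge0 ?sqr_ge0.
rewrite normrM ler_wpM2r // ger0_norm //.
have h1 : a ^+ 2 <= 1 by rewrite exprn_ile1.
have h2 : c ^+ 2 <= 1 by rewrite exprn_ile1.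
have h3 : a * c <= 1 by rewrite mulr_ile1.
lra.
Qed.

Lemma eta_real_approx n x : 0 <= x -> x <= 2^-1 ->
  `|eta_real x - (map_poly intr (eta_poly n)).[x]| <= 12 * x ^+ n.+1.
Proof.
move=> x0 x1; have x2 : x <= 1 by lra.
have pow d : (0 < d)%N -> [/\ 0 <= x ^+ d, x ^+ d <= x & x ^+ d <= 2^-1].
  move=> d0; have h : x ^+ d <= x by rewrite -{2}(expr1 x) ler_wiXn2l.
  by split; rewrite ?exprn_ge0 // (le_trans h).
have [y0 yx y1] := pow 2 isT; have [z0 zx z1] := pow 6 isT.
rewrite /eta_real horner_eta_poly; move: (x ^+ 2) (x ^+ 6) y0 yx y1 z0 zx z1 => y z y0 yx y1 z0 zx z1.
have y01 : 0 <= y <= 1 by rewrite y0; lra.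
have z01 : 0 <= z <= 1 by rewrite z0; lra.
have ha := euler_lim_approx n y0 y1; have hb := euler_lim_approx n z0 z1.
have {}ha : `|euler_lim y - euler_prod y n.+1| <= 2 * x ^+ n.+1.
  by apply: le_trans ha _; rewrite ler_wpM2l // lerXn2r.
have {}hb : `|euler_lim z - euler_prod z n.+1| <= 2 * x ^+ n.+1.
  by apply: le_trans hb _; rewrite ler_wpM2l // lerXn2r.
have := euler_lim_bounds y01; have := euler_lim_bounds z01.
have := euler_prod_bounds n.+1 y01; have := euler_prod_bounds n.+1 z01.
move: (euler_lim y) (euler_lim z) (euler_prod y _) (euler_prod z _) ha hb => a c A D ha hb D01 A01 c01 a01.
have h3a := cube_diff a01 A01; have h3c := cube_diff c01 D01.
rewrite (_ : _ - _ = x * ((a ^+ 3 - A ^+ 3) * c ^+ 3 + A ^+ 3 * (c ^+ 3 - D ^+ 3))); last by ring.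
move: c01 A01 => /andP[c0 c1] /andP[A0 A1].
have c3 : `|c ^+ 3| <= 1 by rewrite ger0_norm ?exprn_ge0 ?exprn_ile1.
have A3 : `|A ^+ 3| <= 1 by rewrite ger0_norm ?exprn_ge0 ?exprn_ile1.
rewrite normrM; apply: le_trans (_ : `|(a ^+ 3 - A ^+ 3) * c ^+ 3 + A ^+ 3 * (c ^+ 3 - D ^+ 3)| <= _).
  by rewrite ler_piMl // ger0_norm.
apply: le_trans (ler_normD _ _) _; rewrite [`|_ * c ^+ 3|]normrM [`|A ^+ 3 * _|]normrM.
have : `|a ^+ 3 - A ^+ 3| * `|c ^+ 3| <= `|a ^+ 3 - A ^+ 3| by rewrite ler_piMr.
have : `|A ^+ 3| * `|c ^+ 3 - D ^+ 3| <= `|c ^+ 3 - D ^+ 3| by rewrite ler_piMl.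
lra.
Qed.
End EulerProduct.

Section CoefficientComparison.
Variable R : realType.
Implicit Types (x : R) (p : {poly R}).

Lemma horner_bounded p : exists2 S : R, 0 <= S & forall x, 0 <= x <= 1 -> `|p.[x]| <= S.
Proof.
exists (\sum_(i < size p) `|p`_i|); first by rewrite sumr_ge0.
move=> x /andP[x0 x1]; rewrite horner_coef; apply: le_trans (ler_norm_sum _ _ _) _.
apply: ler_sum => i _; rewrite normrM ler_piMr // ger0_norm ?exprn_ge0 //.
by rewrite exprn_ile1.
Qed.

(** A polynomial which is O(x^n) near 0 has no coefficients below n: divide by x
    after letting x tend to 0. *)
Lemma small_poly_coef n p (B r : R) : 0 < r ->
  (forall x, 0 < x <= r -> `|p.[x]| <= B * x ^+ n) -> forall i, (i < n)%N -> p`_i = 0.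
Proof.
move=> r0; elim: n p => [//|n IH] p small.
have [q [c pE]] : exists q c, p = q * 'X + c%:P.
  by elim/poly_ind: p {small} => [|q c _]; [exists 0, 0; rewrite mul0r addr0|exists q, c].
have [S S0 Sq] := horner_bounded q.
have c0 : c = 0.
  apply/eqP; rewrite -normr_eq0 eq_le normr_ge0 andbT; apply/ler_addgt0Pr => e e0.
  rewrite add0r; pose T := `|B| + S + 1.
  have T0 : 0 < T by rewrite ltr_wpDl // addr_ge0.
  pose x := Num.min (Num.min r 1) (e / T).
  have x0 : 0 < x by rewrite !lt_min r0 ltr01 divr_gt0.
  have xr : x <= r by rewrite /x !ge_min lexx.
  have x1 : x <= 1 by rewrite /x !ge_min lexx orbT.
  have xe : x * T <= e by rewrite -ler_pdivlMr // /x ge_min lexx orbT.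
  have h1 := small x; rewrite x0 xr in h1; have {}h1 := h1 isT.
  have h2 := Sq x; rewrite (ltW x0) x1 in h2; have {}h2 := h2 isT.
  have xn : x ^+ n.+1 <= x by rewrite -{2}(expr1 x) ler_wiXn2l // ltW.
  have h3 : B * x ^+ n.+1 <= `|B| * x.
    apply: le_trans (_ : `|B| * x ^+ n.+1 <= _); last by rewrite ler_wpM2l.
    by rewrite ler_wpM2r ?ler_norm // exprn_ge0 // ltW.
  have h4 : `|q.[x] * x| <= S * x by rewrite normrM (gtr0_norm x0) ler_wpM2r // ltW.
  have h5 : `|c| <= `|p.[x]| + `|q.[x] * x|.
    have -> : c = p.[x] - q.[x] * x by rewrite pE hornerMXaddC addrAC subrr add0r.
    exact: ler_normB.
  have : x * T = `|B| * x + S * x + x by rewrite /T; ring.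
  lra.
case=> [|i] iN; first by rewrite pE coefD coefMX coefC c0 addr0.
rewrite pE coefD coefMX coefC /= addr0; apply: (IH q) => // x /andP[x0 xr].
have e : `|p.[x]| = `|q.[x]| * x by rewrite pE hornerMXaddC c0 addr0 normrM (gtr0_norm x0).
by have := small x; rewrite x0 xr e exprSr mulrA ler_pM2r // => ->.
Qed.

(** Convergence at 1/2 bounds the coefficients by a multiple of 2^i, so that the
    tail at x <= 1/4 is dominated by a geometric series of ratio 2 x <= 1/2. *)
Lemma power_series_tail (b : nat -> R) (l : R -> R) :
  (forall x, 0 < x < 1 -> (\sum_(1 <= n < N) b n * x ^+ n) @[N --> \oo] --> l x) ->
  forall n, exists B : R, forall x, 0 < x <= 4^-1 ->
    `|l x - \sum_(1 <= i < n.+1) b i * x ^+ i| <= B * x ^+ n.+1.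
Proof.
move=> cv n; have half : 0 < (2^-1 : R) < 1 by lra.
have [M M0 bM] : exists2 M : R, 0 <= M & forall i, (0 < i)%N -> `|b i * 2^-1 ^+ i| <= M.
  have /cvg_seq_bounded[M [_ bM]] : cvgn (fun N => \sum_(1 <= n < N) b n * (2^-1 : R) ^+ n).
    by apply/cvg_ex; exists (l 2^-1); exact: cv.
  have {}bM N := bM (`|M| + 1) (le_lt_trans (ler_norm M) (ltr_pwDr ltr01 (lexx _))) N I.
  exists (`|M| + 1 + (`|M| + 1)); first by rewrite !addr_ge0.
  move=> i i0; have -> : b i * 2^-1 ^+ i = \sum_(1 <= n < i.+1) b n * (2^-1 : R) ^+ n
      - \sum_(1 <= n < i) b n * (2^-1 : R) ^+ n.
    by rewrite big_nat_recr //= addrAC subrr add0r.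
  by apply: le_trans (ler_normB _ _) _; apply: lerD; apply: bM.
exists (2 * M * 2 ^+ n.+1) => x /andP[x0 x4].
have y0 : 0 <= 2 * x by lra.
have tail k : `|\sum_(1 <= i < n.+1 + k) b i * x ^+ i - \sum_(1 <= i < n.+1) b i * x ^+ i|
    <= 2 * M * (2 * x) ^+ n.+1 - 2 * M * (2 * x) ^+ (n.+1 + k).
  elim: k => [|k IH]; first by rewrite addn0 !subrr normr0.
  rewrite addnS big_nat_recr /=; last by rewrite addSn.
  set m := (n.+1 + k)%N in IH *; rewrite addrAC.
  apply: le_trans (ler_normD _ _) _.
  have h : `|b m * x ^+ m| <= M * (2 * x) ^+ m.
    have -> : b m * x ^+ m = b m * 2^-1 ^+ m * (2 * x) ^+ m.
      by rewrite -mulrA -exprMn mulrA mulVf ?mul1r // pnatr_eq0.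
    by rewrite normrM [`|(2 * x) ^+ m|]ger0_norm ?exprn_ge0 // ler_wpM2r ?exprn_ge0 ?bM.
  have h2 : 2 * M * (2 * x) ^+ m.+1 <= M * (2 * x) ^+ m.
    rewrite exprS -subr_ge0 (_ : _ - _ = M * (2 * x) ^+ m * (1 - 4 * x)); last by ring.
    by rewrite !mulr_ge0 ?exprn_ge0 //; lra.
  apply: le_trans (lerD IH h) _; lra.
rewrite (_ : _ * x ^+ n.+1 = 2 * M * (2 * x) ^+ n.+1); last by rewrite exprMn mulrA.
apply/ler_addgt0Pr => e e0.
have x1 : 0 < x < 1 by rewrite x0; lra.
have /cvgrPdist_lt/(_ e e0)[N _ NP] := cv x x1.
have := NP (n.+1 + N)%N (leq_addl _ _); have := tail N.
have : 0 <= 2 * M * (2 * x) ^+ (n.+1 + N) by rewrite !mulr_ge0 ?exprn_ge0.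
set s := \sum_(1 <= i < n.+1 + N) _ => h0 h1 h2.
rewrite (_ : l x - _ = (l x - s) + (s - \sum_(1 <= i < n.+1) b i * x ^+ i)); last by ring.
apply: le_trans (ler_normD _ _) _; rewrite /= -/s in h2; lra.
Qed.

(** The partial sum of the series and the truncated product are polynomials that
    agree up to O(x^(n+1)). *)
Lemma eta_real_coef (b : nat -> int) :
  (forall x, 0 < x < 1 -> (\sum_(1 <= n < N) (b n)%:~R * x ^+ n) @[N --> \oo] --> eta_real x) ->
  forall n i, (0 < i <= n)%N -> b i = (eta_poly n)`_i.
Proof.
move=> cv n i /andP[i0 iN]; have [B hB] := power_series_tail cv n.
pose p : {poly R} := \poly_(i < n.+1) (if i == 0%N then 0 else (b i)%:~R) - map_poly intr (eta_poly n).
have small x : 0 < x <= 4^-1 -> `|p.[x]| <= (B + 12) * x ^+ n.+1.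
  move=> x4; have h1 := hB x x4; case/andP: x4 => x0 x4.
  have x2 : x <= 2^-1 by lra.
  have h2 := eta_real_approx n (ltW x0) x2.
  rewrite /p hornerD hornerN horner_poly.
  have -> : \sum_(i < n.+1) (if i == 0%N :> nat then 0 else (b i)%:~R) * x ^+ i =
     \sum_(1 <= i < n.+1) (b i)%:~R * x ^+ i.
    rewrite -(big_mkord xpredT (fun i => (if i == 0%N then 0 else (b i)%:~R) * x ^+ i)).
    rewrite big_nat_recl // eqxx mul0r add0r big_add1 /=.
    by apply: eq_bigr => j _.
  move: h1 h2; set s := \sum_(_ <= _ < _) _; set f := eta_real x; set g := _.[x] => h1 h2.
  rewrite (_ : s - g = (f - g) - (f - s)); last by ring.
  apply: le_trans (ler_normB _ _) _; lra.
have r0 : 0 < (4^-1 : R) by lra.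
have := small_poly_coef r0 small (iN : (i < n.+1)%N).
rewrite /p coefB coef_poly ltnS iN gtn_eqF // coef_map /= => /eqP.
by rewrite subr_eq0 eqr_int => /eqP.
Qed.
End CoefficientComparison.

Section ImaginaryAxis.
Variable R : realType.
Implicit Types (x t : R).
Local Notation cx x := (Complex x 0 : R[i]).

Lemma cxE x : cx x = (x%:C)%C. Proof. by []. Qed.

Lemma norm_cx x : `|cx x| = cx `|x|.
Proof. by rewrite normc_def /= expr0n addr0 sqrtr_sqr. Qed.

Lemma cvg_cx (u : nat -> R) (l : R) :
  ((cx (u n) : R[i]^o) @[n --> \oo] --> (cx l : R[i]^o)) <-> u @ \oo --> l.
Proof.
have dist n : `|(cx l : R[i]^o) - cx (u n)| = cx `|l - u n|.
  by rewrite -norm_cx; congr `|_|; rewrite !cxE -rmorphB.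
split=> /cvgrPdist_lt h; apply/cvgrPdist_lt => e e0.
  have ce : 0 < (cx e : R[i]) by rewrite !cxE ltcR.
  by have := h _ ce; apply: filterS => n /=; rewrite dist !cxE ltcR.
case: e e0 => e1 e2; rewrite ltcE /= => /andP[/eqP -> e0].
by have := h _ e0; apply: filterS => n /= hn; rewrite dist !cxE ltcR.
Qed.

Lemma expi2pi_iy t : expi2pi (Complex 0 t) = cx (expR (- (2 * pi * t))).
Proof. by rewrite /expi2pi /= mulr0 cos0 sin0 mulr1 mulr0. Qed.

Lemma iy_natM n t : n%:R * Complex 0 t = Complex 0 (n%:R * t) :> R[i].
Proof.
rewrite !mulr_natl; elim: n => [|n IH]; first by rewrite !mulr0n.
by rewrite !mulrS IH; apply/eqP; rewrite eq_complex /= addr0 !eqxx.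
Qed.

Lemma eta_iy t : 0 < t -> dedekind_eta (Complex 0 t) =
  cx (expR (- (2 * pi * (t / 24))) * euler_lim (expR (- (2 * pi * t)))).
Proof.
move=> t0; rewrite /dedekind_eta expi2pi_iy.
have -> : (Complex 0 t : R[i]) / 24 = Complex 0 (t / 24).
  have e24 : (24 : R[i]) != 0 by rewrite pnatr_eq0.
  apply: (mulIf e24); rewrite divfK // mulrC iy_natM mulrC divfK // pnatr_eq0.
rewrite expi2pi_iy; set q := expR (- (2 * pi * t)).
have q01 : 0 <= q <= 1.
  by rewrite expR_ge0 /= -expR0 ler_expR oppr_le0 !mulr_ge0 ?pi_ge0 // ltW.
have -> : (fun N => \prod_(1 <= n < N) (1 - (cx q) ^+ n)) = (fun N => cx (euler_prod q N)).
  apply/funext => N; rewrite /euler_prod !cxE rmorph_prod; apply: eq_bigr => n _.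
  by rewrite rmorphB rmorph1 rmorphXn.
rewrite (cvg_lim (@norm_hausdorff _ _) (_ : _ --> (cx (euler_lim q) : R[i]^o))).
  by rewrite !cxE -rmorphM.
by apply/cvg_cx; exact: euler_prod_cvg.
Qed.

Lemma eta_product_real (b : nat -> int) :
  (forall z : R[i], 0 < complex.Im z ->
      (\sum_(1 <= n < N) (b n)%:~R * expi2pi z ^+ n : R[i]^o) @[N --> \oo] -->
      (dedekind_eta (6 * z) ^+ 3 * dedekind_eta (2 * z) ^+ 3 : R[i]^o)) ->
  forall x, 0 < x < 1 -> (\sum_(1 <= n < N) (b n)%:~R * x ^+ n) @[N --> \oo] --> eta_real x.
Proof.
move=> h x x01; have x0 : 0 < x by case/andP: x01.
pose t := - ln x / (2 * pi).
have pi0 : 0 < (2 * pi : R) by rewrite mulr_gt0 // pi_gt0.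
have t0 : 0 < t by rewrite divr_gt0 // oppr_gt0 ln_lt0.
have tx : expR (- (2 * pi * t)) = x.
  by rewrite /t mulrC divfK ?gt_eqF // opprK lnK.
have txn n : expR (- (2 * pi * (n%:R * t))) = x ^+ n.
  by rewrite -tx -expRM_natl; congr expR; ring.
have := h (Complex 0 t) t0.
have t6 : 0 < 6 * t by rewrite mulr_gt0.
have t2 : 0 < 2 * t by rewrite mulr_gt0.
rewrite !iy_natM (eta_iy t6) (eta_iy t2) !txn.
rewrite expi2pi_iy tx.
have -> : cx (expR (- (2 * pi * (6 * t / 24))) * euler_lim (x ^+ 6)) ^+ 3 *
    cx (expR (- (2 * pi * (2 * t / 24))) * euler_lim (x ^+ 2)) ^+ 3 = cx (eta_real x).
  rewrite !cxE -!rmorphXn -rmorphM /=; congr (_%:C)%C.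
  rewrite !exprMn -!expRM_natl mulrACA -expRD /eta_real.
  rewrite (_ : _ + _ = - (2 * pi * t)); last by field.
  by rewrite tx; ring.
have -> : (fun N => \sum_(1 <= n < N) (b n)%:~R * (cx x) ^+ n) =
    (fun N => cx (\sum_(1 <= n < N) (b n)%:~R * x ^+ n)).
  apply/funext => N; rewrite !cxE rmorph_sum; apply: eq_bigr => n _.
  by rewrite rmorphM rmorphXn rmorph_int.
by move/cvg_cx.
Qed.
End ImaginaryAxis.

Lemma eta_coefficients (R : realType) (b : nat -> int) :
  (forall z : R[i], 0 < complex.Im z ->
      (\sum_(1 <= n < N) (b n)%:~R * expi2pi z ^+ n : R[i]^o) @[N --> \oo] -->
      (dedekind_eta (6 * z) ^+ 3 * dedekind_eta (2 * z) ^+ 3 : R[i]^o)) ->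
  forall n, (0 < n)%N -> b n = eta_coef n n.
Proof.
move=> /eta_product_real/eta_real_coef h n n0; rewrite (h n) ?n0 ?leqnn //.
exact: eta_polyE.
Qed.

Theorem theorem1p5 (R : realType) (p : nat) (p_pr : prime p) (p_gt3 : (3 < p)%N)
    (b : nat -> int)
    (b_def : forall z : R[i], 0 < complex.Im z ->
      (\sum_(1 <= n < N) (b n)%:~R * expi2pi z ^+ n : R[i]^o) @[N --> \oo] -->
      (dedekind_eta (6 * z) ^+ 3 * dedekind_eta (2 * z) ^+ 3 : R[i]^o)) :
  mcCarthyG p_pr [tuple 1 / 2; 1 / 3; 2 / 3] [tuple 0; 0; 0] 1 = (b p)%:~R.
Proof.
rewrite (eta_coefficients b_def (prime_gt0 p_pr)).
have [p0|[p1|p2]] : (p %% 3 = 0 \/ p %% 3 = 1 \/ p %% 3 = 2)%N.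
- by have := ltn_pmod p (isT : 0 < 3)%N; case: (p %% 3)%N => [|[|[|]]] //; tauto.
- by move: p0 => /eqP; rewrite -/(dvdn 3 p) dvdn_prime2 // => /eqP p3; rewrite -p3 in p_gt3.
- have [x [y [pE ->]]] := mcCarthyG_1mod3 p_pr p_gt3 p1.
  by rewrite (eta_coef_1mod3 p_pr p_gt3 (leqnn p) pE).
by rewrite (mcCarthyG_2mod3 p_pr p_gt3 p2) (eta_coef_2mod3 p_pr p_gt3 p p2).
Qed.
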